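(* Let $p \geq 3$ be an even integer, let $\lambda \in \mathbb{R}$ with $|\lambda| \geq 1$, and let $f_{\lambda} : \mathbb{C} \to \mathbb{C}$ be the entire function $$f_{\lambda}(z) = \lambda \sum_{k=0}^{p-1} \exp(\omega_p^k z), \qquad \omega_p = \exp(2\pi i/p).$$ Then $J(f_{\lambda}) = \mathbb{C}$.
   Context: For a transcendental entire function $f$, $f^n$ denotes the $n$th iterate of $f$. The Fatou set $F(f)$ is the set of points $z \in \mathbb{C}$ such that $\{f^n\}_{n\in\mathbb{N}}$ is a normal family (in the usual sense, with respect to the spherical metric, so that locally uniform convergence to $\infty$ is allowed) in some neighbourhood of $z$. The Julia set is $J(f) = \mathbb{C} \setminus F(f)$. *)

(* Defs.v *)
(* Stdlib reals with Coquelicot's complex numbers [C] and their topology. *)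
From Stdlib Require Import Reals.
From Coquelicot Require Import Coquelicot.

Open Scope R_scope.

(* exp (x + i y) = e^x (cos y + i sin y) *)
Definition Cexp (z : C) : C :=
  (exp (Re z) * cos (Im z), exp (Re z) * sin (Im z)).

(* The Riemann sphere; [None] is the point at infinity. *)
Definition Chat : Type := option C.

(* Euclidean distance in R^3 of the points of the unit sphere that correspond
   to [a] and [b] under stereographic projection. *)
Definition chordal_dist (a b : Chat) : R :=
  match a, b with
  | Some z, Some w =>
      2 * Cmod (z - w)%C / (sqrt (1 + Cmod z ^ 2) * sqrt (1 + Cmod w ^ 2))
  | Some z, None => 2 / sqrt (1 + Cmod z ^ 2)
  | None, Some w => 2 / sqrt (1 + Cmod w ^ 2)
  | None, None => 0
  end.

(* Great-circle distance: an arc of length s of the unit circle has a chord of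
   length 2 sin (s / 2). *)
Definition spherical_dist (a b : Chat) : R := 2 * asin (chordal_dist a b / 2).

Definition cv_locally_uniformly
    (U : C -> Prop) (g : nat -> C -> C) (h : C -> Chat) : Prop :=
  forall z : C, U z ->
  exists V : C -> Prop, locally z V /\
    forall eps : R, 0 < eps ->
    eventually (fun n : nat =>
      forall w : C, U w -> V w -> spherical_dist (Some (g n w)) (h w) < eps).

Definition normal_family (U : C -> Prop) (F : (C -> C) -> Prop) : Prop :=
  forall g : nat -> C -> C, (forall k : nat, F (g k)) ->
  exists phi : nat -> nat,
    (forall k : nat, (phi k < phi (S k))%nat) /\
    exists h : C -> Chat, cv_locally_uniformly U (fun k => g (phi k)) h.

Definition iterates (f : C -> C) (g : C -> C) : Prop :=
  exists n : nat, g = Nat.iter n f.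

Definition Fatou (f : C -> C) (z : C) : Prop :=
  exists U : C -> Prop, open U /\ U z /\ normal_family U (iterates f).

Definition Julia (f : C -> C) (z : C) : Prop := ~ Fatou f z.

Definition omega (p : nat) : C := Cexp (2 * PI * Ci / INR p)%C.

Definition f_lambda (p : nat) (lambda : R) (z : C) : C :=
  (lambda * sum_n (fun k : nat => Cexp (omega p ^ k * z)) (p - 1))%C.

(* Main.v *)
Require Import Defs.
From Stdlib Require Import Reals Lra Lia Factorial Classical.
From Coquelicot Require Import Coquelicot.
From mathcomp Require all_boot all_algebra complex Rstruct.

(**
   Write [f = f_lambda p lambda], so that [f z = lambda * esum p 0 z], where
   [esum p i z] is the sum over the [p]-th roots of unity [w] of
   [w^i exp (w z)] and is the [i]-th derivative of [esum p 0].  The real axis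
   is invariant under [f], and real points escape to infinity since
   [|f x| >= |x| + 1] there.  The proof has two halves: preimages of the real
   axis are dense, and the iterates are not normal at any such preimage.

   Density ([disc_meets_real_preimage]).  As a function of [z^p], [f] has only
   real critical points, hence real critical values, so it is a covering of the
   complement of the real axis and can only expand hyperbolic lengths.  The
   quantitative form used here is [esum_expansion_even]:
   [|z| |Im f(z)| <= |Re z| |Im z| |f'(z)|].  To prove it,
   note that [exp u] is the limit of [(1 + u/M)^M], which turns the sums into
   the polynomials [sec], every [p]-th term of the binomial expansion.  A
   recursion confines their values to sectors ([sec_sector]), so those that give
   the derivative have no zero in the upper half-plane.  After factorization
   their modulus increases upwards along vertical rays
   ([stable_poly_vertical]), and the mean value theorem yields the inequality
   ([sec_expansion]).
   If all iterates omitted the real axis on a disc of radius [r] around [z0],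
   they would map it into a half-plane, and [|(f^n)'(z0)| / |Im f^n(z0)|] would
   be at most [2/r] ([half_plane_bound], a form of the Schwarz-Pick lemma).
   These quotients increase, so the expansion factors along the orbit tend to
   [1], which forces the orbit towards the real direction.  Far out in this
   direction [f] is close to [lambda * exp], for which a factor near [1] is only
   possible at small height above the axis, while small heights are at least
   doubled at each step: a contradiction.

   Non-normality.  Suppose the iterates are normal near [z1] and [f^N(z1)] is
   real.  Then [f^n(z1)] tends to infinity, and normality gives a disc around
   [z1] on which infinitely many iterates satisfy [|f^n| >= 1].  There
   [ln |f^n|] is a nonnegative harmonic function, so its values at two points
   near [z1] are comparable with a factor independent of [n] ([log_harnack]).
   Every iterate takes its values with finite order ([power_like]), so [f^N]
   takes another real value, of different modulus, near [z1]
   ([other_real_modulus]).  But two real orbits with different moduli separate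
   so fast that the quotient of their logarithms is unbounded
   ([real_orbits_log_gap]).

   Both uses of harmonic functions rest on [gradient_bound], that
   [r |grad u| <= 2 u] at the centre of a disc of radius [r] on which the
   harmonic function [u] is nonnegative.
*)

(** * Factorization of complex polynomials *)

Fixpoint peval (l : list C) (z : C) : C :=
  match l with
  | nil => 0%C
  | (c :: l)%list => (c + z * peval l z)%C
  end.

Fixpoint prod_roots (rs : list C) (z : C) : C :=
  match rs with
  | nil => 1%C
  | (r :: rs)%list => ((z - r) * prod_roots rs z)%C
  end.

Module FTA.
Import all_boot all_algebra complex Rstruct.
Import GRing.Theory.
Local Open Scope ring_scope.

Definition toM (z : C) : R[i] := Complex (fst z) (snd z).
Definition toC (z : R[i]) : C := (complex.Re z, complex.Im z).

Lemma toMK z : toC (toM z) = z. Proof. by case: z. Qed.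
Lemma toC_add z w : toC (z + w) = Cplus (toC z) (toC w). Proof. by case: z; case: w. Qed.
Lemma toC_opp z : toC (- z) = Copp (toC z). Proof. by case: z. Qed.
Lemma toC_mul z w : toC (z * w) = Cmult (toC z) (toC w).
Proof. by case: z => a b; case: w => c d. Qed.

Fixpoint mpoly (l : seq C) : {poly R[i]} :=
  if l is c :: l then (toM c)%:P + 'X * mpoly l else 0.

Lemma eval_mpoly l z : toC (mpoly l).[toM z] = peval l z.
Proof.
elim: l => [|c l IH] /=; first by rewrite horner0.
by rewrite !hornerE toC_add toC_mul IH !toMK.
Qed.

(** Transports the factorization over the algebraically closed field [R[i]]
    along the identification [toC] of [R[i]] with pairs of reals. *)
Lemma factor l : exists (c : C) (rs : list C),
  forall z, peval l z = Cmult c (prod_roots rs z).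
Proof.
have [rs E] := closed_field_poly_normal (mpoly l).
exists (toC (lead_coef (mpoly l))), [seq toC r | r <- rs] => z.
rewrite -eval_mpoly E hornerZ toC_mul -E; congr Cmult.
elim: rs {E} => [|r rs IH] /=; first by rewrite big_nil hornerE.
by rewrite big_cons hornerM toC_mul IH !hornerE toC_add toC_opp toMK.
Qed.
End FTA.

(** * Complex derivatives *)

(** The real differential of [v] at [z] is encoded as the complex number [d] for
    which it sends [h] to [Re (d h)]; composing with a holomorphic map then
    multiplies [d] by the complex derivative of that map. *)
Definition grad (v : C -> R) (z d : C) : Prop :=
  differentiable_pt_lim (fun x y => v (x, y)) (Re z) (Im z) (Re d) (- Im d).

(** The Cauchy-Riemann equations are built in: the differential of [Im g] is
    that of [Re g] turned by [- Ci]. *)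
Definition Cderiv (g : C -> C) (z d : C) : Prop :=
  grad (fun w => Re (g w)) z d /\ grad (fun w => Im (g w)) z (- Ci * d)%C.

Definition Rcont (v : C -> R) (z : C) : Prop :=
  continuity_2d_pt (fun x y => v (x, y)) (Re z) (Im z).

Definition Ccont (g : C -> C) (z : C) : Prop :=
  Rcont (fun w => Re (g w)) z /\ Rcont (fun w => Im (g w)) z.

Lemma C_eta (z : C) : (Re z, Im z) = z.
Proof. now destruct z. Qed.

Lemma C_ext (z w : C) : Re z = Re w -> Im z = Im w -> z = w.
Proof. destruct z, w; simpl; intros; now f_equal. Qed.

Lemma grad_eq v w z d e :
  (forall y, v y = w y) -> d = e -> grad v z d -> grad w z e.
Proof.
  intros H <-. apply differentiable_pt_lim_ext.
  exists (mkposreal 1 Rlt_0_1); intros; apply H.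
Qed.

Lemma Cderiv_eq f g z d e :
  (forall y, f y = g y) -> d = e -> Cderiv f z d -> Cderiv g z e.
Proof.
  intros H <- [H1 H2]; split; [eapply grad_eq; [| |apply H1] | eapply grad_eq; [| |apply H2]];
    trivial; intros y; cbn beta; now rewrite H.
Qed.

Lemma grad_op2 F v1 v2 z a b d1 d2 :
  differentiable_pt_lim F (v1 z) (v2 z) a b -> grad v1 z d1 -> grad v2 z d2 ->
  grad (fun w => F (v1 w) (v2 w)) z (a * d1 + b * d2)%C.
Proof.
  unfold grad; intros H H1 H2.
  rewrite <- (C_eta z) in H at 1 2.
  pose proof (differentiable_pt_lim_comp F _ _ _ _ _ _ _ _ _ _ H H1 H2) as K.
  cbn in K |- *; unfold Re, Im in K |- *.
  match goal with |- differentiable_pt_lim _ _ _ ?p ?q =>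
    match type of K with differentiable_pt_lim _ _ _ ?r ?s =>
    replace p with r by ring; replace q with s by ring end end.
  exact K.
Qed.

Lemma grad_comp v g z d e :
  grad v (g z) d -> Cderiv g z e -> grad (fun w => v (g w)) z (d * e)%C.
Proof.
  intros H [H1 H2].
  apply (grad_eq (fun w => v (Re (g w), Im (g w))) _ z (Re d * e + - Im d * (- Ci * e))%C).
  - intros; now rewrite C_eta.
  - apply C_ext; cbn; unfold Re, Im; ring.
  - rewrite <- RtoC_opp.
    exact (grad_op2 (fun x y => v (x, y)) _ _ z _ _ _ _ H H1 H2).
Qed.

Lemma Cderiv_comp f g z d e :
  Cderiv f (g z) d -> Cderiv g z e -> Cderiv (fun w => f (g w)) z (d * e)%C.
Proof.
  intros [H1 H2] H; split.
  - exact (grad_comp (fun w => Re (f w)) g z _ _ H1 H).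
  - replace (- Ci * (d * e))%C with ((- Ci * d) * e)%C by ring.
    exact (grad_comp (fun w => Im (f w)) g z _ _ H2 H).
Qed.

Lemma differentiable_plus x y : differentiable_pt_lim Rplus x y 1 1.
Proof.
  intros eps. exists (mkposreal 1 Rlt_0_1); intros u v _ _.
  replace (u + v - (x + y) - (1 * (u - x) + 1 * (v - y))) with 0 by ring.
  rewrite Rabs_R0. apply Rmult_le_pos; [apply Rlt_le, cond_pos|].
  apply Rle_trans with (1 := Rabs_pos (u - x)), Rmax_l.
Qed.

Lemma differentiable_mult x y : differentiable_pt_lim Rmult x y y x.
Proof.
  intros eps. exists eps; intros u v Hu Hv.
  replace (u * v - x * y - (y * (u - x) + x * (v - y))) with ((u - x) * (v - y)) by ring.
  rewrite Rabs_mult. apply Rmult_le_compat; try apply Rabs_pos; [now apply Rlt_le|apply Rmax_r].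
Qed.

Lemma differentiable_fst f x y l :
  is_derive f x l -> differentiable_pt_lim (fun u _ => f u) x y l 0.
Proof. intros H; apply differentiable_pt_lim_proj1_0. now apply is_derive_Reals. Qed.

Lemma grad_const c z : grad (fun _ => c) z 0.
Proof.
  intros eps. exists (mkposreal 1 Rlt_0_1); intros u v _ _. cbn.
  match goal with |- Rabs ?e <= _ => replace e with 0 by ring end.
  rewrite Rabs_R0.
  apply Rmult_le_pos; [apply Rlt_le, cond_pos|].
  apply Rle_trans with (1 := Rabs_pos (u - Re z)), Rmax_l.
Qed.

Lemma grad_Re z : grad Re z 1.
Proof.
  unfold grad; cbn. rewrite Ropp_0.
  apply differentiable_fst. apply (is_derive_id (K := R_AbsRing)).
Qed.

Lemma grad_Im z : grad Im z (- Ci)%C.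
Proof.
  unfold grad; cbn. rewrite Ropp_0, Ropp_involutive.
  intros eps. exists (mkposreal 1 Rlt_0_1); intros u v _ _.
  match goal with |- Rabs ?e <= _ => replace e with 0 by (cbn; unfold Re, Im; ring) end.
  rewrite Rabs_R0. apply Rmult_le_pos; [apply Rlt_le, cond_pos|].
  apply Rle_trans with (1 := Rabs_pos (u - Re z)), Rmax_l.
Qed.

Lemma grad_comp1 f v z l d :
  is_derive f (v z) l -> grad v z d -> grad (fun w => f (v w)) z (l * d)%C.
Proof.
  intros H Hv.
  apply (grad_eq (fun w => f (v w)) _ z (l * d + 0 * d)%C); [trivial|ring|].
  apply (grad_op2 (fun u _ => f u) v v z l 0 d d); trivial. now apply differentiable_fst.
Qed.

Lemma grad_plus v w z d e :
  grad v z d -> grad w z e -> grad (fun y => v y + w y) z (d + e)%C.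
Proof.
  intros H1 H2. eapply grad_eq; [reflexivity| |apply (grad_op2 Rplus _ _ _ _ _ _ _ (differentiable_plus _ _) H1 H2)].
  ring.
Qed.

Lemma grad_mult v w z d e :
  grad v z d -> grad w z e -> grad (fun y => v y * w y) z (w z * d + v z * e)%C.
Proof.
  intros H1 H2. exact (grad_op2 Rmult _ _ _ _ _ _ _ (differentiable_mult _ _) H1 H2).
Qed.

Lemma grad_opp v z d : grad v z d -> grad (fun y => - v y) z (- d)%C.
Proof.
  intros H. eapply grad_eq; [| |apply (grad_mult _ _ _ _ _ (grad_const (-1) z) H)].
  - intros; cbn; ring.
  - apply C_ext; cbn; unfold Re, Im; ring.
Qed.

Lemma Cderiv_const c z : Cderiv (fun _ => c) z 0.
Proof.
  split; [apply grad_const|].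
  eapply grad_eq; [| |apply (grad_const (Im c))]; [trivial|ring].
Qed.

Lemma Cderiv_id z : Cderiv (fun w => w) z 1.
Proof.
  split; [apply grad_Re|].
  eapply grad_eq; [| |apply grad_Im]; [trivial|ring].
Qed.

Lemma Cderiv_plus f g z d e :
  Cderiv f z d -> Cderiv g z e -> Cderiv (fun w => f w + g w)%C z (d + e)%C.
Proof.
  intros [H1 H2] [H3 H4]; split.
  - exact (grad_plus _ _ _ _ _ H1 H3).
  - replace (- Ci * (d + e))%C with (- Ci * d + - Ci * e)%C by ring.
    exact (grad_plus _ _ _ _ _ H2 H4).
Qed.

Lemma Cderiv_mult f g z d e :
  Cderiv f z d -> Cderiv g z e -> Cderiv (fun w => f w * g w)%C z (d * g z + f z * e)%C.
Proof.
  intros [H1 H2] [H3 H4]; split.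
  - eapply grad_eq;
      [| |apply (grad_plus _ _ _ _ _ (grad_mult _ _ _ _ _ H1 H3)
                   (grad_opp _ _ _ (grad_mult _ _ _ _ _ H2 H4)))].
    + intros; cbn; unfold Re, Im; ring.
    + apply C_ext; cbn; unfold Re, Im; ring.
  - eapply grad_eq;
      [| |apply (grad_plus _ _ _ _ _ (grad_mult _ _ _ _ _ H1 H4)
                   (grad_mult _ _ _ _ _ H2 H3))].
    + intros; cbn; unfold Re, Im; ring.
    + apply C_ext; cbn; unfold Re, Im; ring.
Qed.

Lemma Cderiv_scal c g z d : Cderiv g z d -> Cderiv (fun w => c * g w)%C z (c * d)%C.
Proof.
  intros H. eapply Cderiv_eq; [| |apply (Cderiv_mult _ _ _ _ _ (Cderiv_const c z) H)];
    [trivial|ring].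
Qed.

Lemma Cderiv_minus f g z d e :
  Cderiv f z d -> Cderiv g z e -> Cderiv (fun w => f w - g w)%C z (d - e)%C.
Proof.
  intros H1 H2.
  eapply Cderiv_eq; [| |apply (Cderiv_plus _ _ _ _ _ H1 (Cderiv_scal (-1) _ _ _ H2))];
    intros; cbn beta; ring.
Qed.

Lemma norm2_pos (z : C) : z <> 0%C -> 0 < Re z * Re z + Im z * Im z.
Proof.
  intros H. destruct (Req_dec (Re z) 0) as [A|A].
  - destruct (Req_dec (Im z) 0) as [B|B].
    + exfalso; apply H, C_ext; [exact A|exact B].
    + nra.
  - nra.
Qed.

Lemma grad_norm2 z : grad (fun w => Re w * Re w + Im w * Im w) z (2 * Cconj z)%C.
Proof.
  eapply grad_eq; [| |apply (grad_plus _ _ _ _ _ (grad_mult _ _ _ _ _ (grad_Re z) (grad_Re z))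
    (grad_mult _ _ _ _ _ (grad_Im z) (grad_Im z)))]; [trivial|].
  apply C_ext; cbn; unfold Re, Im; ring.
Qed.

Lemma Cderiv_inv (z : C) : z <> 0%C -> Cderiv Cinv z (- / (z * z))%C.
Proof.
  intros Hz. pose proof (norm2_pos z Hz) as Hp.
  set (n := fun w => Re w * Re w + Im w * Im w). pose proof (grad_norm2 z) as Hn. fold n in Hn.
  assert (Hi : grad (fun w => / n w) z (- / (n z * n z) * (2 * Cconj z))%C).
  { replace (- / (n z * n z))%C with (RtoC (- / (n z * n z))).
    2: { rewrite RtoC_opp, RtoC_inv, RtoC_mult; [trivial|]. unfold n; nra. }
    apply grad_comp1; trivial.
    assert (n z <> 0) by (unfold n; lra).
    auto_derive; [trivial|]. field; trivial. }
  assert (Hzz : (z * z)%C <> 0%C) by (now apply Cmult_neq_0).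
  split.
  - eapply grad_eq; [| |apply (grad_mult _ _ _ _ _ (grad_Re z) Hi)].
    + intros w; unfold n, Cinv; cbn. unfold Rdiv. f_equal. f_equal. unfold Re, Im; ring.
    + apply C_ext; cbn; unfold n, Re, Im in *; cbn; field; repeat split; nra.
  - eapply grad_eq; [| |apply (grad_opp _ _ _ (grad_mult _ _ _ _ _ (grad_Im z) Hi))].
    + intros w; unfold n, Cinv; cbn. unfold Rdiv. rewrite <- Ropp_mult_distr_l. f_equal. f_equal. f_equal. unfold Re, Im; ring.
    + apply C_ext; cbn; unfold n, Re, Im in *; cbn; field; repeat split; nra.
Qed.

(** The chain rule along a real path with coordinates [a] and [b]. *)
Lemma grad_path v a b t d a' b' :
  grad v (a t, b t) d -> is_derive a t a' -> is_derive b t b' ->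
  is_derive (fun s => v (a s, b s)) t (Re (d * (a', b'))%C).
Proof.
  intros H Ha Hb. apply is_derive_Reals.
  replace (Re (d * (a', b'))%C) with (Re d * a' + - Im d * b') by (cbn; unfold Re, Im; ring).
  apply (derivable_pt_lim_comp_2d (fun x y => v (x, y))); trivial;
    now apply is_derive_Reals.
Qed.

Lemma grad_cont v z d : grad v z d -> Rcont v z.
Proof.
  intros H. apply differentiable_continuity_pt. eexists; eexists; exact H.
Qed.

Lemma Cderiv_cont g z d : Cderiv g z d -> Ccont g z.
Proof. intros [H1 H2]; split; eapply grad_cont; eassumption. Qed.

Lemma Rcont_eq v w z : (forall y, v y = w y) -> Rcont v z -> Rcont w z.
Proof. intros H; apply continuity_2d_pt_ext; intros; apply H. Qed.

Lemma Ccont_eq f g z : (forall y, f y = g y) -> Ccont f z -> Ccont g z.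
Proof.
  intros H [H1 H2]; split; [eapply Rcont_eq; [|exact H1] | eapply Rcont_eq; [|exact H2]];
    intros; cbn beta; now rewrite H.
Qed.

Lemma Rcont_eps v z :
  Rcont v z <->
  forall eps, 0 < eps -> exists del, 0 < del /\
    forall w, Cmod (w - z) < del -> Rabs (v w - v z) < eps.
Proof.
  split.
  - intros H eps He. destruct (H (mkposreal eps He)) as [del Hd].
    exists del; split; [apply cond_pos|]. intros w Hw.
    pose proof (Rmax_Cmod (w - z)%C) as M.
    rewrite <- (C_eta w), <- (C_eta z). apply Hd.
    + apply Rle_lt_trans with (2 := Hw). apply Rle_trans with (2 := M). apply Rmax_l.
    + apply Rle_lt_trans with (2 := Hw). apply Rle_trans with (2 := M). apply Rmax_r.
  - intros H eps. destruct (H eps (cond_pos eps)) as [del [Hd K]].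
    assert (Hd2 : 0 < del / 2) by lra.
    exists (mkposreal _ Hd2); cbn; intros u w Hu Hw.
    rewrite (C_eta z). apply K.
    apply Rle_lt_trans with (1 := Cmod_2Rmax _). cbn.
    fold (Re z) (Im z).
    assert (sqrt 2 < 2) by (rewrite <- (sqrt_pow2 2) at 2; [apply sqrt_lt_1|]; lra).
    pose proof (sqrt_pos 2).
    assert (Rmax (Rabs (u + - Re z)) (Rabs (w + - Im z)) < del / 2) by (apply Rmax_lub_lt; trivial).
    assert (0 <= Rmax (Rabs (u + - Re z)) (Rabs (w + - Im z))) by (eapply Rle_trans; [apply (Rabs_pos (u + - Re z))|apply Rmax_l]).
    nra.
Qed.

Lemma Rcont_comp v g z : Rcont v (g z) -> Ccont g z -> Rcont (fun w => v (g w)) z.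
Proof.
  rewrite !Rcont_eps. intros H [H1 H2] eps He.
  destruct (H eps He) as [d [Hd K]].
  rewrite !Rcont_eps in H1, H2.
  destruct (H1 (d / 2)) as [d1 [Hd1 K1]]; [lra|].
  destruct (H2 (d / 2)) as [d2 [Hd2 K2]]; [lra|].
  exists (Rmin d1 d2); split; [now apply Rmin_pos|].
  intros w Hw. apply K.
  apply Rle_lt_trans with (1 := Cmod_2Rmax _).
  assert (A1 : Rabs (Re (g w) - Re (g z)) < d / 2) by (apply K1; eapply Rlt_le_trans; [exact Hw|apply Rmin_l]).
  assert (A2 : Rabs (Im (g w) - Im (g z)) < d / 2) by (apply K2; eapply Rlt_le_trans; [exact Hw|apply Rmin_r]).
  assert (sqrt 2 < 2) by (rewrite <- (sqrt_pow2 2) at 2; [apply sqrt_lt_1|]; lra).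
  pose proof (sqrt_pos 2).
  change (fst (g w - g z)%C) with (Re (g w) - Re (g z)).
  change (snd (g w - g z)%C) with (Im (g w) - Im (g z)).
  assert (Rmax (Rabs (Re (g w) - Re (g z))) (Rabs (Im (g w) - Im (g z))) < d / 2) by (apply Rmax_lub_lt; trivial).
  assert (0 <= Rmax (Rabs (Re (g w) - Re (g z))) (Rabs (Im (g w) - Im (g z)))) by (eapply Rle_trans; [apply (Rabs_pos (Re (g w) - Re (g z)))|apply Rmax_l]).
  nra.
Qed.

Lemma Ccont_comp f g z : Ccont f (g z) -> Ccont g z -> Ccont (fun w => f (g w)) z.
Proof.
  intros [H1 H2] H; split.
  - exact (Rcont_comp (fun w => Re (f w)) g z H1 H).
  - exact (Rcont_comp (fun w => Im (f w)) g z H2 H).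
Qed.

Lemma Ccont_const c z : Ccont (fun _ => c) z.
Proof. eapply Cderiv_cont, Cderiv_const. Qed.

Lemma Ccont_id z : Ccont (fun w => w) z.
Proof. eapply Cderiv_cont, Cderiv_id. Qed.

Lemma Ccont_plus f g z : Ccont f z -> Ccont g z -> Ccont (fun w => f w + g w)%C z.
Proof. intros [H1 H2] [H3 H4]; split; now apply continuity_2d_pt_plus. Qed.

Lemma Ccont_mult f g z : Ccont f z -> Ccont g z -> Ccont (fun w => f w * g w)%C z.
Proof.
  intros [H1 H2] [H3 H4]; split.
  - apply (continuity_2d_pt_minus (fun x y => Re (f (x,y)) * Re (g (x,y))) (fun x y => Im (f (x,y)) * Im (g (x,y))));
      now apply continuity_2d_pt_mult.
  - apply (continuity_2d_pt_plus (fun x y => Re (f (x,y)) * Im (g (x,y))) (fun x y => Im (f (x,y)) * Re (g (x,y))));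
      now apply continuity_2d_pt_mult.
Qed.

Lemma Ccont_minus f g z : Ccont f z -> Ccont g z -> Ccont (fun w => f w - g w)%C z.
Proof.
  intros H1 H2. eapply Ccont_eq; [|apply (Ccont_plus _ _ _ H1 (Ccont_mult _ _ _ (Ccont_const (-1) z) H2))].
  intros; cbn beta; ring.
Qed.

Lemma Ccont_inv (g : C -> C) z : g z <> 0%C -> Ccont g z -> Ccont (fun w => / g w)%C z.
Proof. intros H; apply Ccont_comp. eapply Cderiv_cont, Cderiv_inv, H. Qed.

Lemma Ccont_pow g z n : Ccont g z -> Ccont (fun w => g w ^ n)%C z.
Proof.
  intros H; induction n as [|n IH]; [apply (Ccont_const 1%C)|].
  now apply (Ccont_mult g).
Qed.

Lemma Rcont_Cmod z : Rcont Cmod z.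
Proof.
  rewrite Rcont_eps; intros eps He; exists eps; split; trivial; intros w Hw.
  apply Rle_lt_trans with (2 := Hw). apply Rabs_le; split.
  - pose proof (Cmod_triangle w (z - w)) as T. replace (w + (z - w))%C with z in T by ring.
    replace (Cmod (w - z)) with (Cmod (z - w)); [lra|]. rewrite <- Cmod_opp. f_equal; ring.
  - pose proof (Cmod_triangle z (w - z)) as T. replace (z + (w - z))%C with w in T by ring. lra.
Qed.

Lemma Ccont_eps g z :
  Ccont g z ->
  forall eps, 0 < eps -> exists del, 0 < del /\
    forall w, Cmod (w - z) < del -> Cmod (g w - g z) < eps.
Proof.
  intros H eps He.
  pose proof (Rcont_comp Cmod (fun w => g w - g z)%C z (Rcont_Cmod _)
                (Ccont_minus _ _ _ H (Ccont_const (g z) z))) as K.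
  rewrite Rcont_eps in K. destruct (K eps He) as [d [Hd L]].
  exists d; split; trivial. intros w Hw. specialize (L w Hw).
  replace (g z - g z)%C with (RtoC 0) in L by ring. rewrite Cmod_0, Rminus_0_r in L.
  now rewrite Rabs_pos_eq in L by apply Cmod_ge_0.
Qed.

(** * The complex exponential *)

Lemma Cexp_plus z w : Cexp (z + w) = (Cexp z * Cexp w)%C.
Proof. unfold Cexp; apply C_ext; cbn; rewrite exp_plus, ?cos_plus, ?sin_plus; unfold Re, Im; ring. Qed.

Lemma Cexp_0 : Cexp 0 = 1%C.
Proof. unfold Cexp; cbn. rewrite exp_0, cos_0, sin_0. apply C_ext; cbn; unfold Re, Im; ring. Qed.

Lemma exp_monotone x y : x <= y -> exp x <= exp y.
Proof. intros [L| ->]; [now apply Rlt_le, exp_increasing|lra]. Qed.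

Lemma Cmod_Cexp z : Cmod (Cexp z) = exp (Re z).
Proof.
  unfold Cexp, Cmod; cbn.
  replace (_ + _) with (Rsqr (exp (Re z))).
  - apply sqrt_Rsqr. apply Rlt_le, exp_pos.
  - unfold Rsqr. pose proof (sin2_cos2 (Im z)) as H. unfold Rsqr in H.
    transitivity (exp (Re z) * exp (Re z) * (sin (Im z) * sin (Im z) + cos (Im z) * cos (Im z))).
    + rewrite H; ring.
    + ring.
Qed.

Lemma Cexp_neq_0 z : Cexp z <> 0%C.
Proof. apply Cmod_gt_0. rewrite Cmod_Cexp. apply exp_pos. Qed.

Lemma Cexp_pow z n : (Cexp z ^ n)%C = Cexp (INR n * z)%C.
Proof.
  induction n as [|n IH].
  - cbn [INR]. rewrite Cmult_0_l, Cexp_0. reflexivity.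
  - rewrite Cpow_S, IH, <- Cexp_plus. f_equal. rewrite S_INR, RtoC_plus. ring.
Qed.

Lemma Cderiv_Cexp z : Cderiv Cexp z (Cexp z).
Proof.
  assert (He : grad (fun w => exp (Re w)) z (exp (Re z) * 1)%C).
  { apply grad_comp1; [apply is_derive_exp|apply grad_Re]. }
  assert (Hc : grad (fun w => cos (Im w)) z ((- sin (Im z))%R * - Ci)%C).
  { apply grad_comp1; [apply is_derive_cos|apply grad_Im]. }
  assert (Hs : grad (fun w => sin (Im w)) z (cos (Im z) * - Ci)%C).
  { apply grad_comp1; [apply is_derive_sin|apply grad_Im]. }
  split.
  - eapply grad_eq; [| |apply (grad_mult _ _ _ _ _ He Hc)]; [trivial|].
    apply C_ext; cbn; unfold Re, Im; ring.
  - eapply grad_eq; [| |apply (grad_mult _ _ _ _ _ He Hs)]; [trivial|].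
    apply C_ext; cbn; unfold Re, Im; ring.
Qed.

(** * Mean value inequality *)

(** The increment [a] of [g] is projected on its own direction, where the real
    mean value theorem applies: [|a|^2 = Re (Cconj a * a)]. *)
Lemma mean_value_ineq (g d : C -> C) z h K :
  (forall t, 0 <= t <= 1 -> Cderiv g (z + t * h)%C (d (z + t * h)%C)) ->
  (forall t, 0 <= t <= 1 -> Cmod (d (z + t * h)%C) <= K) ->
  Cmod (g (z + h) - g z)%C <= K * Cmod h.
Proof.
  intros Hd HK.
  set (a := (g (z + h) - g z)%C).
  set (phi := fun t : R => Re (Cconj a * g (z + t * h))%C).
  set (phi' := fun t : R => Re (Cconj a * (d (z + t * h) * h))%C).
  assert (D : forall t, 0 <= t <= 1 -> is_derive phi t (phi' t)).
  { intros t Ht.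
    destruct (Cderiv_scal (Cconj a) g _ _ (Hd t Ht)) as [G _].
    set (v := fun w => Re (Cconj a * g w)%C) in *.
    apply (is_derive_ext (fun s : R => v (Re z + s * Re h, Im z + s * Im h))).
    { intros s. unfold phi, v. do 3 f_equal. apply C_ext; cbn; unfold Re, Im; ring. }
    replace (phi' t) with (Re (Cconj a * d (z + t * h) * (Re h, Im h))%C).
    2: { unfold phi'. rewrite C_eta. f_equal. ring. }
    apply (grad_path v (fun s => Re z + s * Re h) (fun s => Im z + s * Im h)).
    - replace (Re z + t * Re h, Im z + t * Im h) with (z + t * h)%C; [exact G|].
      apply C_ext; cbn; unfold Re, Im; ring.
    - auto_derive; [trivial|ring].
    - auto_derive; [trivial|ring]. }
  destruct (MVT_gen phi 0 1 phi') as [c [Hc E]].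
  - intros t; rewrite Rmin_left, Rmax_right by lra. intros Ht; apply D; lra.
  - intros t; rewrite Rmin_left, Rmax_right by lra. intros Ht.
    apply derivable_continuous_pt. eexists. apply is_derive_Reals. apply D; lra.
  - rewrite Rmin_left, Rmax_right in Hc by lra.
    assert (E1 : phi 1 - phi 0 = Cmod a ^ 2).
    { unfold phi. rewrite Cmult_1_l, Cmult_0_l, Cplus_0_r, Cmod2_alt.
      unfold a, Cconj; cbn; unfold Re, Im; ring. }
    assert (E2 : phi' c <= Cmod a * (K * Cmod h)).
    { unfold phi'. apply Rle_trans with (1 := Rle_abs _).
      apply Rle_trans with (1 := re_le_Cmod _). rewrite !Cmod_mult, Cmod_conj.
      apply Rmult_le_compat_l; [apply Cmod_ge_0|]. apply Rmult_le_compat_r; [apply Cmod_ge_0|].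
      now apply HK. }
    destruct (Req_dec (Cmod a) 0) as [Z|Z].
    + fold a. rewrite Z. apply Rmult_le_pos; [|apply Cmod_ge_0].
      apply Rle_trans with (2 := HK 0 ltac:(lra)), Cmod_ge_0.
    + pose proof (Cmod_ge_0 a). apply Rmult_le_reg_l with (Cmod a); [lra|]. fold a. nra.
Qed.

(** * Gradient bound for positive harmonic functions *)

Definition unit_at (t : R) : C := (cos t, sin t).
Definition circ (z0 : C) (rho t : R) : C := (z0 + rho * unit_at t)%C.

Lemma Cmod_unit_at t : Cmod (unit_at t) = 1.
Proof.
  unfold Cmod, unit_at; cbn. rewrite !Rmult_1_r.
  replace (cos t * cos t + sin t * sin t) with 1; [apply sqrt_1|].
  pose proof (sin2_cos2 t) as H; unfold Rsqr in H; lra.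
Qed.

Lemma Cmod_circ z0 rho t : Cmod (circ z0 rho t - z0) = Rabs rho.
Proof.
  unfold circ. replace (z0 + rho * unit_at t - z0)%C with (rho * unit_at t)%C by ring.
  rewrite Cmod_mult, Cmod_unit_at, Cmod_R; ring.
Qed.

Lemma Rcont_fun (f : R -> R) (v : C -> R) z :
  continuity_pt f (v z) -> Rcont v z -> Rcont (fun w => f (v w)) z.
Proof.
  intros H H1. apply (continuity_1d_2d_pt_comp f (fun x y => v (x, y))); [now rewrite C_eta|trivial].
Qed.

Lemma Rcont_const c z : Rcont (fun _ => c) z.
Proof. exact (continuity_2d_pt_const _ _ c). Qed.

Lemma Rcont_Re z : Rcont Re z.
Proof. apply continuity_2d_pt_id1. Qed.

Lemma Rcont_Im z : Rcont Im z.
Proof. apply continuity_2d_pt_id2. Qed.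

Lemma Rcont_mult v w z : Rcont v z -> Rcont w z -> Rcont (fun y => v y * w y) z.
Proof. apply continuity_2d_pt_mult. Qed.

Lemma Ccont_unit_at z : Ccont (fun w => unit_at (Im w)) z.
Proof.
  split; cbn.
  - apply (Rcont_fun cos Im); [apply continuity_cos|apply Rcont_Im].
  - apply (Rcont_fun sin Im); [apply continuity_sin|apply Rcont_Im].
Qed.

Lemma Ccont_Re z : Ccont (fun w => RtoC (Re w)) z.
Proof. split; [apply Rcont_Re|exact (continuity_2d_pt_const _ _ 0)]. Qed.

Lemma Ccont_circ z0 z : Ccont (fun w => circ z0 (Re w) (Im w)) z.
Proof.
  apply Ccont_plus; [apply Ccont_const|].
  apply Ccont_mult; [apply Ccont_Re|apply Ccont_unit_at].
Qed.

Lemma Rcont_section (V : C -> R) x y : Rcont V (x, y) -> continuous (fun t => V (x, t)) y.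
Proof.
  intros H. apply continuity_pt_filterlim. intros eps He.
  destruct (proj1 (Rcont_eps _ _) H eps He) as [d [Hd K]].
  exists d; split; trivial. intros t [_ Ht]. apply K.
  apply Rle_lt_trans with (2 := Ht), Req_le.
  change (Cmod ((x, t) - (x, y))%C = Rabs (t - y)).
  rewrite <- Cmod_R, <- (Rmult_1_l (Cmod (t - y)%R)), <- Cmod_Ci, <- Cmod_mult.
  f_equal. apply C_ext; cbn; ring.
Qed.

Lemma ex_RInt_section (V : C -> R) x a b :
  (forall y, Rcont V (x, y)) -> ex_RInt (fun t => V (x, t)) a b.
Proof. intros H; apply (ex_RInt_continuous (V := R_CompleteNormedModule)). intros y _; now apply Rcont_section. Qed.

(** Differentiation under the integral sign over the circles around [z0].  The
    weight [k] does not depend on the radius; it will be [1] for mean values and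
    [1 - cos] (up to a rotation) for gradients. *)
Lemma circle_radial_derive (v k : _ -> R) (g : C -> C) z0 r rho :
  (forall z, Cmod (z - z0) < r -> grad v z (g z)) ->
  (forall z, Cmod (z - z0) < r -> Ccont g z) ->
  (forall t, continuity_pt k t) -> Rabs rho < r ->
  is_derive (fun s => RInt (fun t => v (circ z0 s t) * k t) 0 (2 * PI)) rho
    (RInt (fun t => Re (g (circ z0 rho t) * unit_at t)%C * k t) 0 (2 * PI)).
Proof.
  intros Hv Hg Hk Hr.
  set (G := fun w => Re (g (circ z0 (Re w) (Im w)) * unit_at (Im w))%C * k (Im w)).
  assert (D : forall s t, Rabs s < r ->
    is_derive (fun s => v (circ z0 s t) * k t) s (G (s, t))).
  { intros s t Hs. unfold G.
    apply (is_derive_ext (fun s => k t * v (Re z0 + s * cos t, Im z0 + s * sin t))).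
    - intros u. unfold circ, unit_at. rewrite Rmult_comm. do 2 f_equal.
      apply C_ext; cbn; unfold Re, Im; ring.
    - rewrite Rmult_comm. apply is_derive_scal.
      change (unit_at (Im (s, t))) with (cos t, sin t).
      apply (grad_path v (fun s => Re z0 + s * cos t) (fun s => Im z0 + s * sin t)).
      + replace (Re z0 + s * cos t, Im z0 + s * sin t) with (circ z0 s t)
          by (unfold circ, unit_at; apply C_ext; cbn; unfold Re, Im; ring).
        apply Hv. now rewrite Cmod_circ.
      + auto_derive; [trivial|ring].
      + auto_derive; [trivial|ring]. }
  assert (GC : forall s t, Rabs s < r -> Rcont G (s, t)).
  { intros s t Hs. unfold G. apply Rcont_mult.
    - assert (HC : Ccont (fun w => g (circ z0 (Re w) (Im w)) * unit_at (Im w))%C (s, t)); [|apply HC].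
      apply Ccont_mult; [|apply Ccont_unit_at].
      apply (Ccont_comp g); [|apply Ccont_circ].
      apply Hg. rewrite Cmod_circ. exact Hs.
    - apply (Rcont_fun k Im); [apply Hk|apply Rcont_Im]. }
  assert (L : locally rho (fun s => Rabs s < r)).
  { assert (Hp : 0 < r - Rabs rho) by lra. exists (mkposreal _ Hp). intros s Hs.
    cbn in Hs. change (Rabs (s - rho) < r - Rabs rho) in Hs.
    pose proof (Rabs_triang (s - rho) rho) as T. replace (s - rho + rho) with (s : R) in T by (unfold Rminus; rewrite Rplus_assoc, Rplus_opp_l, Rplus_0_r; trivial). lra. }
  replace (RInt (fun t => Re (g (circ z0 rho t) * unit_at t)%C * k t) 0 (2 * PI))
    with (RInt (fun t => Derive (fun s => v (circ z0 s t) * k t) rho) 0 (2 * PI)).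
  2: { apply RInt_ext. intros t _. apply is_derive_unique. now apply D. }
  apply (is_derive_RInt_param (fun s t => v (circ z0 s t) * k t)).
  - revert L; apply filter_imp; intros s Hs t _. eexists; now apply D.
  - intros t _. apply (continuity_2d_pt_ext_loc (fun s t => G (s, t))); [|exact (GC rho t Hr)].
    destruct L as [del Hdel]. exists del. intros s u Hs _.
    symmetry. apply is_derive_unique, D, Hdel, Hs.
  - revert L; apply filter_imp; intros s Hs.
    apply (ex_RInt_section (fun w => v (circ z0 (Re w) (Im w)) * k (Im w)) s). intros y.
    apply Rcont_mult.
    + apply (Rcont_comp v); [|apply Ccont_circ].
      eapply grad_cont, Hv. rewrite Cmod_circ. exact Hs.
    + apply (Rcont_fun k Im); [apply Hk|apply Rcont_Im].
Qed.

Lemma RInt_unit_at (a : C) : RInt (fun t => Re (a * unit_at t)%C) 0 (2 * PI) = 0.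
Proof.
  apply is_RInt_unique.
  replace 0 with (minus (Re (a * (- Ci * unit_at (2 * PI)))%C) (Re (a * (- Ci * unit_at 0))%C)) at 2.
  2: { unfold unit_at. rewrite cos_2PI, sin_2PI, cos_0, sin_0. apply Rminus_diag. }
  apply (is_RInt_derive (fun t => Re (a * (- Ci * unit_at t))%C)).
  - intros t _. unfold unit_at; cbn; unfold Re, Im. auto_derive; [trivial|]. ring.
  - intros t _. apply (Rcont_section (fun w => Re (a * unit_at (Im w))%C) 0).
    assert (HC : Ccont (fun w => a * unit_at (Im w))%C (0, t)); [|apply HC].
    apply Ccont_mult; [apply Ccont_const|apply Ccont_unit_at].
Qed.

(** The integrand is, up to the factor [1 / rho], the angular derivative of
    [Im H], which is periodic. *)
Lemma circle_tangential (H H' : C -> C) z0 r rho :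
  (forall z, Cmod (z - z0) < r -> Cderiv H z (H' z)) ->
  (forall z, Cmod (z - z0) < r -> Ccont H' z) -> Rabs rho < r ->
  RInt (fun t => Re (H' (circ z0 rho t) * unit_at t)%C) 0 (2 * PI) = 0.
Proof.
  intros Hd Hc Hr.
  destruct (Req_dec rho 0) as [->|N].
  { transitivity (RInt (fun t => Re (H' z0 * unit_at t)%C) 0 (2 * PI)); [|apply RInt_unit_at].
    apply RInt_ext; intros t _. do 3 f_equal.
    unfold circ; ring. }
  assert (E : is_RInt (fun t => rho * Re (H' (circ z0 rho t) * unit_at t)%C) 0 (2 * PI) 0).
  { replace 0 with (minus (Im (H (circ z0 rho (2 * PI)))) (Im (H (circ z0 rho 0)))) at 2.
    2: { unfold circ, unit_at. rewrite cos_2PI, sin_2PI, cos_0, sin_0. apply Rminus_diag. }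
    apply (is_RInt_derive (fun t => Im (H (circ z0 rho t)))).
    - intros t _.
      apply (is_derive_ext (fun t => Im (H (Re z0 + rho * cos t, Im z0 + rho * sin t)))).
      { intros u. unfold circ, unit_at. do 2 f_equal. apply C_ext; cbn; unfold Re, Im; ring. }
      replace (rho * Re (H' (circ z0 rho t) * unit_at t)%C)
        with (Re ((- Ci * H' (circ z0 rho t)) * ((- (rho * sin t))%R, (rho * cos t)%R))%C)
        by (unfold unit_at; cbn; unfold Re, Im; ring).
      apply (grad_path (fun w => Im (H w)) (fun t => Re z0 + rho * cos t) (fun t => Im z0 + rho * sin t)).
      + replace (Re z0 + rho * cos t, Im z0 + rho * sin t) with (circ z0 rho t)
          by (unfold circ, unit_at; apply C_ext; cbn; unfold Re, Im; ring).
        apply Hd. now rewrite Cmod_circ.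
      + auto_derive; [trivial|ring].
      + auto_derive; [trivial|ring].
    - intros t _.
      apply (Rcont_section (fun w => rho * Re (H' (circ z0 (Re w) (Im w)) * unit_at (Im w))%C) rho).
      apply Rcont_mult; [apply Rcont_const|].
      assert (HC : Ccont (fun w => H' (circ z0 (Re w) (Im w)) * unit_at (Im w))%C (rho, t)); [|apply HC].
      apply Ccont_mult; [|apply Ccont_unit_at].
      apply (Ccont_comp H'); [|apply Ccont_circ].
      apply Hc. rewrite Cmod_circ. exact Hr. }
  apply (is_RInt_scal _ _ _ (/ rho)) in E.
  apply is_RInt_unique.
  replace 0 with (scal (/ rho) 0) at 2 by apply Rmult_0_r.
  revert E; apply is_RInt_ext. intros t _. unfold scal; cbn; unfold mult; cbn. field; trivial.
Qed.

(** By [circle_tangential] the mean over a circle has derivative [0] with respect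
    to the radius; at radius [0] it is the value at the centre. *)
Lemma circle_mean (H H' : C -> C) z0 r rho :
  (forall z, Cmod (z - z0) < r -> Cderiv H z (H' z)) ->
  (forall z, Cmod (z - z0) < r -> Ccont H' z) -> 0 <= rho < r ->
  RInt (fun t => Re (H (circ z0 rho t))) 0 (2 * PI) = 2 * PI * Re (H z0).
Proof.
  intros Hd Hc Hr.
  set (M := fun s => RInt (fun t => Re (H (circ z0 s t)) * 1) 0 (2 * PI)).
  assert (D : forall s, 0 <= s <= rho -> is_derive M s 0).
  { intros s Hs. assert (As : Rabs s < r) by (rewrite Rabs_pos_eq; lra).
    pose proof (circle_radial_derive (fun w => Re (H w)) (fun _ => 1) H' z0 r s
      (fun z Hz => proj1 (Hd z Hz)) Hc (fun t => continuity_pt_const (fun _ => 1) t (fun _ _ => eq_refl)) As) as K.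
    rewrite <- (circle_tangential H H' z0 r s Hd Hc As).
    rewrite (RInt_ext (fun t => Re (H' (circ z0 s t) * unit_at t)%C)
      (fun t => Re (H' (circ z0 s t) * unit_at t)%C * 1)); [exact K|].
    intros t _. exact (eq_sym (Rmult_1_r _)). }
  assert (E : M 0 = M rho).
  { destruct (Req_dec rho 0) as [->|N]; trivial.
    apply (eq_is_derive M); [|lra]. exact D. }
  transitivity (M rho); [apply RInt_ext; intros; exact (eq_sym (Rmult_1_r _))|].
  rewrite <- E. unfold M.
  rewrite (RInt_ext _ (fun _ => Re (H z0))).
  - rewrite RInt_const. unfold scal; cbn; unfold mult; cbn. ring.
  - intros t _. rewrite Rmult_1_r. do 2 f_equal. unfold circ; ring.
Qed.

(** Let [e = unit_at t] and let [c] be the unit number with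
    [Re (c * d z0) = |d z0|].  The mean of [u] against the nonnegative weight
    [1 - Re (Cconj c * e)] is [u z0 - rho |d z0| / 2]: its radial derivative is a
    combination of means of [d e], [d e^2] and [d], and only the last one is not
    zero.  As the mean is nonnegative, the bound follows on each smaller disc. *)
Lemma gradient_bound (u : C -> R) (d d' : C -> C) z0 r :
  (forall z, Cmod (z - z0) < r -> 0 <= u z) ->
  (forall z, Cmod (z - z0) < r -> grad u z (d z)) ->
  (forall z, Cmod (z - z0) < r -> Cderiv d z (d' z)) ->
  (forall z, Cmod (z - z0) < r -> Ccont d' z) ->
  0 < r -> r * Cmod (d z0) <= 2 * u z0.
Proof.
  intros Hu Hg Hd Hc Hr.
  assert (Hc0 : exists c : C, Cmod c = 1 /\ Re (c * d z0)%C = Cmod (d z0)).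
  { destruct (Ceq_dec (d z0) 0) as [Z|N].
    - exists 1%C. rewrite Cmod_1, Z, Cmult_1_l, Cmod_0. now split.
    - exists (Cconj (d z0) / Cmod (d z0))%C.
      pose proof (proj1 (Cmod_gt_0 _) N) as P.
      assert (NC : RtoC (Cmod (d z0)) <> 0%C) by (intros Q; apply RtoC_inj in Q; lra).
      split.
      + rewrite Cmod_div, Cmod_conj, Cmod_R, Rabs_pos_eq; trivial; [field; lra|lra].
      + replace (Cconj (d z0) / Cmod (d z0) * d z0)%C with (RtoC (Cmod (d z0))); [reflexivity|].
        replace (Cconj (d z0) / Cmod (d z0) * d z0)%C with ((d z0 * Cconj (d z0)) / Cmod (d z0))%C
          by (field; trivial).
        rewrite <- Cmod2_conj. cbn. rewrite Rmult_1_r, RtoC_mult. field; trivial. }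
  destruct Hc0 as [c [Hc1 Hc2]].
  assert (Hcc : (c * Cconj c)%C = 1%C) by (rewrite <- Cmod2_conj, Hc1; f_equal; ring).
  set (k := fun t => 1 - Re (Cconj c * unit_at t)%C).
  assert (Hk : forall t, 0 <= k t).
  { intros t. unfold k. pose proof (re_le_Cmod (Cconj c * unit_at t)%C) as H.
    rewrite Cmod_mult, Cmod_conj, Hc1, Cmod_unit_at in H.
    pose proof (Rle_abs (Re (Cconj c * unit_at t)%C)). lra. }
  assert (Kc : forall t, continuity_pt k t).
  { intros t. apply derivable_continuous_pt. unfold k, unit_at; cbn. unfold Re, Im.
    apply ex_derive_Reals_0. auto_derive. trivial. }
  (* The means of [d], [d e] and [d e^2] over the circle of radius [s] are, up to
     powers of [s], mean values of [d z * (z - z0)^m] for [m = 0, 1, 2], which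
     vanish at the centre for [m > 0]. *)
  assert (Moment : forall (q q' : C -> C) s, 0 <= s < r ->
    (forall z, Cderiv q z (q' z)) -> (forall z, Ccont q' z) ->
    RInt (fun t => Re (d (circ z0 s t) * q (circ z0 s t))%C) 0 (2 * PI)
      = 2 * PI * Re (d z0 * q z0)%C).
  { intros q q' s Hs Hq Hq'.
    apply (circle_mean (fun z => d z * q z)%C (fun z => d' z * q z + d z * q' z)%C z0 r); trivial.
    - intros z Hz. apply Cderiv_mult; auto.
    - intros z Hz. apply Ccont_plus; apply Ccont_mult; auto; eapply Cderiv_cont; eauto. }
  assert (Int : forall (a : R -> C) s, 0 <= s < r ->
     (forall w, Ccont (fun w => a (Im w)) w) ->
     ex_RInt (fun t => Re (d (circ z0 s t) * a t)%C) 0 (2 * PI)).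
  { intros a s Hs Ha.
    apply (ex_RInt_section (fun w => Re (d (circ z0 (Re w) (Im w)) * a (Im w))%C) s). intros y.
    assert (HC : Ccont (fun w => d (circ z0 (Re w) (Im w)) * a (Im w))%C (s, y)); [|apply HC].
    apply Ccont_mult; [|apply Ha]. apply (Ccont_comp d); [|apply Ccont_circ].
    eapply Cderiv_cont, Hd. rewrite Cmod_circ. cbn. rewrite Rabs_pos_eq; lra. }
  assert (M0 : forall s, 0 <= s < r ->
    RInt (fun t => Re (d (circ z0 s t) * c)%C) 0 (2 * PI) = 2 * PI * Cmod (d z0)).
  { intros s Hs. rewrite (Moment (fun _ => c) (fun _ => 0%C)); trivial.
    - rewrite Cmult_comm, Hc2. trivial.
    - intros; apply Cderiv_const.
    - intros; apply Ccont_const. }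
  assert (D1 : forall z, Cderiv (fun z => z - z0)%C z 1%C).
  { intros z. eapply Cderiv_eq; [| |apply (Cderiv_minus _ _ _ _ _ (Cderiv_id z) (Cderiv_const z0 z))];
      [trivial|ring]. }
  assert (M1 : forall s, 0 < s < r ->
    RInt (fun t => Re (d (circ z0 s t) * unit_at t)%C) 0 (2 * PI) = 0).
  { intros s Hs.
    assert (E : s * RInt (fun t => Re (d (circ z0 s t) * unit_at t)%C) 0 (2 * PI) = 0).
    { rewrite <- (RInt_scal (V := R_CompleteNormedModule)) by (apply Int; [lra|apply Ccont_unit_at]).
      transitivity (2 * PI * Re (d z0 * (z0 - z0))%C).
      - rewrite <- (Moment (fun z => z - z0)%C (fun _ => 1%C) s); [|lra|trivial|intros; apply Ccont_const].
        apply RInt_ext; intros t _. unfold circ, scal; cbn; unfold mult, Re, Im; cbn. ring.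
      - replace (d z0 * (z0 - z0))%C with (RtoC 0) by ring. cbn; ring. }
    apply Rmult_integral in E; destruct E; [lra|trivial]. }
  assert (M2 : forall s, 0 < s < r ->
    RInt (fun t => Re (d (circ z0 s t) * (Cconj c * (unit_at t * unit_at t)))%C) 0 (2 * PI) = 0).
  { intros s Hs.
    assert (E : (s * s) * RInt (fun t => Re (d (circ z0 s t) * (Cconj c * (unit_at t * unit_at t)))%C) 0 (2 * PI) = 0).
    { rewrite <- (RInt_scal (V := R_CompleteNormedModule)).
      2: { apply (Int (fun t => Cconj c * (unit_at t * unit_at t))%C); [lra|]. intros w.
           apply Ccont_mult; [apply Ccont_const|]. apply Ccont_mult; apply Ccont_unit_at. }
      transitivity (2 * PI * Re (d z0 * (Cconj c * ((z0 - z0) * (z0 - z0))))%C).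
      - rewrite <- (Moment (fun z => Cconj c * ((z - z0) * (z - z0)))%C
          (fun z => Cconj c * (1 * (z - z0) + (z - z0) * 1))%C s); [|lra| |].
        + apply RInt_ext; intros t _. unfold circ, scal; cbn; unfold mult, Re, Im; cbn. ring.
        + intros z. apply Cderiv_scal. exact (Cderiv_mult _ _ _ _ _ (D1 z) (D1 z)).
        + intros z. apply Ccont_mult; [apply Ccont_const|].
          apply Ccont_plus; apply Ccont_mult; try apply Ccont_const; eapply Cderiv_cont; apply D1.
      - replace (d z0 * (Cconj c * ((z0 - z0) * (z0 - z0))))%C with (RtoC 0) by ring. cbn; ring. }
    apply Rmult_integral in E; destruct E; [nra|trivial]. }
  set (Phi := fun s => RInt (fun t => u (circ z0 s t) * k t) 0 (2 * PI)).
  assert (DP : forall s, Rabs s < r ->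
    is_derive Phi s (RInt (fun t => Re (d (circ z0 s t) * unit_at t)%C * k t) 0 (2 * PI))).
  { intros s Hs. apply (circle_radial_derive u k d z0 r); trivial.
    intros z Hz. eapply Cderiv_cont, Hd, Hz. }
  assert (DV : forall s, 0 < s < r ->
    RInt (fun t => Re (d (circ z0 s t) * unit_at t)%C * k t) 0 (2 * PI) = - PI * Cmod (d z0)).
  { intros s Hs.
    rewrite (RInt_ext _ (fun t => plus (Re (d (circ z0 s t) * unit_at t)%C)
      (scal (- / 2) (plus (Re (d (circ z0 s t) * (Cconj c * (unit_at t * unit_at t)))%C)
         (Re (d (circ z0 s t) * c)%C))))).
    - assert (I1 : ex_RInt (fun t => Re (d (circ z0 s t) * unit_at t)%C) 0 (2 * PI)).
      { apply Int; [lra|apply Ccont_unit_at]. }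
      assert (I2 : ex_RInt (fun t => Re (d (circ z0 s t) * (Cconj c * (unit_at t * unit_at t)))%C) 0 (2 * PI)).
      { apply (Int (fun t => Cconj c * (unit_at t * unit_at t))%C); [lra|]. intros w.
        apply Ccont_mult; [apply Ccont_const|]. apply Ccont_mult; apply Ccont_unit_at. }
      assert (I3 : ex_RInt (fun t => Re (d (circ z0 s t) * c)%C) 0 (2 * PI)).
      { apply (Int (fun _ => c)); [lra|]. intros; apply Ccont_const. }
      pose proof (ex_RInt_plus _ _ _ _ I2 I3) as I4.
      rewrite (RInt_plus (V := R_CompleteNormedModule)); trivial.
      2: { now apply (ex_RInt_scal (V := R_NormedModule)). }
      rewrite (RInt_scal (V := R_CompleteNormedModule)); trivial.
      rewrite (RInt_plus (V := R_CompleteNormedModule)); trivial.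
      rewrite M0, M1, M2 by lra. unfold plus, scal; cbn; unfold mult; cbn. field.
    - intros t _. unfold k, plus, scal; cbn; unfold mult; cbn. unfold Re, Im; cbn.
      set (p := cos t). set (q := sin t).
      assert (PQ : p * p + q * q = 1) by (unfold p, q; pose proof (sin2_cos2 t) as Q; unfold Rsqr in Q; lra).
      destruct (d (circ z0 s t)) as [x y], c as [c1 c2]; cbn.
      replace ((x * p - y * q) * (1 - (c1 * p - - c2 * q))) with
        ((x * p - y * q) - / 2 * ((x * (c1 * (p * p - q * q) + c2 * (2 * p * q)) - y * (c1 * (2 * p * q) - c2 * (p * p - q * q)))
          + (x * c1 - y * c2) * (p * p + q * q))) by field.
      rewrite PQ. field. }
  assert (P0 : Phi 0 = 2 * PI * u z0).
  { unfold Phi. rewrite (RInt_ext _ (fun t => scal (u z0) (k t))).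
    - assert (Ik : is_RInt (fun t => Re (Cconj c * unit_at t)%C) 0 (2 * PI) 0).
      { pose proof (RInt_unit_at (Cconj c)) as Z0.
        set (I := RInt _ _ _) in Z0. rewrite <- Z0 at 2. unfold I. apply (RInt_correct (V := R_CompleteNormedModule)).
        apply (ex_RInt_section (fun w => Re (Cconj c * unit_at (Im w))%C) 0). intros y.
        assert (HC : Ccont (fun w => Cconj c * unit_at (Im w))%C (0, y)); [|apply HC].
        apply Ccont_mult; [apply Ccont_const|apply Ccont_unit_at]. }
      pose proof (is_RInt_minus _ _ _ _ _ _ (is_RInt_const (V := R_NormedModule) 0 (2 * PI) 1) Ik) as J.
      apply (is_RInt_scal _ _ _ (u z0)) in J.
      etransitivity; [exact (is_RInt_unique _ _ _ _ J)|].
      unfold minus, plus, opp, scal; cbn; unfold mult; cbn. ring.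
    - intros t _. unfold scal; cbn; unfold mult; cbn. do 2 f_equal. unfold circ; ring. }
  assert (PP : forall s, 0 < s < r -> 0 <= Phi s).
  { intros s Hs. apply RInt_ge_0.
    - pose proof PI_RGT_0; lra.
    - apply (ex_RInt_section (fun w => u (circ z0 (Re w) (Im w)) * k (Im w)) s). intros y.
      apply Rcont_mult.
      + apply (Rcont_comp u); [|apply Ccont_circ].
        eapply grad_cont, Hg. rewrite Cmod_circ. cbn. rewrite Rabs_pos_eq; lra.
      + apply (Rcont_fun k Im); [apply Kc|apply Rcont_Im].
    - intros t _. apply Rmult_le_pos; [|apply Hk].
      apply Hu. rewrite Cmod_circ, Rabs_pos_eq; lra. }
  assert (B : forall s, 0 < s < r -> s * Cmod (d z0) <= 2 * u z0).
  { intros s Hs.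
    destruct (MVT_gen Phi 0 s (fun _ => - PI * Cmod (d z0))) as [x [Hx E]].
    - intros x; rewrite Rmin_left, Rmax_right by lra. intros Hx.
      rewrite <- (DV x) by lra. apply DP. rewrite Rabs_pos_eq; lra.
    - intros x; rewrite Rmin_left, Rmax_right by lra. intros Hx.
      apply derivable_continuous_pt. eexists. apply is_derive_Reals. apply DP. rewrite Rabs_pos_eq; lra.
    - pose proof (PP s Hs). rewrite P0 in E. pose proof PI_RGT_0.
      apply Rmult_le_reg_l with PI; trivial. lra. }
  destruct (Rle_or_lt (r * Cmod (d z0)) (2 * u z0)) as [L|L]; trivial.
  exfalso. pose proof (Cmod_ge_0 (d z0)).
  assert (U0 : 0 <= u z0).
  { apply Hu. replace (z0 - z0)%C with (RtoC 0) by ring. rewrite Cmod_0; trivial. }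
  assert (Pd : 0 < Cmod (d z0)) by (destruct (Req_dec (Cmod (d z0)) 0) as [Z|]; [rewrite Z in L; lra|lra]).
  set (s := (2 * u z0 / Cmod (d z0) + r) / 2).
  assert (A : 2 * u z0 / Cmod (d z0) < r).
  { apply Rmult_lt_reg_r with (Cmod (d z0)); trivial. unfold Rdiv; rewrite Rmult_assoc, Rinv_l; lra. }
  assert (A0 : 0 <= 2 * u z0 / Cmod (d z0)).
  { apply Rmult_le_pos; [lra|]. apply Rlt_le, Rinv_0_lt_compat, Pd. }
  assert (Hs : 0 < s < r) by (unfold s; lra).
  pose proof (B s Hs) as Q.
  assert (2 * u z0 = 2 * u z0 / Cmod (d z0) * Cmod (d z0)) by (field; lra).
  unfold s in Q. nra.
Qed.

(** * Sections of the binomial *)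

(** The [j]-th section of the binomial: [(1 + x)^M] is the sum over [j < p] of
    [x^j * sec p M j (x^p)].  The recursion is multiplication by [1 + x]; the
    exponent [p - 1] becomes [p], which contributes the factor [W] to the
    section [0]. *)
Fixpoint sec (p M : nat) : nat -> C -> C :=
  match M with
  | O => fun j _ => match j with O => 1%C | S _ => 0%C end
  | S M => fun j W =>
      match j with
      | O => (sec p M 0 W + W * sec p M (p - 1) W)%C
      | S i => (sec p M (S i) W + sec p M i W)%C
      end
  end.

Fixpoint dsec (p M : nat) : nat -> C -> C :=
  match M with
  | O => fun _ _ => 0%C
  | S M => fun j W =>
      match j with
      | O => (dsec p M 0 W + (1 * sec p M (p - 1) W + W * dsec p M (p - 1) W))%C
      | S i => (dsec p M (S i) W + dsec p M i W)%C
      end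
  end.

Lemma Cderiv_sec p M j W : Cderiv (sec p M j) W (dsec p M j W).
Proof.
  revert j; induction M as [|M IH]; intros j; [|destruct j as [|i]]; cbn [sec dsec].
  - destruct j; apply Cderiv_const.
  - apply Cderiv_plus; [apply IH|]. apply (Cderiv_mult (fun w => w)); [apply Cderiv_id|apply IH].
  - apply Cderiv_plus; apply IH.
Qed.

(** This is [d/dx (1 + x)^M = M (1 + x)^(M - 1)] read off section by section.  In
    section [0] the derivative is a multiple of the section [p - 1]. *)
Lemma dsec_eq p M W : (2 <= p)%nat ->
  (INR p * dsec p M 0 W = INR M * sec p (M - 1) (p - 1) W)%C /\
  (forall i, (S i < p)%nat ->
    INR p * W * dsec p M (S i) W + INR (S i) * sec p M (S i) W = INR M * sec p (M - 1) i W)%C.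
Proof.
  intros Hp. induction M as [|M [IH0 IH]].
  { cbn -[INR]. split; intros; cbn [INR]; ring. }
  assert (R0 : (INR M * sec p M 0 W = INR M * (sec p (M - 1) 0 W + W * sec p (M - 1) (p - 1) W))%C).
  { destruct M as [|m]; [cbn [INR]; ring|].
    replace (S m - 1)%nat with m by lia. reflexivity. }
  assert (RS : forall i, (INR M * sec p M (S i) W = INR M * (sec p (M - 1) (S i) W + sec p (M - 1) i W))%C).
  { intros i. destruct M as [|m]; [cbn [INR]; ring|].
    replace (S m - 1)%nat with m by lia. reflexivity. }
  replace (S M - 1)%nat with M by lia. rewrite S_INR, RtoC_plus. split.
  - cbn [dsec]. destruct p as [|[|q]]; [lia|lia|].
    replace (S (S q) - 1)%nat with (S q) in * by lia.
    specialize (IH q ltac:(lia)).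
    rewrite !Cmult_plus_distr_l, IH0.
    rewrite Cmult_plus_distr_r, (RS q), Cmult_plus_distr_l, <- IH.
    rewrite (S_INR (S q)), RtoC_plus. ring.
  - intros i Hi. cbn [dsec sec].
    destruct i as [|i].
    + specialize (IH 0%nat Hi). cbn [INR] in *.
      rewrite Cmult_plus_distr_r, R0.
      transitivity ((INR p * W * dsec p M 1 W + 1 * sec p M 1 W) + W * (INR p * dsec p M 0 W) + sec p M 0 W)%C; [ring|].
      rewrite IH, IH0. ring.
    + pose proof (IH i ltac:(lia)) as IH1. specialize (IH (S i) Hi).
      rewrite Cmult_plus_distr_r, RS.
      rewrite (S_INR (S i)), RtoC_plus in *.
      transitivity ((INR p * W * dsec p M (S (S i)) W + (INR (S i) + 1) * sec p M (S (S i)) W)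
        + (INR p * W * dsec p M (S i) W + INR (S i) * sec p M (S i) W) + sec p M (S i) W)%C; [ring|].
      rewrite IH, IH1. ring.
Qed.

Lemma sec_conj p M j W : sec p M j (Cconj W) = Cconj (sec p M j W).
Proof.
  revert j; induction M as [|M IH]; intros j; [|destruct j as [|i]]; cbn [sec].
  - destruct j; apply C_ext; cbn; ring.
  - rewrite !IH, Cplus_conj, Cmult_conj. reflexivity.
  - rewrite !IH, Cplus_conj. reflexivity.
Qed.

Lemma sec_nonneg p M j (w : R) : 0 <= w -> exists r : R, 0 <= r /\ sec p M j w = r.
Proof.
  intros Hw. revert j; induction M as [|M IH]; intros j; [|destruct j as [|i]]; cbn [sec].
  - destruct j; [exists 1|exists 0]; split; trivial; lra.
  - destruct (IH 0%nat) as [a [Ha ->]], (IH (p - 1)%nat) as [b [Hb ->]].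
    exists (a + w * b); split; [nra|]. now rewrite RtoC_plus, RtoC_mult.
  - destruct (IH (S i)) as [a [Ha ->]], (IH i) as [b [Hb ->]].
    exists (a + b); split; [lra|]. now rewrite RtoC_plus.
Qed.

(** Nonnegative when [a] is reached from [b] by a counterclockwise rotation of at
    most a half turn and a scaling.  It is additive in each argument, which an
    inequality between arguments of complex numbers would not be. *)
Definition area (a b : C) : R := Im (a * Cconj b)%C.

Lemma area_plus_l a b c : area (a + b) c = area a c + area b c.
Proof. unfold area; cbn; unfold Re, Im; ring. Qed.
Lemma area_plus_r a b c : area a (b + c) = area a b + area a c.
Proof. unfold area; cbn; unfold Re, Im; ring. Qed.
Lemma area_diag a : area a a = 0.
Proof. unfold area; cbn; unfold Re, Im; ring. Qed.
Lemma area_scale w a b : area (w * a) (w * b) = Cmod w ^ 2 * area a b.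
Proof. rewrite Cmod2_alt. unfold area; cbn; unfold Re, Im; ring. Qed.
Lemma area_mult_diag w a : area (w * a) a = Im w * Cmod a ^ 2.
Proof. rewrite Cmod2_alt. unfold area; cbn; unfold Re, Im; ring. Qed.

(** For [W] in the upper half-plane the arguments of the sections decrease from
    section [0] to section [p - 1], by no more than the argument of [W] in
    total.  Both conditions together are preserved by the recursion, because the
    terms produced by expanding [area] are instances of them or cancel. *)
Lemma sec_sector p M W : (1 <= p)%nat -> 0 < Im W ->
  forall i j, (i <= j < p)%nat ->
    0 <= area (sec p M i W) (sec p M j W) /\ 0 <= area (W * sec p M j W) (sec p M i W).
Proof.
  intros Hp HW. induction M as [|M IH].
  - intros i j Hij. cbn [sec].
    destruct i, j; try lia; unfold area; cbn; unfold Im in HW; lra.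
  - assert (P1 : forall i j, (i <= j < p)%nat -> 0 <= area (sec p M i W) (sec p M j W)) by (intros; now apply IH).
    assert (P2 : forall i j, (i <= j < p)%nat -> 0 <= area (W * sec p M j W) (sec p M i W)) by (intros; now apply IH).
    assert (P3 : forall a b, 0 <= area a b -> 0 <= area (W * a) (W * b)).
    { intros a b H. rewrite area_scale. apply Rmult_le_pos; [apply pow2_ge_0|trivial]. }
    assert (P4 : forall a, 0 <= area (W * a) a).
    { intros a. rewrite area_mult_diag. apply Rmult_le_pos; [lra|apply pow2_ge_0]. }
    intros i j Hij. destruct i as [|i], j as [|j]; try lia; cbn [sec].
    + split; [rewrite area_diag; lra|apply P4].
    + split.
      * rewrite !area_plus_l, !area_plus_r.
        pose proof (P1 0 (S j) ltac:(lia))%nat. pose proof (P1 0 j ltac:(lia))%nat.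
        pose proof (P2 (S j) (p - 1) ltac:(lia))%nat. pose proof (P2 j (p - 1) ltac:(lia))%nat. lra.
      * rewrite Cmult_plus_distr_l, !area_plus_l, !area_plus_r.
        pose proof (P2 0 (S j) ltac:(lia))%nat. pose proof (P2 0 j ltac:(lia))%nat.
        pose proof (P3 _ _ (P1 (S j) (p - 1) ltac:(lia)))%nat. pose proof (P3 _ _ (P1 j (p - 1) ltac:(lia)))%nat. lra.
    + split.
      * rewrite !area_plus_l, !area_plus_r.
        pose proof (P1 (S i) (S j) ltac:(lia)). pose proof (P1 i (S j) ltac:(lia)). pose proof (P1 i j ltac:(lia)).
        destruct (Nat.eq_dec i j) as [->|N].
        -- pose proof (area_diag (sec p M j W + sec p M (S j) W)) as D.
           rewrite !area_plus_l, !area_plus_r in D. lra.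
        -- pose proof (P1 (S i) j ltac:(lia)). lra.
      * rewrite Cmult_plus_distr_l, !area_plus_l, !area_plus_r.
        pose proof (P2 (S i) (S j) ltac:(lia)). pose proof (P2 i (S j) ltac:(lia)). pose proof (P2 i j ltac:(lia)).
        destruct (Nat.eq_dec i j) as [->|N].
        -- pose proof (P4 (sec p M j W + sec p M (S j) W)%C) as D.
           rewrite Cmult_plus_distr_l, !area_plus_l, !area_plus_r in D. lra.
        -- pose proof (P2 (S i) j ltac:(lia)). lra.
Qed.

(** A sum of two consecutive sections can only vanish if they point in opposite
    directions, and then the second half of [sec_sector] is violated; for the
    section [0] it is the first half. *)
Lemma sec_neq_0 p M (W : C) : (1 <= p)%nat -> 0 < Im W ->
  forall j, (j < p)%nat -> (j <= M)%nat -> sec p M j W <> 0%C.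
Proof.
  intros Hp HW. induction M as [|M IH].
  - intros j _ Hj. replace j with 0%nat by lia. cbn. apply C1_nz.
  - assert (Neg : forall a : C, a <> 0%C -> ~ 0 <= - (Im W * Cmod a ^ 2)).
    { intros a Ha H. apply Cmod_gt_0 in Ha. assert (0 < Cmod a ^ 2) by (apply pow_lt; trivial). nra. }
    intros j Hjp HjM Z. destruct j as [|i]; cbn [sec] in Z.
    + assert (E : sec p M 0 W = (- (W * sec p M (p - 1) W))%C).
      { transitivity (sec p M 0 W + W * sec p M (p - 1) W - W * sec p M (p - 1) W)%C; [ring|]. rewrite Z; ring. }
      apply (Neg (sec p M (p - 1) W)).
      * intros Q. rewrite Q, Cmult_0_r in E. apply (IH 0%nat); [lia|lia|]. rewrite E; ring.
      * rewrite <- area_mult_diag.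
        destruct (sec_sector p M W Hp HW 0 (p - 1) ltac:(lia))%nat as [H _].
        rewrite E in H. unfold area in *; cbn in *; unfold Re, Im in *. lra.
    + assert (E : sec p M (S i) W = (- sec p M i W)%C).
      { transitivity (sec p M (S i) W + sec p M i W - sec p M i W)%C; [ring|]. rewrite Z; ring. }
      apply (Neg (sec p M i W)).
      * apply IH; lia.
      * rewrite <- area_mult_diag.
        destruct (sec_sector p M W Hp HW i (S i) ltac:(lia))%nat as [_ H].
        rewrite E in H. unfold area in *; cbn in *; unfold Re, Im in *. lra.
Qed.

(** * Polynomials without zeros in the upper half-plane *)

Fixpoint padd (l m : list C) : list C :=
  match l, m with
  | nil, _ => m
  | _, nil => l
  | (a :: l)%list, (b :: m)%list => ((a + b)%C :: padd l m)%list
  end.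

Lemma peval_padd l m z : peval (padd l m) z = (peval l z + peval m z)%C.
Proof.
  revert m; induction l as [|a l IH]; intros [|b m]; cbn [padd peval]; try ring.
  rewrite IH; ring.
Qed.

Lemma sec_poly p M j : exists l, forall W, sec p M j W = peval l W.
Proof.
  revert j; induction M as [|M IH]; intros j; [|destruct j as [|i]]; cbn [sec].
  - destruct j; [exists (RtoC 1 :: nil)%list|exists nil]; intros; cbn; ring.
  - destruct (IH 0%nat) as [l Hl], (IH (p - 1)%nat) as [m Hm].
    exists (padd l (RtoC 0 :: m)%list); intros W. rewrite peval_padd, Hl, Hm; cbn; ring.
  - destruct (IH (S i)) as [l Hl], (IH i) as [m Hm].
    exists (padd l m); intros W. now rewrite peval_padd, Hl, Hm.
Qed.

(** Each factor [z - r] with [Im r <= 0] grows in modulus as [z] moves up from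
    the real axis. *)
Lemma stable_poly_vertical l :
  (forall z : C, 0 < Im z -> peval l z <> 0%C) ->
  forall x s t, 0 <= s <= t -> Cmod (peval l (x, s)) <= Cmod (peval l (x, t)).
Proof.
  intros H x s t Hst. destruct (FTA.factor l) as [c [rs E]].
  rewrite !E, !Cmod_mult. apply Rmult_le_compat_l; [apply Cmod_ge_0|].
  assert (Hr : forall r : C, List.In r rs -> Im r <= 0).
  { intros r Hr. destruct (Rle_or_lt (Im r) 0) as [|P]; trivial. exfalso.
    apply (H r P). rewrite E. replace (prod_roots rs r) with (RtoC 0); [ring|].
    clear - Hr. induction rs as [|a rs IH]; [destruct Hr|]. cbn. destruct Hr as [->|Hr].
    - ring.
    - rewrite <- (IH Hr); ring. }
  clear E H. induction rs as [|a rs IH]; cbn; [lra|].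
  rewrite !Cmod_mult. apply Rmult_le_compat; try apply Cmod_ge_0.
  - specialize (Hr a (or_introl eq_refl)). unfold Cmod. apply sqrt_le_1_alt.
    apply Rplus_le_compat_l. cbn. unfold Im in Hr. nra.
  - apply IH. intros r Hr'. apply Hr. now right.
Qed.

Lemma Im_real_line p M j (x : R) : Im (sec p M j x) = 0.
Proof.
  assert (H : sec p M j x = Cconj (sec p M j x)).
  { rewrite <- sec_conj. f_equal. apply C_ext; cbn; ring. }
  apply (f_equal Im) in H. rewrite im_conj in H. lra.
Qed.

(** The section [0] is real on the real axis, so [Im (sec p M 0 W)] is [Im W]
    times a real part of the derivative at some point below [W].  The modulus of
    the derivative is at most that at [W] because, by [dsec_eq], the derivative
    is a section without zeros in the upper half-plane. *)
Lemma sec_expansion_upper p M W : (2 <= p)%nat -> (p <= M)%nat -> 0 < Im W ->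
  Rabs (Im (sec p M 0 W)) <= Im W * Cmod (dsec p M 0 W).
Proof.
  intros Hp HM HW. destruct W as [X Y]; cbn [Im snd] in *. cbn in HW.
  assert (Mono : forall s, 0 <= s <= Y -> Cmod (dsec p M 0 (X, s)) <= Cmod (dsec p M 0 (X, Y))).
  { intros s Hs.
    assert (P : 0 < INR p) by (apply lt_0_INR; lia).
    apply Rmult_le_reg_l with (Cmod (INR p)).
    { rewrite Cmod_R, Rabs_pos_eq; lra. }
    rewrite <- !Cmod_mult.
    rewrite (proj1 (dsec_eq p M (X, s) Hp)), (proj1 (dsec_eq p M (X, Y) Hp)).
    rewrite !Cmod_mult. apply Rmult_le_compat_l; [apply Cmod_ge_0|].
    destruct (sec_poly p (M - 1) (p - 1)) as [l Hl]. rewrite !Hl.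
    apply stable_poly_vertical; trivial. intros z Hz. rewrite <- Hl.
    apply sec_neq_0; trivial; lia. }
  set (h := fun s => Im (sec p M 0 (X, s))).
  assert (D : forall s, is_derive h s (Re (dsec p M 0 (X, s)))).
  { intros s. replace (Re (dsec p M 0 (X, s))) with (Re (- Ci * dsec p M 0 (X, s) * (0, 1))%C)
      by (cbn; unfold Re, Im; ring).
    apply (grad_path (fun w => Im (sec p M 0 w)) (fun _ => X) (fun s => s)).
    - apply (Cderiv_sec p M 0).
    - auto_derive; trivial.
    - auto_derive; trivial. }
  destruct (MVT_gen h 0 Y (fun s => Re (dsec p M 0 (X, s)))) as [c [Hc E]].
  - intros s _; apply D.
  - intros s _. apply derivable_continuous_pt. eexists. apply is_derive_Reals, D.
  - rewrite Rmin_left, Rmax_right in Hc by lra.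
    unfold h in E at 2. change (X, 0) with (RtoC X) in E. rewrite Im_real_line, !Rminus_0_r in E.
    fold (h Y). rewrite E, Rabs_mult, (Rabs_pos_eq Y), Rmult_comm by lra.
    apply Rmult_le_compat_l; [lra|]. apply Rle_trans with (1 := re_le_Cmod _). now apply Mono.
Qed.

Lemma sec_expansion p M W : (2 <= p)%nat -> (p <= M)%nat ->
  INR p * Rabs (Im (sec p M 0 W)) <= Rabs (Im W) * (INR M * Cmod (sec p (M - 1) (p - 1) W)).
Proof.
  intros Hp HM.
  assert (E : forall V, INR p * Cmod (dsec p M 0 V) = INR M * Cmod (sec p (M - 1) (p - 1) V)).
  { intros V. pose proof (f_equal Cmod (proj1 (dsec_eq p M V Hp))) as E.
    rewrite !Cmod_mult, !Cmod_R, !Rabs_pos_eq in E by apply pos_INR. exact E. }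
  assert (P : 0 <= INR p) by apply pos_INR.
  destruct (Rtotal_order (Im W) 0) as [H|[H|H]].
  - pose proof (sec_expansion_upper p M (Cconj W) Hp HM) as K.
    rewrite im_conj in K. specialize (K ltac:(lra)).
    rewrite sec_conj, im_conj, Rabs_Ropp in K.
    specialize (E (Cconj W)). rewrite sec_conj, Cmod_conj in E.
    rewrite <- E, (Rabs_left (Im W)) by lra. nra.
  - assert (W = RtoC (Re W)) as -> by (apply C_ext; cbn; trivial).
    rewrite Im_real_line, Rabs_R0, Rmult_0_r. apply Rmult_le_pos; [apply Rabs_pos|].
    apply Rmult_le_pos; [apply pos_INR|apply Cmod_ge_0].
  - pose proof (sec_expansion_upper p M W Hp HM H) as K.
    rewrite <- E, (Rabs_pos_eq (Im W)) by lra. nra.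
Qed.

(** * Finite sums *)

Fixpoint csum (a : nat -> C) (n : nat) : C :=
  match n with
  | O => 0%C
  | S n => (csum a n + a n)%C
  end.

Lemma csum_ext a b n : (forall k, (k < n)%nat -> a k = b k) -> csum a n = csum b n.
Proof.
  induction n as [|n IH]; intros H; cbn; trivial.
  rewrite IH, H; trivial; [lia|]. intros; apply H; lia.
Qed.

Lemma csum_plus a b n : csum (fun k => a k + b k)%C n = (csum a n + csum b n)%C.
Proof. induction n as [|n IH]; cbn; [ring|]. rewrite IH; ring. Qed.

Lemma csum_scal c a n : csum (fun k => c * a k)%C n = (c * csum a n)%C.
Proof. induction n as [|n IH]; cbn; [ring|]. rewrite IH; ring. Qed.

Lemma csum_Cmod a n K : (forall k, (k < n)%nat -> Cmod (a k) <= K) -> Cmod (csum a n) <= INR n * K.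
Proof.
  induction n as [|n IH]; intros H.
  - cbn. rewrite Cmod_0; lra.
  - rewrite S_INR. cbn [csum]. apply Rle_trans with (1 := Cmod_triangle _ _).
    specialize (IH (fun k Hk => H k ltac:(lia))). specialize (H n ltac:(lia)). lra.
Qed.

Lemma csum_first a n : csum a (S n) = (a 0%nat + csum (fun k => a (S k)) n)%C.
Proof. induction n as [|n IH]; [cbn; ring|]. change (csum a (S (S n))) with (csum a (S n) + a (S n))%C. rewrite IH; cbn; ring. Qed.

Lemma Cderiv_csum (a d : nat -> C -> C) n z :
  (forall k, Cderiv (a k) z (d k z)) ->
  Cderiv (fun w => csum (fun k => a k w) n) z (csum (fun k => d k z) n).
Proof.
  intros H; induction n as [|n IH]; cbn [csum]; [apply Cderiv_const|].
  now apply Cderiv_plus.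
Qed.

Lemma csum_geometric w n : ((w - 1) * csum (fun k => w ^ k) n = w ^ n - 1)%C.
Proof.
  induction n as [|n IH]; [cbn; ring|].
  cbn [csum]. rewrite Cmult_plus_distr_l, IH, Cpow_S. ring.
Qed.

(** * Taylor remainders of the exponential *)

(** [exp_rem n] is the exponential minus its Taylor polynomial of degree
    [n - 1]; each remainder is an antiderivative of the previous one. *)
Fixpoint exp_rem (n : nat) (h : C) : C :=
  match n with
  | O => Cexp h
  | S n => (exp_rem n h - / INR (fact n) * h ^ n)%C
  end.

Lemma Cderiv_pow n z : Cderiv (fun w => w ^ S n)%C z (INR (S n) * z ^ n)%C.
Proof.
  induction n as [|n IH].
  - eapply Cderiv_eq; [| |apply Cderiv_id]; intros; cbn; ring.
  - eapply Cderiv_eq; [| |apply (Cderiv_mult _ _ _ _ _ (Cderiv_id z) IH)].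
    + reflexivity.
    + cbn beta. rewrite (S_INR (S n)), RtoC_plus, Cpow_S. ring.
Qed.

Lemma INR_fact_neq n : RtoC (INR (fact n)) <> 0%C.
Proof. intros H; apply RtoC_inj in H. now apply (INR_fact_neq_0 n). Qed.

Lemma Cderiv_exp_rem n h : Cderiv (exp_rem (S n)) h (exp_rem n h).
Proof.
  induction n as [|n IH]; cbn [exp_rem] in *.
  - eapply Cderiv_eq; [| |apply (Cderiv_minus _ _ _ _ _ (Cderiv_Cexp h) (Cderiv_const (/ INR (fact 0) * h ^ 0) h))].
    + reflexivity.
    + ring.
  - apply Cderiv_minus; [exact IH|].
    replace (/ INR (fact n) * h ^ n)%C with (/ INR (fact (S n)) * (INR (S n) * h ^ n))%C.
    + apply Cderiv_scal, Cderiv_pow.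
    + rewrite fact_simpl, mult_INR, RtoC_mult. field. split; [apply INR_fact_neq|].
      intros H; apply RtoC_inj in H. now apply (not_0_INR (S n)).
Qed.

Lemma exp_rem_0 n : exp_rem (S n) 0 = 0%C.
Proof.
  induction n as [|n IH].
  - cbn. rewrite Cexp_0. apply C_ext; cbn; field.
  - cbn [exp_rem] in *. rewrite IH, Cpow_S. ring.
Qed.

Lemma exp_rem_bound n h : Cmod (exp_rem n h) <= Cmod h ^ n * exp (Cmod h).
Proof.
  revert h; induction n as [|n IH]; intros h.
  - cbn [exp_rem pow]. rewrite Cmod_Cexp, Rmult_1_l.
    apply exp_monotone, Rle_trans with (2 := re_le_Cmod h), Rle_abs.
  - replace (exp_rem (S n) h) with (exp_rem (S n) (0 + h) - exp_rem (S n) 0)%C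
      by (rewrite exp_rem_0, Cplus_0_l; ring).
    replace (Cmod h ^ S n * exp (Cmod h)) with ((Cmod h ^ n * exp (Cmod h)) * Cmod h) by (cbn; ring).
    apply (mean_value_ineq _ (exp_rem n)).
    + intros; apply Cderiv_exp_rem.
    + intros t Ht. rewrite Cplus_0_l.
      apply Rle_trans with (1 := IH _).
      assert (Q : Cmod (t * h) <= Cmod h).
      { rewrite Cmod_mult, Cmod_R, Rabs_pos_eq by lra. pose proof (Cmod_ge_0 h). nra. }
      apply Rmult_le_compat.
      * apply pow_le, Cmod_ge_0.
      * apply Rlt_le, exp_pos.
      * apply pow_incr. split; [apply Cmod_ge_0|trivial].
      * now apply exp_monotone.
Qed.

(** * Limits of complex sequences *)

Definition Clim (a : nat -> C) (l : C) : Prop := is_lim_seq (fun n => Cmod (a n - l)) 0.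

Lemma Clim_le (a : nat -> C) l b :
  (forall n, Cmod (a n - l) <= b n) -> is_lim_seq b 0 -> Clim a l.
Proof.
  intros H Hb. apply (is_lim_seq_le_le (fun _ => 0) _ b); trivial; [|apply is_lim_seq_const].
  intros n; split; [apply Cmod_ge_0|apply H].
Qed.

Lemma Clim_const l : Clim (fun _ => l) l.
Proof. apply (Clim_le _ _ (fun _ => 0)); [|apply is_lim_seq_const].
  intros _. replace (l - l)%C with (RtoC 0) by ring. rewrite Cmod_0; lra. Qed.

Lemma Clim_plus a b l m : Clim a l -> Clim b m -> Clim (fun n => a n + b n)%C (l + m)%C.
Proof.
  intros Ha Hb. apply (Clim_le _ _ (fun n => Cmod (a n - l) + Cmod (b n - m))).
  - intros n. replace (a n + b n - (l + m))%C with ((a n - l) + (b n - m))%C by ring. apply Cmod_triangle.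
  - rewrite <- (Rplus_0_l 0). now apply is_lim_seq_plus'.
Qed.

Lemma Clim_scal c a l : Clim a l -> Clim (fun n => c * a n)%C (c * l)%C.
Proof.
  intros Ha. apply (Clim_le _ _ (fun n => Cmod c * Cmod (a n - l))).
  - intros n. rewrite <- Cmod_mult. apply Req_le. f_equal. ring.
  - rewrite <- (Rmult_0_r (Cmod c)). apply (is_lim_seq_scal_l _ (Cmod c) 0 Ha).
Qed.

Lemma Clim_csum (a : nat -> nat -> C) (l : nat -> C) m :
  (forall k, Clim (a k) (l k)) -> Clim (fun n => csum (fun k => a k n) m) (csum l m).
Proof.
  intros H; induction m as [|m IH]; cbn [csum]; [apply Clim_const|]. now apply Clim_plus.
Qed.

Lemma Clim_ext a b l : (forall n, a n = b n) -> Clim a l -> Clim b l.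
Proof. intros H; apply is_lim_seq_ext; intros n; now rewrite H. Qed.

Lemma Clim_unique a l m : Clim a l -> Clim a m -> l = m.
Proof.
  intros H1 H2. apply Ceq_minus, Cmod_eq_0. apply Rle_antisym; [|apply Cmod_ge_0].
  apply (is_lim_seq_le (fun _ => Cmod (l - m)) (fun n => Cmod (a n - l) + Cmod (a n - m)) (Cmod (l - m)) 0).
  - intros n. replace (l - m)%C with (- (a n - l) + (a n - m))%C at 1 by ring.
    rewrite <- (Cmod_opp (a n - l)). apply Cmod_triangle.
  - apply is_lim_seq_const.
  - rewrite <- (Rplus_0_l 0). now apply is_lim_seq_plus'.
Qed.

(** Passage to the limit in an inequality; [L] will be a real or imaginary part
    or its absolute value. *)
Lemma Clim_le_linear (a b : nat -> C) l m (L : C -> R) c N :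
  (forall z w : C, Rabs (L z - L w) <= Cmod (z - w)) ->
  (forall n, (N <= n)%nat -> L (a n) <= c * Cmod (b n)) ->
  0 <= c -> Clim a l -> Clim b m -> L l <= c * Cmod m.
Proof.
  intros HL H Hc Ha Hb.
  apply (is_lim_seq_le_loc (fun _ => L l) (fun n => c * Cmod m + (Cmod (a n - l) + c * Cmod (b n - m))) (L l) (c * Cmod m)).
  - exists N. intros n Hn. specialize (H n Hn).
    specialize (HL (a n) l). apply Rabs_le_between in HL.
    pose proof (Cmod_triangle m (b n - m)) as T. replace (m + (b n - m))%C with (b n) in T by ring.
    nra.
  - apply is_lim_seq_const.
  - rewrite <- (Rplus_0_r (c * Cmod m)) at 1. apply is_lim_seq_plus'; [apply is_lim_seq_const|].
    rewrite <- (Rplus_0_l 0). apply is_lim_seq_plus'; trivial.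
    rewrite <- (Rmult_0_r c). apply (is_lim_seq_scal_l _ c 0 Hb).
Qed.

Lemma pow_diff_bound (a b : C) K n : Cmod a <= K -> Cmod b <= K ->
  Cmod (a ^ S n - b ^ S n) <= INR (S n) * (Cmod (a - b) * K ^ n).
Proof.
  intros Ha Hb. pose proof (Cmod_ge_0 a). induction n as [|n IH].
  - rewrite !Cpow_1_r. cbn. lra.
  - replace (a ^ S (S n) - b ^ S (S n))%C with (a * (a ^ S n - b ^ S n) + (a - b) * b ^ S n)%C
      by (rewrite !(Cpow_S _ (S n)); ring).
    apply Rle_trans with (1 := Cmod_triangle _ _). rewrite !Cmod_mult, Cmod_pow.
    rewrite (S_INR (S n)), Rmult_plus_distr_r, Rmult_1_l. apply Rplus_le_compat.
    + apply Rle_trans with (K * (INR (S n) * (Cmod (a - b) * K ^ n))).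
      * apply Rmult_le_compat; trivial. apply Cmod_ge_0.
      * cbn [pow]. lra.
    + apply Rmult_le_compat_l; [apply Cmod_ge_0|]. apply pow_incr. split; [apply Cmod_ge_0|trivial].
Qed.

Lemma exp_pow_INR a n : exp a ^ n = exp (INR n * a).
Proof.
  induction n as [|n IH]; [cbn [INR pow]; now rewrite Rmult_0_l, exp_0|].
  rewrite S_INR, Rmult_plus_distr_r, Rmult_1_l, exp_plus, <- IH; cbn; ring.
Qed.

(** With [v = u / (n + 1)], both [1 + v] and [exp v] have modulus at most
    [exp |v|] and differ by [O(|v|^2)]; the [n + 1] factors lose one power of
    [n]. *)
Lemma Euler_limit_bound u n :
  Cmod ((1 + u / INR (S n)) ^ S n - Cexp u) <= (Cmod u ^ 2 * exp (Cmod u) ^ 2) / INR (S n) /\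
  Cmod ((1 + u / INR (S n)) ^ n) <= exp (Cmod u).
Proof.
  assert (N0 : 1 <= INR (S n)) by (rewrite S_INR; pose proof (pos_INR n); lra).
  assert (NC : RtoC (INR (S n)) <> 0%C) by (intros H; apply RtoC_inj in H; lra).
  set (v := (u / INR (S n))%C).
  assert (Hv : Cmod v = Cmod u / INR (S n)).
  { unfold v. rewrite Cmod_div, Cmod_R, Rabs_pos_eq; trivial; lra. }
  assert (Hvu : Cmod v <= Cmod u).
  { rewrite Hv. pose proof (Cmod_ge_0 u). apply Rmult_le_reg_r with (INR (S n)); [lra|].
    unfold Rdiv. rewrite Rmult_assoc, Rinv_l; nra. }
  assert (E1 : exp (Cmod v) ^ S n = exp (Cmod u)).
  { rewrite exp_pow_INR, Hv. f_equal. field; lra. }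
  assert (Ev : 1 <= exp (Cmod v)).
  { rewrite <- exp_0. apply exp_monotone, Cmod_ge_0. }
  assert (En : exp (Cmod v) ^ n <= exp (Cmod u)).
  { rewrite <- E1. apply Rle_pow; [trivial|lia]. }
  assert (Ha : Cmod (1 + v) <= exp (Cmod v)).
  { apply Rle_trans with (1 := Cmod_triangle _ _). rewrite Cmod_1. apply exp_ineq1_le. }
  assert (Hb : Cmod (Cexp v) <= exp (Cmod v)).
  { pose proof (exp_rem_bound 0 v) as H. cbn in H. lra. }
  assert (Huu : Cexp u = (Cexp v ^ S n)%C).
  { rewrite Cexp_pow. f_equal. unfold v. field; trivial. }
  split.
  - rewrite Huu. apply Rle_trans with (1 := pow_diff_bound _ _ _ n Ha Hb).
    assert (D : Cmod (1 + v - Cexp v) <= Cmod v ^ 2 * exp (Cmod v)).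
    { replace (1 + v - Cexp v)%C with (- exp_rem 2 v)%C.
      - rewrite Cmod_opp. apply exp_rem_bound.
      - cbn [exp_rem fact Nat.mul Nat.add INR]. rewrite Cpow_1_r.
        replace (v ^ 0)%C with (RtoC 1) by reflexivity. field. }
    pose proof (Cmod_ge_0 v). pose proof (Cmod_ge_0 u). pose proof (exp_pos (Cmod v)). pose proof (exp_pos (Cmod u)).
    assert (L1 : Cmod (1 + v - Cexp v) * exp (Cmod v) ^ n <= Cmod v ^ 2 * (exp (Cmod u) * exp (Cmod u))).
    { apply Rle_trans with ((Cmod v ^ 2 * exp (Cmod v)) * exp (Cmod v) ^ n).
      - apply Rmult_le_compat_r; trivial. apply pow_le; lra.
      - rewrite Rmult_assoc. apply Rmult_le_compat_l; [apply pow_le; lra|].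
        apply Rmult_le_compat; trivial; [lra|apply pow_le; lra|].
        now apply exp_monotone. }
    apply Rle_trans with (INR (S n) * (Cmod v ^ 2 * (exp (Cmod u) * exp (Cmod u)))).
    + apply Rmult_le_compat_l; [lra|trivial].
    + rewrite Hv. apply Req_le. field; lra.
  - rewrite Cmod_pow. apply Rle_trans with (2 := En). apply pow_incr. split; [apply Cmod_ge_0|trivial].
Qed.

Lemma lim_inv_S c : is_lim_seq (fun n => c / INR (S n)) 0.
Proof.
  rewrite <- (Rmult_0_r c). apply (is_lim_seq_scal_l (fun n => / INR (S n)) c 0).
  apply (is_lim_seq_incr_1 (fun n => / INR n)).
  change (Finite 0) with (Rbar_inv p_infty).
  apply is_lim_seq_inv; [apply is_lim_seq_INR|discriminate].
Qed.

Lemma Euler_limit u : Clim (fun n => (1 + u / INR (S n)) ^ S n)%C (Cexp u).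
Proof.
  apply (Clim_le _ _ _ (fun n => proj1 (Euler_limit_bound u n))). apply lim_inv_S.
Qed.

(** The variant with one factor less is what the derivative of [(1 + x)^(n + 1)]
    produces. *)
Lemma Euler_limit' u : Clim (fun n => (1 + u / INR (S n)) ^ n)%C (Cexp u).
Proof.
  apply (Clim_le _ _ (fun n => (Cmod u ^ 2 * exp (Cmod u) ^ 2 + Cmod u * exp (Cmod u)) / INR (S n))); [|apply lim_inv_S].
  intros n. destruct (Euler_limit_bound u n) as [H1 H2].
  assert (N0 : 1 <= INR (S n)) by (rewrite S_INR; pose proof (pos_INR n); lra).
  assert (NC : RtoC (INR (S n)) <> 0%C) by (intros H; apply RtoC_inj in H; lra).
  replace ((1 + u / INR (S n)) ^ n - Cexp u)%C with
    (((1 + u / INR (S n)) ^ S n - Cexp u) + - (u / INR (S n) * (1 + u / INR (S n)) ^ n))%C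
    by (rewrite Cpow_S; ring).
  apply Rle_trans with (1 := Cmod_triangle _ _). rewrite Cmod_opp, Cmod_mult, Cmod_div, Cmod_R, Rabs_pos_eq; trivial; [|lra].
  unfold Rdiv in *. rewrite Rmult_plus_distr_r. apply Rplus_le_compat; trivial.
  apply Rle_trans with (Cmod u * / INR (S n) * exp (Cmod u)); [|apply Req_le; ring].
  apply Rmult_le_compat_l; trivial. apply Rmult_le_pos; [apply Cmod_ge_0|].
  apply Rlt_le, Rinv_0_lt_compat; lra.
Qed.

(** * Exponential sums over the roots of unity *)

Lemma Cexp_Ci (x : R) : Cexp (x * Ci) = (cos x, sin x).
Proof.
  unfold Cexp. replace (Re (x * Ci)) with 0 by (cbn; ring).
  replace (Im (x * Ci)) with x by (cbn; ring).
  rewrite exp_0, !Rmult_1_l. reflexivity.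
Qed.

Lemma omega_pow p k : (1 <= p)%nat -> (omega p ^ k)%C = Cexp (RtoC (2 * PI * INR k / INR p) * Ci).
Proof.
  intros Hp. unfold omega. rewrite Cexp_pow. f_equal.
  assert (P : INR p <> 0) by (apply not_0_INR; lia).
  assert (PC : RtoC (INR p) <> 0%C) by (intros H; apply RtoC_inj in H; contradiction).
  rewrite RtoC_div, !RtoC_mult by trivial. field; trivial.
Qed.

Lemma Cmod_omega_pow p k : Cmod (omega p ^ k) = 1.
Proof.
  rewrite Cmod_pow. unfold omega. rewrite Cmod_Cexp.
  replace (Re (2 * PI * Ci / INR p)) with 0; [rewrite exp_0; apply pow1|].
  rewrite <- RtoC_mult. unfold Cdiv. rewrite <- Cmult_assoc, re_scal_l. cbn. unfold Rdiv; ring.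
Qed.

Lemma omega_pow_p p : (1 <= p)%nat -> (omega p ^ p)%C = 1%C.
Proof.
  intros Hp. rewrite omega_pow by trivial.
  replace (2 * PI * INR p / INR p) with (2 * PI) by (field; apply not_0_INR; lia).
  rewrite Cexp_Ci, cos_2PI, sin_2PI. reflexivity.
Qed.

(** This strict inequality serves twice: [omega p ^ k] is not [1], so the sums of
    its powers vanish, and [exp] dominates the other exponentials to the right. *)
Lemma Re_omega_pow p k : (0 < k < p)%nat -> Re (omega p ^ k) < 1.
Proof.
  intros Hk. rewrite omega_pow by lia.
  set (x := 2 * PI * INR k / INR p).
  rewrite Cexp_Ci; cbn [Re fst].
  assert (P : 0 < INR p) by (apply lt_0_INR; lia).
  assert (K : 0 < INR k) by (apply lt_0_INR; lia).
  assert (KP : INR k < INR p) by (apply lt_INR; lia).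
  pose proof PI_RGT_0.
  replace x with (2 * (x / 2)) by field. rewrite cos_2a_sin.
  assert (0 < sin (x / 2)); [|nra].
  assert (Q : x / 2 = PI * (INR k / INR p)) by (unfold x; field; lra).
  assert (0 < INR k / INR p < 1).
  { split; [apply Rdiv_lt_0_compat; trivial|]. apply Rmult_lt_reg_r with (INR p); trivial.
    unfold Rdiv; rewrite Rmult_assoc, Rinv_l; lra. }
  rewrite Q. apply sin_gt_0; nra.
Qed.

(** The [i]-th derivative of [esum p 0]. *)
Definition esum (p i : nat) (z : C) : C :=
  csum (fun k => (omega p ^ k) ^ i * Cexp (omega p ^ k * z))%C p.

(** Tends to [esum p i z] for [x = z / M], by the limit formula for [exp]. *)
Definition bsum (p i M : nat) (x : C) : C :=
  csum (fun k => (omega p ^ k) ^ i * (1 + omega p ^ k * x) ^ M)%C p.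

Lemma sum_n_csum (a : nat -> C) n : sum_n a n = csum a (S n).
Proof.
  induction n as [|n IH]; [rewrite sum_O; cbn; ring|].
  rewrite sum_Sn, IH. reflexivity.
Qed.

Lemma f_lambda_esum p lambda z : (1 <= p)%nat -> f_lambda p lambda z = (lambda * esum p 0 z)%C.
Proof.
  intros Hp. unfold f_lambda, esum. f_equal. rewrite sum_n_csum.
  replace (S (p - 1)) with p by lia. apply csum_ext. intros k _. cbn [Cpow]. ring.
Qed.

Lemma esum_p p z : (1 <= p)%nat -> esum p p z = esum p 0 z.
Proof.
  intros Hp. apply csum_ext. intros k _.
  rewrite <- Cpow_mult_r, Nat.mul_comm, Cpow_mult_r, omega_pow_p, Cpow_1_l by trivial. reflexivity.
Qed.

Lemma Cderiv_esum p i z : Cderiv (esum p i) z (esum p (S i) z).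
Proof.
  unfold esum.
  apply (Cderiv_csum (fun k w => (omega p ^ k) ^ i * Cexp (omega p ^ k * w))%C
    (fun k w => (omega p ^ k) ^ S i * Cexp (omega p ^ k * w))%C).
  intros k. rewrite Cpow_S, (Cmult_comm (omega p ^ k)), <- Cmult_assoc.
  apply Cderiv_scal. rewrite Cmult_comm.
  apply (Cderiv_comp Cexp); [apply Cderiv_Cexp|].
  eapply Cderiv_eq; [reflexivity| |apply Cderiv_scal, Cderiv_id]. ring.
Qed.

Lemma esum_limit p i z :
  Clim (fun n => bsum p i (S n) (z / INR (S n))%C) (esum p i z) /\
  Clim (fun n => bsum p i n (z / INR (S n))%C) (esum p i z).
Proof.
  split; apply (Clim_csum (fun k n => (omega p ^ k) ^ i * (1 + omega p ^ k * (z / INR (S n))) ^ _)%C);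
    intros k; apply Clim_scal.
  - apply (Clim_ext (fun n => (1 + (omega p ^ k * z) / INR (S n)) ^ S n)%C); [|apply Euler_limit].
    intros n. do 2 f_equal. unfold Cdiv; ring.
  - apply (Clim_ext (fun n => (1 + (omega p ^ k * z) / INR (S n)) ^ n)%C); [|apply Euler_limit'].
    intros n. do 2 f_equal. unfold Cdiv; ring.
Qed.

Lemma bsum_S p i M x : bsum p i (S M) x = (bsum p i M x + x * bsum p (S i) M x)%C.
Proof.
  unfold bsum. rewrite <- csum_scal, <- csum_plus. apply csum_ext; intros k _.
  rewrite !Cpow_S. ring.
Qed.

Lemma bsum_period p i M x : (1 <= p)%nat -> bsum p (p + i) M x = bsum p i M x.
Proof.
  intros Hp. apply csum_ext; intros k _. f_equal.
  rewrite Cpow_add_r, <- (Cpow_mult_r _ k p), Nat.mul_comm, Cpow_mult_r, omega_pow_p, Cpow_1_l by trivial. ring.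
Qed.

(** Averaging over the roots of unity selects one residue class of exponents;
    proved through the common recursion of both sides, where the index [i + 1]
    goes with [j - 1]. *)
Lemma bsum_sec p M x i j : (1 <= p)%nat -> (i + j = p)%nat -> (j < p)%nat ->
  bsum p i M x = (INR p * x ^ j * sec p M j (x ^ p))%C.
Proof.
  intros Hp. revert i j. induction M as [|M IH]; intros i j Hij Hj.
  - assert (E : bsum p i 0 x = csum (fun k => (omega p ^ i) ^ k)%C p).
    { apply csum_ext; intros k _. rewrite <- !Cpow_mult_r, Nat.mul_comm. cbn [Cpow]. ring. }
    rewrite E. destruct j as [|j]; cbn [sec].
    + replace i with p by lia. rewrite omega_pow_p by trivial.
      cbn [Cpow]. rewrite !Cmult_1_r. clear. induction p as [|n IH]; [reflexivity|].
      cbn [csum]. rewrite IH, S_INR, RtoC_plus, Cpow_1_l. reflexivity.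
    + pose proof (csum_geometric (omega p ^ i) p) as G.
      rewrite <- Cpow_mult_r, Nat.mul_comm, Cpow_mult_r, omega_pow_p, Cpow_1_l in G by trivial.
      replace (1 - 1)%C with (RtoC 0) in G by ring.
      rewrite Cmult_0_r. destruct (Ceq_dec (csum (fun k => ((omega p ^ i) ^ k)%C) p) 0) as [Z|Z]; trivial.
      exfalso. revert G. apply Cmult_neq_0; trivial.
      intros Q. assert (R : (omega p ^ i = 1)%C) by (apply Ceq_minus, Q).
      pose proof (Re_omega_pow p i ltac:(lia)) as L. rewrite R in L. cbn in L. lra.
  - rewrite bsum_S. destruct j as [|j]; cbn [sec].
    + replace (S i) with (p + 1)%nat by lia. rewrite bsum_period by trivial.
      rewrite (IH i 0%nat), (IH 1%nat (p - 1)%nat) by lia.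
      assert (X : (x ^ p = x * x ^ (p - 1))%C) by (rewrite <- Cpow_S; f_equal; lia).
      rewrite X. cbn [Cpow]. ring.
    + rewrite (IH i (S j)), (IH (S i) j) by lia. rewrite Cpow_S. ring.
Qed.

(** * The expansion inequality *)

Lemma Rabs_Im_le (z : C) : Rabs (Im z) <= Cmod z.
Proof. rewrite <- Rabs_Ropp, <- re_mult_Ci. apply Rle_trans with (1 := re_le_Cmod _).
  rewrite Cmod_mult, Cmod_Ci; lra. Qed.

Lemma INR_S_C n : RtoC (INR (S n)) <> 0%C.
Proof. intros H; apply RtoC_inj in H. now apply (not_0_INR (S n)). Qed.

Lemma div_INR_pow (z : C) n m : ((z / INR (S n)) ^ m = z ^ m * RtoC (/ INR (S n) ^ m))%C.
Proof.
  unfold Cdiv. rewrite Cpow_mult_l. f_equal.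
  rewrite <- RtoC_inv by (now apply not_0_INR). rewrite <- RtoC_pow, pow_inv. reflexivity.
Qed.

(** The limit [M -> oo] of [sec_expansion] at [W = (z / M)^p]. *)
Lemma esum_expansion p (z : C) : (2 <= p)%nat ->
  INR p * Cmod z ^ (p - 1) * Rabs (Im (esum p 0 z)) <= Rabs (Im (z ^ p)%C) * Cmod (esum p 1 z).
Proof.
  intros Hp. rewrite <- esum_p by lia.
  assert (P : 0 < INR p) by (apply lt_0_INR; lia).
  set (c := INR p * Cmod z ^ (p - 1)).
  assert (Hc : 0 <= c) by (apply Rmult_le_pos; [lra|apply pow_le, Cmod_ge_0]).
  destruct (esum_limit p p z) as [L1 _]. destruct (esum_limit p 1 z) as [_ L2].
  destruct (Req_dec c 0) as [Z|Z].
  { rewrite Z, Rmult_0_l. apply Rmult_le_pos; [apply Rabs_pos|apply Cmod_ge_0]. }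
  assert (K : Rabs (Im (esum p p z)) <= (Rabs (Im (z ^ p)%C) / c) * Cmod (esum p 1 z)).
  { apply (Clim_le_linear _ _ _ _ (fun w => Rabs (Im w)) _ p) with (4 := L1) (5 := L2).
    - intros a b. apply Rle_trans with (1 := Rabs_triang_inv2 _ _).
      apply (Rabs_Im_le (a - b)).
    - intros n Hn. set (x := (z / INR (S n))%C).
      rewrite (bsum_sec p (S n) x p 0), (bsum_sec p n x 1 (p - 1)) by lia.
      pose proof (sec_expansion p (S n) (x ^ p) Hp ltac:(lia)) as K.
      replace (S n - 1)%nat with n in K by lia.
      assert (N : 0 < INR (S n)) by (apply lt_0_INR; lia).
      replace (Im (x ^ p)%C) with (Im (z ^ p)%C * / INR (S n) ^ p) in K
        by (unfold x; now rewrite div_INR_pow, im_scal_r).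
      cbn [Cpow]. rewrite Cmult_1_r, im_scal_l, !Cmod_mult, !Rabs_mult, Cmod_R, Cmod_pow.
      rewrite (Rabs_pos_eq (INR p)) by lra.
      assert (NP : 0 < INR (S n) ^ p) by (apply pow_lt; trivial).
      rewrite Rabs_mult, (Rabs_pos_eq (/ _)) in K by (apply Rlt_le, Rinv_0_lt_compat; trivial).
      assert (X : Cmod z = INR (S n) * Cmod x).
      { unfold x. rewrite Cmod_div by apply INR_S_C. rewrite Cmod_R, Rabs_pos_eq by lra. field; lra. }
      apply Rle_trans with (1 := K). apply Req_le. unfold c in *. rewrite X in *.
      set (q := (p - 1)%nat) in *.
      assert (NE : INR (S n) ^ p = INR (S n) * INR (S n) ^ q) by (rewrite tech_pow_Rmult; f_equal; unfold q; lia).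
      rewrite NE.
      rewrite Rpow_mult_distr in *.
      assert (INR (S n) ^ q <> 0) by (apply pow_nonzero; lra).
      assert (Cmod x ^ q <> 0) by (intros E; apply Z; rewrite E; ring).
      field. repeat split; trivial; lra.
    - apply Rmult_le_pos; [apply Rabs_pos|]. apply Rlt_le, Rinv_0_lt_compat; lra. }
  apply Rmult_le_compat_l with (r := c) in K; trivial. apply Rle_trans with (1 := K).
  apply Req_le. field; trivial.
Qed.

Lemma Im_pow_le (z : C) n : Rabs (Im (z ^ S n)%C) <= INR (S n) * Cmod z ^ n * Rabs (Im z).
Proof.
  induction n as [|n IH].
  - rewrite Cpow_1_r. cbn. lra.
  - rewrite Cpow_S, im_mult. apply Rle_trans with (1 := Rabs_triang _ _). rewrite !Rabs_mult.
    pose proof (re_le_Cmod z) as H1. pose proof (re_le_Cmod (z ^ S n)%C) as H2. rewrite Cmod_pow in H2.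
    rewrite (S_INR (S n)). pose proof (Rabs_pos (Im z)). pose proof (Rabs_pos (Re z)).
    apply Rle_trans with (Cmod z * (INR (S n) * Cmod z ^ n * Rabs (Im z)) + Rabs (Im z) * Cmod z ^ S n).
    + apply Rplus_le_compat; [apply Rmult_le_compat; trivial; apply Rabs_pos|].
      apply Rmult_le_compat_l; trivial.
    + cbn [pow]. lra.
Qed.

(** Evenness enters through [Im (z^2) = 2 Re z Im z], which gains the factor
    [|Re z| / |z|] over [Im_pow_le]. *)
Lemma Im_pow_even_le (z : C) p : (2 <= p)%nat -> Nat.Even p ->
  Rabs (Im (z ^ p)%C) <= INR p * Cmod z ^ (p - 2) * (Rabs (Re z) * Rabs (Im z)).
Proof.
  intros Hp [q ->]. destruct q as [|q]; [lia|].
  rewrite Cpow_mult_r. apply Rle_trans with (1 := Im_pow_le _ _).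
  replace (2 * S q - 2)%nat with (2 * q)%nat by lia.
  rewrite Cmod_pow, <- pow_mult, mult_INR. apply Req_le.
  replace (Im (z ^ 2)%C) with (2 * (Re z * Im z)) by (cbn; unfold Re, Im; ring).
  rewrite !Rabs_mult, (Rabs_pos_eq 2) by lra. cbn [INR]. ring.
Qed.

(** The function expands the hyperbolic metric of the half-planes, by a factor of
    at least [|z| / |Re z|]. *)
Lemma esum_expansion_even p (z : C) : (2 <= p)%nat -> Nat.Even p -> z <> 0%C ->
  Cmod z * Rabs (Im (esum p 0 z)) <= Rabs (Re z) * Rabs (Im z) * Cmod (esum p 1 z).
Proof.
  intros Hp He Hz. apply Cmod_gt_0 in Hz.
  pose proof (esum_expansion p z Hp) as H1. pose proof (Im_pow_even_le z p Hp He) as H2.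
  pose proof (Cmod_ge_0 (esum p 1 z)) as H3.
  assert (P : 0 < INR p) by (apply lt_0_INR; lia).
  assert (Q : 0 < INR p * Cmod z ^ (p - 2)) by (apply Rmult_lt_0_compat; [trivial|now apply pow_lt]).
  apply Rmult_le_reg_l with (1 := Q).
  replace (p - 1)%nat with (S (p - 2)) in H1 by lia. cbn [pow] in H1.
  apply Rmult_le_compat_r with (r := Cmod (esum p 1 z)) in H2; trivial. lra.
Qed.

(** * Symmetries and the real axis *)

Lemma Cpow_opp_even (x : C) p : Nat.Even p -> ((- x) ^ p = x ^ p)%C.
Proof. intros [q ->]. rewrite !Cpow_mult_r. f_equal. cbn. ring. Qed.

(** The symmetries of [esum] in this and the next lemma are read off from the
    finite sums, which by [bsum_sec] are real polynomials in [x^p] times a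
    power of [x]. *)
Lemma esum_even p (z : C) : (2 <= p)%nat -> Nat.Even p ->
  esum p 0 (- z) = esum p 0 z /\ esum p 1 (- z) = (- esum p 1 z)%C.
Proof.
  intros Hp He. split.
  - rewrite <- !esum_p by lia.
    apply (Clim_unique (fun n => bsum p p (S n) (z / INR (S n))%C)); [|exact (proj1 (esum_limit _ _ _))].
    apply (Clim_ext (fun n => bsum p p (S n) (- z / INR (S n))%C)); [|exact (proj1 (esum_limit _ _ _))].
    intros n. rewrite !(bsum_sec p (S n) _ p 0) by lia.
    replace (- z / INR (S n))%C with (- (z / INR (S n)))%C by (unfold Cdiv; ring).
    rewrite (Cpow_opp_even _ p He). reflexivity.
  - replace (- esum p 1 z)%C with ((-1) * esum p 1 z)%C by ring.
    apply (Clim_unique (fun n => (-1) * bsum p 1 (S n) (z / INR (S n)))%C); [|apply Clim_scal; exact (proj1 (esum_limit _ _ _))].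
    apply (Clim_ext (fun n => bsum p 1 (S n) (- z / INR (S n))%C)); [|exact (proj1 (esum_limit _ _ _))].
    intros n. rewrite !(bsum_sec p (S n) _ 1 (p - 1)) by lia.
    replace (- z / INR (S n))%C with (- (z / INR (S n)))%C by (unfold Cdiv; ring).
    rewrite (Cpow_opp_even _ p He).
    destruct He as [q Hq]. replace (p - 1)%nat with (S (2 * (q - 1))) by lia.
    rewrite !Cpow_S, Cpow_opp_even by (eexists; reflexivity). ring.
Qed.

Lemma esum_real p i (x : R) : (1 <= i <= p)%nat ->
  Im (esum p i x) = 0 /\ (0 <= x -> 0 <= Re (esum p i x)).
Proof.
  intros Hi.
  assert (B : forall n, exists y w : R, (0 <= x -> 0 <= y /\ 0 <= w) /\
     bsum p i (S n) (x / INR (S n))%C = (y * sec p (S n) (p - i) w)%C).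
  { intros n. assert (N : 0 < INR (S n)) by (apply lt_0_INR; lia).
    exists (INR p * (x / INR (S n)) ^ (p - i)), ((x / INR (S n)) ^ p). split.
    - intros Hx. assert (0 <= x / INR (S n)) by (apply Rmult_le_pos; [trivial|apply Rlt_le, Rinv_0_lt_compat, N]).
      split; [apply Rmult_le_pos; [apply pos_INR|]|]; apply pow_le; trivial.
    - rewrite (bsum_sec p (S n) _ i (p - i)) by lia.
      rewrite RtoC_mult, !RtoC_pow, RtoC_div by (now apply not_0_INR). reflexivity. }
  destruct (esum_limit p i x) as [L _].
  assert (Tri : forall (s : R) (F : C -> R), Rabs s = 1 -> (forall a b : C, F a - F b = F (a - b)%C) ->
    (forall a : C, Rabs (F a) <= Cmod a) -> forall a b, Rabs (s * F a - s * F b) <= Cmod (a - b)).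
  { intros s F Hs H1 H2 a b. rewrite <- Rmult_minus_distr_l, Rabs_mult, Hs, H1, Rmult_1_l. apply H2. }
  assert (Z : forall (s : R) (F : C -> R), Rabs s = 1 -> (forall a b : C, F a - F b = F (a - b)%C) ->
    (forall a : C, Rabs (F a) <= Cmod a) ->
    (forall n, s * F (bsum p i (S n) (x / INR (S n))%C) <= 0) -> s * F (esum p i x) <= 0).
  { intros s F Hs H1 H2 H3.
    pose proof (Clim_le_linear _ _ _ _ (fun a => s * F a) 0 0 (Tri s F Hs H1 H2)
      (fun n _ => Rle_trans _ _ _ (H3 n) (Req_le _ _ (eq_sym (Rmult_0_l _)))) (Rle_refl 0) L L) as Q.
    now rewrite Rmult_0_l in Q. }
  assert (IB : forall n, Im (bsum p i (S n) (x / INR (S n))%C) = 0).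
  { intros n. destruct (B n) as [y [w [_ ->]]]. rewrite im_scal_l, Im_real_line. ring. }
  split.
  - assert (A1 : 1 * Im (esum p i x) <= 0).
    { apply (Z 1 Im); [apply Rabs_R1|reflexivity|apply Rabs_Im_le|]. intros n. rewrite IB; lra. }
    assert (A2 : - 1 * Im (esum p i x) <= 0).
    { apply (Z (-1) Im); [rewrite Rabs_left; lra|reflexivity|apply Rabs_Im_le|]. intros n. rewrite IB; lra. }
    lra.
  - intros Hx. assert (A2 : - 1 * Re (esum p i x) <= 0); [|lra].
    apply (Z (-1) Re); [rewrite Rabs_left; lra|reflexivity|apply re_le_Cmod|].
    intros n. destruct (B n) as [y [w [H ->]]]. destruct (H Hx) as [Hy Hw].
    destruct (sec_nonneg p (S n) (p - i) w Hw) as [r [Hr ->]]. rewrite re_scal_l; cbn. nra.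
Qed.

Definition rsum (p i : nat) (x : R) : R := Re (esum p i x).

Lemma esum_rsum p i (x : R) : (1 <= i <= p)%nat -> esum p i x = rsum p i x.
Proof. intros H. apply C_ext; cbn; trivial. now apply esum_real. Qed.

Lemma esum0_rsum p (x : R) : (1 <= p)%nat -> esum p 0 x = rsum p 0 x.
Proof. intros H. unfold rsum. rewrite <- esum_p by trivial. apply esum_rsum; lia. Qed.

Lemma is_derive_rsum p i x : is_derive (rsum p i) x (rsum p (S i) x).
Proof.
  destruct (Cderiv_esum p i (RtoC x)) as [G _].
  replace (rsum p (S i) x) with (Re (esum p (S i) x * (1, 0))%C) by (unfold rsum; cbn; unfold Re, Im; ring).
  apply (grad_path (fun w => Re (esum p i w)) (fun s => s) (fun _ => 0)); trivial.
  - auto_derive; trivial.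
  - auto_derive; trivial.
Qed.

Lemma rsum_0_0 p : (1 <= p)%nat -> rsum p 0 0 = INR p.
Proof.
  intros Hp. unfold rsum, esum.
  rewrite (csum_ext _ (fun _ => 1%C)).
  - clear. induction p as [|n IH]; [reflexivity|]. cbn [csum]. rewrite re_plus, IH, S_INR. reflexivity.
  - intros k _. rewrite Cmult_0_r, Cexp_0. cbn. ring.
Qed.

Lemma le_by_derivative (f g f' g' : R -> R) x : 0 <= x ->
  (forall t, is_derive f t (f' t)) -> (forall t, is_derive g t (g' t)) ->
  f 0 <= g 0 -> (forall t, 0 <= t -> f' t <= g' t) -> f x <= g x.
Proof.
  intros Hx Hf Hg H0 H.
  destruct (MVT_gen (fun t => g t - f t) 0 x (fun t => g' t - f' t)) as [c [Hc E]].
  - intros t _. apply (is_derive_minus (V := R_NormedModule)); trivial.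
  - intros t _. apply derivable_continuous_pt. exists (g' t - f' t). apply is_derive_Reals.
    apply (is_derive_minus (V := R_NormedModule)); trivial.
  - rewrite Rmin_left, Rmax_right in Hc by lra. specialize (H c ltac:(lra)). nra.
Qed.

Lemma rsum_0_ge p x : (1 <= p)%nat -> 0 <= x -> INR p <= rsum p 0 x.
Proof.
  intros Hp Hx. apply (le_by_derivative (fun _ => INR p) (rsum p 0) (fun _ => 0) (rsum p 1)); trivial.
  - intros; auto_derive; trivial.
  - intros; apply is_derive_rsum.
  - rewrite rsum_0_0 by trivial; lra.
  - intros t Ht. now apply esum_real.
Qed.

Lemma is_derive_power_term c m t :
  is_derive (fun x => c * (x ^ S m / INR (fact (S m)))) t (c * (t ^ m / INR (fact m))).
Proof.
  assert (E : INR (fact (S m)) = INR (S m) * INR (fact m)) by (rewrite fact_simpl; apply mult_INR).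
  pose proof (INR_fact_neq_0 m). assert (INR (S m) <> 0) by (now apply not_0_INR).
  rewrite E. generalize dependent (INR (fact m)). intros F _ HF.
  auto_derive; trivial. cbn [pred]. change (match m with O => 1 | S _ => INR m + 1 end) with (INR (S m)).
  field; split; trivial.
Qed.

(** Integrate [rsum p p >= p] repeatedly: the derivatives of [rsum p 0] at [0] are
    nonnegative. *)
Lemma rsum_power_ge p m x : (m < p)%nat -> 0 <= x ->
  INR p * (x ^ m / INR (fact m)) <= rsum p (p - m) x.
Proof.
  intros Hm. revert x. induction m as [|m IH]; intros x Hx.
  - unfold rsum. rewrite Nat.sub_0_r, esum_p by lia. cbn. unfold Rdiv. rewrite Rinv_1, !Rmult_1_r.
    apply rsum_0_ge; trivial; lia.
  - apply (le_by_derivative (fun x => INR p * (x ^ S m / INR (fact (S m)))) (rsum p (p - S m))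
      (fun x => INR p * (x ^ m / INR (fact m))) (rsum p (p - m))); trivial.
    + intros t. apply is_derive_power_term.
    + intros t. replace (p - m)%nat with (S (p - S m)) by lia. apply is_derive_rsum.
    + rewrite pow_i by lia. unfold Rdiv. rewrite Rmult_0_l, Rmult_0_r.
      apply esum_real; [lia|lra].
    + intros t Ht. apply IH; trivial; lia.
Qed.

Lemma rsum_1_pos p x : (2 <= p)%nat -> 0 < x -> 0 < rsum p 1 x.
Proof.
  intros Hp Hx. pose proof (rsum_power_ge p (p - 1) x ltac:(lia) ltac:(lra)) as H.
  replace (p - (p - 1))%nat with 1%nat in H by lia.
  apply Rlt_le_trans with (2 := H). apply Rmult_lt_0_compat; [apply lt_0_INR; lia|].
  apply Rdiv_lt_0_compat; [now apply pow_lt|apply INR_fact_lt_0].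
Qed.

Lemma rsum_0_power_ge p x : (1 <= p)%nat -> 0 <= x ->
  INR p + INR p * (x ^ p / INR (fact p)) <= rsum p 0 x.
Proof.
  intros Hp Hx. destruct p as [|m]; [lia|].
  apply (le_by_derivative (fun x => INR (S m) + INR (S m) * (x ^ S m / INR (fact (S m)))) (rsum (S m) 0)
    (fun x => INR (S m) * (x ^ m / INR (fact m))) (rsum (S m) 1)); trivial.
  - intros t. rewrite <- (Rplus_0_l (INR (S m) * (t ^ m / _))).
    apply (is_derive_plus (V := R_NormedModule)); [apply (is_derive_const (V := R_NormedModule))|apply is_derive_power_term].
  - intros t. apply is_derive_rsum.
  - rewrite pow_i by lia. unfold Rdiv. rewrite rsum_0_0 by lia. lra.
  - intros t Ht. pose proof (rsum_power_ge (S m) m t ltac:(lia) Ht) as H.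
    replace (S m - m)%nat with 1%nat in H by lia. exact H.
Qed.

Lemma fact_le_pow k n : (k <= n)%nat -> INR (fact k) <= INR n ^ k.
Proof.
  induction k as [|k IH]; intros H; [cbn; lra|].
  rewrite fact_simpl, mult_INR. cbn [pow]. apply Rmult_le_compat; try apply pos_INR.
  - now apply le_INR.
  - apply IH; lia.
Qed.

(** For [x <= p - 1] the constant term [p] of the power series suffices, beyond
    that the term of degree [p] is at least [x]. *)
Lemma rsum_0_gt_id p x : (2 <= p)%nat -> 0 <= x -> x + 1 <= rsum p 0 x.
Proof.
  intros Hp Hx. pose proof (rsum_0_power_ge p x ltac:(lia) Hx) as H.
  assert (F : 0 < INR (fact p)) by apply INR_fact_lt_0.
  assert (P2 : 2 <= INR p) by (apply (le_INR 2); lia).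
  destruct (Rle_or_lt x (INR p - 1)) as [L|L].
  - assert (0 <= INR p * (x ^ p / INR (fact p))); [|lra].
    apply Rmult_le_pos; [lra|]. apply Rmult_le_pos; [now apply pow_le|apply Rlt_le, Rinv_0_lt_compat, F].
  - assert (x <= INR p * (x ^ p / INR (fact p))); [|lra].
    destruct p as [|m]; [lia|].
    replace (INR (S m) * (x ^ S m / INR (fact (S m)))) with (x * (x ^ m / INR (fact m))).
    + rewrite <- (Rmult_1_r x) at 1. apply Rmult_le_compat_l; trivial.
      pose proof (INR_fact_lt_0 m). apply Rmult_le_reg_r with (INR (fact m)); trivial.
      unfold Rdiv. rewrite Rmult_assoc, Rinv_l, Rmult_1_l, Rmult_1_r by lra.
      apply Rle_trans with (1 := fact_le_pow m m (le_n _)). apply pow_incr.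
      rewrite S_INR in L. split; [apply pos_INR|lra].
    + rewrite fact_simpl, mult_INR. cbn [pow]. field.
      split; [apply INR_fact_neq_0|now apply not_0_INR].
Qed.

(** * Domination by a single exponential *)

Lemma omega_gap p : exists c, 0 <= c < 1 /\ forall k, (0 < k < p)%nat -> Re (omega p ^ k) <= c.
Proof.
  assert (H : forall n, (n <= p)%nat -> exists c, 0 <= c < 1 /\ forall k, (0 < k < n)%nat -> Re (omega p ^ k) <= c).
  { induction n as [|n IH]; intros Hn.
    - exists 0; split; [lra|]. intros; lia.
    - destruct (IH ltac:(lia)) as [c [Hc K]].
      destruct (Nat.eq_dec n 0) as [->|N]; [exists c; split; trivial; intros; lia|].
      exists (Rmax c (Re (omega p ^ n))). pose proof (Re_omega_pow p n ltac:(lia)). split.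
      + split; [apply Rle_trans with (2 := Rmax_l _ _); lra|]. apply Rmax_lub_lt; lra.
      + intros k Hk. destruct (Nat.eq_dec k n) as [->|]; [apply Rmax_r|].
        apply Rle_trans with (2 := Rmax_l _ _). apply K; lia. }
  apply (H p); lia.
Qed.

Lemma esum_minus_exp p i (z : C) c : (1 <= p)%nat -> 0 <= Re z ->
  (forall k, (0 < k < p)%nat -> Re (omega p ^ k) <= c) ->
  Cmod (esum p i z - Cexp z) <= INR p * exp (c * Re z + Rabs (Im z)).
Proof.
  intros Hp Hz Hc. destruct p as [|m]; [lia|].
  unfold esum. rewrite csum_first.
  replace ((omega (S m) ^ 0) ^ i * Cexp (omega (S m) ^ 0 * z))%C with (Cexp z).
  2: { change (omega (S m) ^ 0)%C with (RtoC 1). rewrite Cpow_1_l, !Cmult_1_l. reflexivity. }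
  match goal with |- Cmod (?a + ?b - ?a) <= _ => replace (a + b - a)%C with b by ring end.
  apply Rle_trans with (INR m * exp (c * Re z + Rabs (Im z))).
  - apply csum_Cmod. intros k Hk.
    rewrite Cmod_mult, Cmod_pow, Cmod_omega_pow, pow1, Rmult_1_l, Cmod_Cexp.
    assert (L : Re (omega (S m) ^ S k * z) <= c * Re z + Rabs (Im z)).
    { rewrite re_mult. specialize (Hc (S k) ltac:(lia)).
      pose proof (Rabs_Im_le (omega (S m) ^ S k)%C) as H. rewrite Cmod_omega_pow in H.
      assert (Rabs (Im (omega (S m) ^ S k)%C * Im z) <= Rabs (Im z)).
      { rewrite Rabs_mult. pose proof (Rabs_pos (Im z)). nra. }
      pose proof (Rle_abs (- (Im (omega (S m) ^ S k)%C * Im z))) as Q. rewrite Rabs_Ropp in Q. nra. }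
    now apply exp_monotone.
  - apply Rmult_le_compat_r; [apply Rlt_le, exp_pos|]. apply le_INR; lia.
Qed.

(** In a thin sector around the positive axis the term [k = 0] dominates all the
    others, for all derivatives at once. *)
Lemma esum_dominated p kappa : (1 <= p)%nat -> 0 < kappa ->
  exists eps X, 0 < eps /\ 0 < X /\ forall i (z : C), X <= Re z -> Rabs (Im z) <= eps * Re z ->
    Cmod (esum p i z - Cexp z) <= kappa * exp (Re z).
Proof.
  intros Hp Hk. destruct (omega_gap p) as [c [Hc G]].
  assert (P : 0 < INR p) by (apply lt_0_INR; lia).
  exists ((1 - c) / 2), (2 * INR p / (kappa * (1 - c))).
  assert (K : 0 < kappa * (1 - c)) by (apply Rmult_lt_0_compat; lra).
  assert (XP : 0 < 2 * INR p / (kappa * (1 - c))) by (apply Rdiv_lt_0_compat; lra).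
  split; [lra|]. split; [trivial|].
  intros i z Hz Hi. apply Rle_trans with (1 := esum_minus_exp p i z c Hp ltac:(lra) G).
  set (t := (1 - c) / 2 * Re z).
  assert (T : INR p / kappa <= t).
  { unfold t. apply Rmult_le_compat_l with (r := (1 - c) / 2) in Hz; [|lra].
    apply Rle_trans with (2 := Hz). apply Req_le. field. split; lra. }
  assert (E : exp (c * Re z + Rabs (Im z)) <= exp (Re z - t)).
  { assert (L : c * Re z + Rabs (Im z) <= Re z - t) by (unfold t; lra).
    now apply exp_monotone. }
  apply Rle_trans with (INR p * exp (Re z - t)); [apply Rmult_le_compat_l; lra|].
  unfold Rminus. rewrite exp_plus, exp_Ropp.
  pose proof (exp_ineq1_le t) as Q. pose proof (exp_pos (Re z)) as EP. pose proof (exp_pos t) as ET.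
  assert (Q2 : INR p <= kappa * exp t).
  { apply Rle_trans with (kappa * (INR p / kappa)); [apply Req_le; field; lra|].
    apply Rmult_le_compat_l; lra. }
  apply Rmult_le_reg_r with (exp t); trivial.
  replace (INR p * (exp (Re z) * / exp t) * exp t) with (INR p * exp (Re z)) by (field; lra).
  nra.
Qed.

(** * Derivatives of iterates *)

Fixpoint iter_d (f f1 : C -> C) (n : nat) (z : C) : C :=
  match n with
  | O => 1%C
  | S n => (f1 (Nat.iter n f z) * iter_d f f1 n z)%C
  end.

Fixpoint iter_d2 (f f1 f2 : C -> C) (n : nat) (z : C) : C :=
  match n with
  | O => 0%C
  | S n => (f2 (Nat.iter n f z) * iter_d f f1 n z * iter_d f f1 n z
            + f1 (Nat.iter n f z) * iter_d2 f f1 f2 n z)%C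
  end.

Section Iterates.
Variables f f1 f2 : C -> C.
Hypothesis Hf : forall z, Cderiv f z (f1 z).
Hypothesis Hf1 : forall z, Cderiv f1 z (f2 z).
Hypothesis Hf2 : forall z, Ccont f2 z.

Lemma Cderiv_iter n z : Cderiv (Nat.iter n f) z (iter_d f f1 n z).
Proof.
  induction n as [|n IH]; [apply Cderiv_id|].
  apply (Cderiv_comp f (Nat.iter n f)); trivial.
Qed.

Lemma Cderiv_iter_d n z : Cderiv (iter_d f f1 n) z (iter_d2 f f1 f2 n z).
Proof.
  induction n as [|n IH]; [apply Cderiv_const|].
  apply (Cderiv_mult (fun w => f1 (Nat.iter n f w)) (iter_d f f1 n)); trivial.
  apply (Cderiv_comp f1 (Nat.iter n f)); trivial. apply Cderiv_iter.
Qed.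

Lemma Ccont_iter n z : Ccont (Nat.iter n f) z.
Proof. eapply Cderiv_cont, Cderiv_iter. Qed.

Lemma Ccont_iter_d n z : Ccont (iter_d f f1 n) z.
Proof. eapply Cderiv_cont, Cderiv_iter_d. Qed.

Lemma Ccont_iter_d2 n z : Ccont (iter_d2 f f1 f2 n) z.
Proof.
  induction n as [|n IH]; [apply Ccont_const|]. cbn [iter_d2].
  apply Ccont_plus; apply Ccont_mult; trivial.
  - apply Ccont_mult; [|apply Ccont_iter_d]. apply (Ccont_comp f2); trivial. apply Ccont_iter.
  - apply Ccont_iter_d.
  - apply (Ccont_comp f1); [|apply Ccont_iter]. eapply Cderiv_cont, Hf1.
Qed.
End Iterates.

(** * Consequences of the gradient bound *)

Lemma Rcont_line (v : C -> R) (a h : C) :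
  (forall z, Rcont v z) -> forall t : R, continuity_pt (fun t : R => v (a + t * h)%C) t.
Proof.
  intros Hv t. apply continuity_pt_filterlim.
  apply (Rcont_section (fun w => v (a + Im w * h)%C) 0).
  apply (Rcont_comp v); trivial.
  apply Ccont_plus; [apply Ccont_const|]. apply Ccont_mult; [|apply Ccont_const].
  split; [apply Rcont_Im|exact (Rcont_const 0 _)].
Qed.

Lemma same_sign_on_segment (v : C -> R) (a b : C) :
  (forall z, Rcont v z) -> (forall t : R, 0 <= t <= 1 -> v (a + t * (b - a))%C <> 0) -> 0 < v a * v b.
Proof.
  intros Hv Hn. set (g := fun t : R => v (a + t * (b - a))%C).
  assert (Ga : g 0 = v a) by (unfold g; f_equal; ring).
  assert (Gb : g 1 = v b) by (unfold g; f_equal; ring).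
  destruct (Rle_or_lt (v a * v b) 0) as [L|L]; trivial. exfalso.
  destruct (IVT_gen g 0 1 0) as [t [Ht E]].
  - intros t. apply Rcont_line, Hv.
  - rewrite Ga, Gb. unfold Rmin, Rmax. destruct (Rle_dec (v a) (v b)); nra.
  - rewrite Rmin_left, Rmax_right in Ht by lra. exact (Hn t Ht E).
Qed.

Lemma segment_in_disc (c a b : C) r (t : R) : 0 <= t <= 1 ->
  Cmod (a - c) < r -> Cmod (b - c) < r -> Cmod (a + t * (b - a) - c) < r.
Proof.
  intros Ht Ha Hb.
  replace (a + t * (b - a) - c)%C with ((1 - t)%R * (a - c) + t * (b - c))%C
    by (rewrite RtoC_minus; ring).
  apply Rle_lt_trans with (1 := Cmod_triangle _ _).
  rewrite !Cmod_mult, !Cmod_R, !Rabs_pos_eq by lra.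
  pose proof (Cmod_ge_0 (a - c)). pose proof (Cmod_ge_0 (b - c)).
  destruct (Req_dec t 0) as [->|]; nra.
Qed.

(** The gradient bound for the harmonic function [Im g], or its negative; it has
    constant sign because the disc is connected. *)
Lemma half_plane_bound (g g1 g2 : C -> C) z0 r : 0 < r ->
  (forall z, Cderiv g z (g1 z)) -> (forall z, Cderiv g1 z (g2 z)) -> (forall z, Ccont g2 z) ->
  (forall z, Cmod (z - z0) < r -> Im (g z) <> 0) ->
  r * Cmod (g1 z0) <= 2 * Rabs (Im (g z0)).
Proof.
  intros Hr H1 H2 H3 Hn.
  assert (C0 : Cmod (z0 - z0) < r).
  { replace (z0 - z0)%C with (RtoC 0) by ring. now rewrite Cmod_0. }
  set (s := if Rle_dec 0 (Im (g z0)) then 1 else -1).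
  assert (Hs : Rabs s = 1 /\ s * Im (g z0) = Rabs (Im (g z0)) /\ s * s = 1).
  { unfold s; destruct (Rle_dec 0 (Im (g z0))).
    - rewrite Rabs_R1, Rabs_pos_eq; lra.
    - rewrite Rabs_left, Rabs_left; lra. }
  destruct Hs as [S1 [S2 S3]].
  assert (K : r * Cmod (s * (- Ci * g1 z0))%C <= 2 * (s * Im (g z0))).
  { apply (gradient_bound (fun z => s * Im (g z)) (fun z => s * (- Ci * g1 z))%C
      (fun z => s * (- Ci * g2 z))%C); trivial.
    - intros z Hz.
      assert (Q : 0 < Im (g z0) * Im (g z)).
      { apply (same_sign_on_segment (fun z => Im (g z))).
        - intros w. exact (proj2 (Cderiv_cont _ _ _ (H1 w))).
        - intros t Ht. apply Hn. now apply segment_in_disc. }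
      pose proof (Hn z0 C0). pose proof (Rabs_pos (Im (g z0))). 
      assert (0 < Rabs (Im (g z0))) by (now apply Rabs_pos_lt).
      assert (0 < (s * Im (g z0)) * (s * Im (g z))).
      { replace ((s * Im (g z0)) * (s * Im (g z))) with ((s * s) * (Im (g z0) * Im (g z))) by ring.
        rewrite S3; lra. }
      nra.
    - intros z _. eapply grad_eq; [reflexivity| |apply (grad_mult (fun _ => s) (fun z => Im (g z)) z _ _ (grad_const s z) (proj2 (H1 z)))].
      ring.
    - intros z _. apply Cderiv_scal, Cderiv_scal, H2.
    - intros z _. apply (Ccont_mult (fun _ => RtoC s)); [apply Ccont_const|].
      apply (Ccont_mult (fun _ => (- Ci)%C)); [apply Ccont_const|apply H3]. }
  rewrite !Cmod_mult, Cmod_R, S1, Cmod_opp, Cmod_Ci, S2 in K. lra.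
Qed.

Lemma ln_Cmod_grad (z : C) : z <> 0%C -> grad (fun w => ln (Cmod w)) z (/ z)%C.
Proof.
  intros Hz. pose proof (norm2_pos z Hz) as P.
  set (n := fun w => Re w * Re w + Im w * Im w). pose proof (grad_norm2 z) as Hn. fold n in Hn.
  assert (G : grad (fun w => ln (sqrt (n w))) z (RtoC (/ (2 * n z)) * (2 * Cconj z))%C).
  { apply (grad_comp1 (fun x => ln (sqrt x)) n); trivial.
    assert (0 < sqrt (n z)) by (now apply sqrt_lt_R0).
    auto_derive; [split; [exact P|split; trivial]|].
    field_simplify_eq; [|split; [unfold n; lra|lra]].
    rewrite pow2_sqrt by (unfold n; lra). ring. }
  eapply grad_eq; [| |exact G].
  - intros w. unfold n, Cmod. do 2 f_equal. unfold Re, Im; cbn; ring.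
  - apply C_ext; cbn; unfold n, Re, Im in *; field; nra.
Qed.

(** By the gradient bound on discs of radius [r / 2], the function
    [u = ln |g|] satisfies [|grad u| <= (4 / r) u] near [c].  Two points at
    distance at most [r / 2] thus have values of [u] with quotient at most
    [exp 2]: along the segment, [u * exp (-2 t)] does not increase. *)
Lemma log_harnack (g g1 g2 : C -> C) c r a b : 0 < r ->
  (forall z, Cderiv g z (g1 z)) -> (forall z, Cderiv g1 z (g2 z)) -> (forall z, Ccont g2 z) ->
  (forall z, Cmod (z - c) < r -> 1 <= Cmod (g z)) ->
  Cmod (a - c) < r / 4 -> Cmod (b - c) < r / 4 ->
  ln (Cmod (g b)) <= exp 2 * ln (Cmod (g a)).
Proof.
  intros Hr H1 H2 H3 Hg Ha Hb.
  set (u := fun z => ln (Cmod (g z))).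
  set (d := fun z => (g1 z * / g z)%C).
  set (d' := fun z => (g2 z * / g z + g1 z * (- / (g z * g z) * g1 z))%C).
  assert (Nz : forall z, Cmod (z - c) < r -> g z <> 0%C).
  { intros z Hz. apply Cmod_gt_0. specialize (Hg z Hz). lra. }
  assert (Hu : forall z, Cmod (z - c) < r -> 0 <= u z).
  { intros z Hz. unfold u. rewrite <- ln_1. specialize (Hg z Hz).
    destruct (Rle_lt_or_eq_dec _ _ Hg) as [L|L]; [apply Rlt_le, ln_increasing; lra|rewrite <- L; lra]. }
  assert (Gu : forall z, Cmod (z - c) < r -> grad u z (d z)).
  { intros z Hz. unfold d. rewrite Cmult_comm.
    apply (grad_comp (fun w => ln (Cmod w)) g); trivial. now apply ln_Cmod_grad, Nz. }
  assert (Dd : forall z, Cmod (z - c) < r -> Cderiv d z (d' z)).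
  { intros z Hz. apply (Cderiv_mult g1 (fun z => / g z)%C); trivial.
    apply (Cderiv_comp Cinv g); trivial. now apply Cderiv_inv, Nz. }
  assert (Cd : forall z, Cmod (z - c) < r -> Ccont d' z).
  { intros z Hz. pose proof (Nz z Hz) as N.
    assert (Cg : Ccont g z) by (eapply Cderiv_cont, H1).
    assert (Cg1 : Ccont g1 z) by (eapply Cderiv_cont, H2).
    apply Ccont_plus; apply Ccont_mult; trivial.
    - now apply Ccont_inv.
    - apply Ccont_mult; trivial.
      eapply Ccont_eq; [|apply (Ccont_mult (fun _ => (-1)%C) (fun z => / (g z * g z))%C)].
      + intros y; cbn beta; ring.
      + apply Ccont_const.
      + apply (Ccont_inv (fun z => g z * g z)%C); [now apply Cmult_neq_0|now apply Ccont_mult]. }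
  assert (In : forall t : R, 0 <= t <= 1 -> Cmod (a + t * (b - a) - c) < r / 4).
  { intros t Ht. now apply segment_in_disc. }
  assert (Near : forall w z, Cmod (w - c) < r / 4 -> Cmod (z - w) < r / 2 -> Cmod (z - c) < r).
  { intros w z Hw Hz. replace (z - c)%C with ((z - w) + (w - c))%C by ring.
    apply Rle_lt_trans with (1 := Cmod_triangle _ _). lra. }
  assert (Bd : forall w, Cmod (w - c) < r / 4 -> r / 2 * Cmod (d w) <= 2 * u w).
  { intros w Hw. apply (gradient_bound u d d' w (r / 2)); try (intros z Hz; specialize (Near w z Hw Hz); auto). lra. }
  set (phi := fun t : R => u (a + t * (b - a))%C * exp (- 2 * t)).
  set (dphi := fun t : R => (Re (d (a + t * (b - a)) * (b - a))%C - 2 * u (a + t * (b - a))%C) * exp (- 2 * t)).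
  assert (D : forall t, 0 <= t <= 1 -> is_derive phi t (dphi t)).
  { intros t Ht.
    assert (Du : is_derive (fun t : R => u (a + t * (b - a))%C) t (Re (d (a + t * (b - a)) * (b - a))%C)).
    { apply (is_derive_ext (fun t => u (Re a + t * Re (b - a), Im a + t * Im (b - a)))).
      - intros s. f_equal. apply C_ext; cbn; unfold Re, Im; ring.
      - replace (d (a + t * (b - a)) * (b - a))%C with (d (a + t * (b - a)) * (Re (b - a), Im (b - a)))%C
          by (now rewrite C_eta).
        apply (grad_path u (fun t => Re a + t * Re (b - a)) (fun t => Im a + t * Im (b - a))).
        + replace (Re a + t * Re (b - a), Im a + t * Im (b - a)) with (a + t * (b - a))%C
            by (apply C_ext; cbn; unfold Re, Im; ring).
          apply Gu. specialize (In t Ht). lra.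
        + auto_derive; [trivial|cbn; unfold Re, Im; ring].
        + auto_derive; [trivial|cbn; unfold Re, Im; ring]. }
    assert (De : is_derive (fun t => exp (- 2 * t)) t (- 2 * exp (- 2 * t))).
    { auto_derive; trivial; ring. }
    pose proof (is_derive_mult _ _ t _ _ Du De Rmult_comm) as K.
    unfold phi, dphi. revert K. unfold plus, mult; cbn -[exp]. intros K.
    match type of K with is_derive _ _ ?e => match goal with |- is_derive _ _ ?e' =>
      replace e' with e by (ring) end end.
    exact K. }
  assert (Le : phi 1 <= phi 0).
  { destruct (MVT_gen phi 0 1 dphi) as [t [Ht E]].
    - intros t; rewrite Rmin_left, Rmax_right by lra. intros Ht; apply D; lra.
    - intros t; rewrite Rmin_left, Rmax_right by lra. intros Ht.
      apply derivable_continuous_pt. eexists. apply is_derive_Reals. apply D; lra.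
    - rewrite Rmin_left, Rmax_right in Ht by lra.
      assert (dphi t <= 0); [|lra].
      unfold dphi. pose proof (exp_pos (- 2 * t)).
      assert (Re (d (a + t * (b - a)) * (b - a))%C <= 2 * u (a + t * (b - a))%C); [|nra].
      apply Rle_trans with (1 := Rle_abs _). apply Rle_trans with (1 := re_le_Cmod _).
      rewrite Cmod_mult. specialize (In t Ht). specialize (Bd _ In).
      assert (Cmod (b - a) <= r / 2).
      { replace (b - a)%C with ((b - c) + - (a - c))%C by ring.
        apply Rle_trans with (1 := Cmod_triangle _ _). rewrite Cmod_opp. lra. }
      pose proof (Cmod_ge_0 (d (a + t * (b - a))%C)). nra. }
  unfold phi in Le. rewrite Rmult_0_r, exp_0, Rmult_1_r in Le.
  replace (a + 0 * (b - a))%C with a in Le by ring. replace (a + 1 * (b - a))%C with b in Le by ring.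
  fold (u b) (u a). rewrite Rmult_1_r in Le. change (exp (-2)) with (exp (Ropp 2)) in Le. rewrite exp_Ropp in Le.
  pose proof (exp_pos 2). apply Rmult_le_reg_r with (/ exp 2); [now apply Rinv_0_lt_compat|].
  apply Rle_trans with (1 := Le). apply Req_le. field. lra.
Qed.

(** * Behaviour far out near the real axis *)

Lemma cos_ge_quadratic x : Rabs x <= 6/5 -> 1 - x * x / 2 <= cos x.
Proof.
  intros H. apply Rabs_le_between in H.
  replace x with (2 * (x / 2)) at 3 by field. rewrite cos_2a_sin.
  assert (S : sin (x / 2) * sin (x / 2) <= (x / 2) * (x / 2)); [|nra].
  pose proof PI2_3_2.
  destruct (Rtotal_order x 0) as [L|[L|L]].
  - assert (A : sin (- (x / 2)) < - (x / 2)) by (apply sin_lt_x; lra).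
    assert (B : 0 < sin (- (x / 2))) by (apply sin_gt_0; lra).
    rewrite sin_neg in *. nra.
  - rewrite L. replace (0 / 2) with 0 by field. rewrite sin_0; lra.
  - assert (A : sin (x / 2) < x / 2) by (apply sin_lt_x; lra).
    assert (B : 0 < sin (x / 2)) by (apply sin_gt_0; lra). nra.
Qed.

Lemma Im_esum0_mvt p (z : C) : (1 <= p)%nat -> exists s, Rabs s <= Rabs (Im z) /\
  Im (esum p 0 z) = Im z * Re (esum p 1 (Re z, s)).
Proof.
  intros Hp. set (x := Re z). set (y := Im z).
  set (h := fun s => Im (esum p 0 (x, s))).
  assert (D : forall s, is_derive h s (Re (esum p 1 (x, s)))).
  { intros s. replace (Re (esum p 1 (x, s))) with (Re (- Ci * esum p 1 (x, s) * (0, 1))%C)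
      by (cbn; unfold Re, Im; ring).
    apply (grad_path (fun w => Im (esum p 0 w)) (fun _ => x) (fun s => s)).
    - apply (Cderiv_esum p 0).
    - auto_derive; trivial.
    - auto_derive; trivial. }
  destruct (MVT_gen h 0 y (fun s => Re (esum p 1 (x, s)))) as [s [Hs E]].
  - intros s _; apply D.
  - intros s _. apply derivable_continuous_pt. eexists. apply is_derive_Reals, D.
  - exists s. split.
    + unfold Rmin, Rmax in Hs. destruct (Rle_dec 0 y).
      * rewrite !Rabs_pos_eq; lra.
      * rewrite !Rabs_left1; lra.
    + unfold h in E. change (x, 0) with (RtoC x) in E.
      replace (Im (esum p 0 x)) with 0 in E.
      * change (x, y) with (Re z, Im z) in E. rewrite C_eta in E. lra.
      * rewrite <- esum_p by trivial. symmetry. apply esum_real; lia.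
Qed.

(** Here [esum p 0] is close to [exp].  Above height [6/5] the bound
    [|sin y| <= 1 <= 5/6 |y|] leaves a definite expansion factor, and below it
    [cos] is bounded away from [0], so that the height at least doubles. *)
Lemma far_right p : (1 <= p)%nat -> exists eps X, 0 < eps /\ 10 <= X /\
  forall z : C, X <= Re z -> Rabs (Im z) <= eps * Re z ->
    (6/5 <= Rabs (Im z) -> 11/10 * Rabs (Im (esum p 0 z)) <= Cmod (esum p 1 z) * Rabs (Im z)) /\
    (Rabs (Im z) <= 6/5 -> 2 * Rabs (Im z) <= Rabs (Im (esum p 0 z))) /\
    2 * Re z + 2 <= Cmod (esum p 0 z).
Proof.
  intros Hp. destruct (esum_dominated p (1/100) Hp ltac:(lra)) as [eps [X0 [He [HX D]]]].
  exists eps, (Rmax X0 10). split; [trivial|]. split; [apply Rmax_r|].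
  intros z Hz Hi.
  assert (Z1 : X0 <= Re z) by (apply Rle_trans with (2 := Hz), Rmax_l).
  assert (Z2 : 10 <= Re z) by (apply Rle_trans with (2 := Hz), Rmax_r).
  pose proof (exp_pos (Re z)) as EP.
  assert (Low : forall i, 99/100 * exp (Re z) <= Cmod (esum p i z)).
  { intros i. pose proof (D i z Z1 Hi) as K.
    pose proof (Cmod_triangle (esum p i z) (- (esum p i z - Cexp z))) as T.
    replace (esum p i z + - (esum p i z - Cexp z))%C with (Cexp z) in T by ring.
    rewrite Cmod_opp, Cmod_Cexp in T. lra. }
  split; [|split].
  - intros Hy.
    pose proof (D 0%nat z Z1 Hi) as K. pose proof (Rabs_Im_le (esum p 0 z - Cexp z)) as K2.
    assert (I : Rabs (Im (esum p 0 z)) <= exp (Re z) * (5/6 * Rabs (Im z) + 1/100)).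
    { replace (Im (esum p 0 z)) with (Im (Cexp z) + Im (esum p 0 z - Cexp z)) by (cbn; unfold Re, Im; ring).
      apply Rle_trans with (1 := Rabs_triang _ _).
      assert (Rabs (Im (Cexp z)) <= exp (Re z) * 1); [|nra].
      cbn. rewrite Rabs_mult, (Rabs_pos_eq (exp _)) by lra.
      apply Rmult_le_compat_l; [lra|]. apply Rabs_le. apply SIN_bound. }
    specialize (Low 1%nat). nra.
  - intros Hy. destruct (Im_esum0_mvt p z Hp) as [s [Hs ->]].
    rewrite Rabs_mult, Rmult_comm. apply Rmult_le_compat_l; [apply Rabs_pos|].
    pose proof (D 1%nat (Re z, s) Z1 (Rle_trans _ _ _ Hs Hi)) as K.
    pose proof (re_le_Cmod (esum p 1 (Re z, s) - Cexp (Re z, s))) as K2.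
    change (Re (Re z, s)) with (Re z) in K.
    assert (C1 : exp (Re z) * (28/100) <= Re (Cexp (Re z, s))).
    { cbn. apply Rmult_le_compat_l; [apply Rlt_le, exp_pos|].
      apply Rle_trans with (2 := cos_ge_quadratic s ltac:(lra)).
      assert (Rabs s * Rabs s <= 6/5 * (6/5)) by (apply Rmult_le_compat; try apply Rabs_pos; lra).
      rewrite <- Rabs_mult in H. pose proof (Rle_abs (s * s)). lra. }
    replace (Re (esum p 1 (Re z, s) - Cexp (Re z, s))) with (Re (esum p 1 (Re z, s)) - Re (Cexp (Re z, s))) in K2 by reflexivity.
    apply Rabs_le_between in K2.
    pose proof (exp_ineq1_le (Re z)). apply Rle_trans with (2 := Rle_abs _).
    assert (27/100 * exp (Re z) <= Re (esum p 1 (Re z, s))) by lra. lra.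
  - specialize (Low 0%nat).
    pose proof (exp_ineq1_le (Re z / 2)).
    assert (exp (Re z) = exp (Re z / 2) * exp (Re z / 2)) by (rewrite <- exp_plus; f_equal; field).
    nra.
Qed.

Lemma far_real p : (2 <= p)%nat -> Nat.Even p -> exists eps X, 0 < eps /\ 10 <= X /\
  forall z : C, X <= Rabs (Re z) -> Rabs (Im z) <= eps * Rabs (Re z) ->
    (6/5 <= Rabs (Im z) -> 11/10 * Rabs (Im (esum p 0 z)) <= Cmod (esum p 1 z) * Rabs (Im z)) /\
    (Rabs (Im z) <= 6/5 -> 2 * Rabs (Im z) <= Rabs (Im (esum p 0 z))) /\
    2 * Rabs (Re z) + 2 <= Cmod (esum p 0 z).
Proof.
  intros Hp He. destruct (far_right p ltac:(lia)) as [eps [X [H1 [H2 H]]]].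
  exists eps, X. split; [trivial|]. split; [trivial|]. intros z Hx Hy.
  destruct (Rle_dec 0 (Re z)) as [L|L].
  - rewrite (Rabs_pos_eq (Re z)) in * by trivial. now apply H.
  - destruct (esum_even p z Hp He) as [E0 E1].
    specialize (H (- z)%C). rewrite E0, E1, Cmod_opp, re_opp, im_opp, Rabs_Ropp in H.
    rewrite (Rabs_left (Re z)) in * by lra. now apply H.
Qed.

Lemma Cmod_esum_le p i (z : C) : Cmod (esum p i z) <= INR p * exp (Cmod z).
Proof.
  apply csum_Cmod. intros k _. rewrite Cmod_mult, Cmod_pow, Cmod_omega_pow, pow1, Rmult_1_l, Cmod_Cexp.
  apply exp_monotone. apply Rle_trans with (1 := Rle_abs _). apply Rle_trans with (1 := re_le_Cmod _).
  rewrite Cmod_mult, Cmod_omega_pow; lra.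
Qed.

(** Points near the real axis follow the real orbit, which moves outwards by at
    least [1]. *)
Lemma near_real_step p X : (2 <= p)%nat -> Nat.Even p -> 0 < X -> forall K, 1 <= K -> exists eta, 0 < eta /\
  forall (lambda : R) (z : C), 1 <= Rabs lambda <= K ->
    Rabs (Re z) <= X -> Rabs (Im z) <= eta -> Rabs (Re z) + 1/2 <= Rabs (Re (lambda * esum p 0 z)%C).
Proof.
  intros Hp He HX K HK.
  assert (P : 0 < INR p) by (apply lt_0_INR; lia).
  set (B := K * (INR p * exp (X + 1))).
  assert (HB : 0 < B) by (repeat apply Rmult_lt_0_compat; trivial; [lra|apply exp_pos]).
  exists (Rmin 1 (/ (2 * B))). split; [apply Rmin_pos; [lra|apply Rinv_0_lt_compat; lra]|].
  intros lambda z Hl Hx Hy.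
  assert (Y1 : Rabs (Im z) <= 1) by (apply Rle_trans with (1 := Hy), Rmin_l).
  assert (Y2 : Rabs (Im z) <= / (2 * B)) by (apply Rle_trans with (1 := Hy), Rmin_r).
  set (x := Re z) in *.
  assert (D : Cmod (esum p 0 z - esum p 0 x) <= (INR p * exp (X + 1)) * Rabs (Im z)).
  { replace (Rabs (Im z)) with (Cmod (Ci * Im z)) by (rewrite Cmod_mult, Cmod_Ci, Cmod_R; ring).
    replace z with (x + Ci * Im z)%C at 1 by (apply C_ext; cbn; unfold x, Re, Im; ring).
    apply (mean_value_ineq (esum p 0) (esum p 1)).
    - intros; apply Cderiv_esum.
    - intros t Ht. apply Rle_trans with (1 := Cmod_esum_le _ _ _).
      apply Rmult_le_compat_l; [lra|]. apply exp_monotone.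
      apply Rle_trans with (1 := Cmod_triangle _ _).
      rewrite !Cmod_mult, Cmod_Ci, !Cmod_R, (Rabs_pos_eq t) by lra. pose proof (Rabs_pos (Im z)). nra. }
  assert (R0 : Rabs x + 1 <= Rabs (rsum p 0 x)).
  { replace (rsum p 0 x) with (rsum p 0 (Rabs x)).
    - apply Rle_trans with (2 := Rle_abs _). apply rsum_0_gt_id; trivial. apply Rabs_pos.
    - unfold Rabs; destruct (Rcase_abs x); trivial. unfold rsum. rewrite RtoC_opp.
      now rewrite (proj1 (esum_even p x Hp He)). }
  assert (S : Rabs lambda * Rabs (Re (esum p 0 z) - rsum p 0 x) <= 1/2).
  { apply Rle_trans with (K * ((INR p * exp (X + 1)) * Rabs (Im z))).
    - apply Rmult_le_compat; try apply Rabs_pos; [lra|]. apply Rle_trans with (2 := D).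
      apply (re_le_Cmod (esum p 0 z - esum p 0 x)).
    - apply Rle_trans with (B * / (2 * B)); [|apply Req_le; field; lra].
      unfold B. rewrite <- Rmult_assoc. apply Rmult_le_compat_l; [fold B; lra|exact Y2]. }
  rewrite re_scal_l.
  replace (lambda * Re (esum p 0 z)) with (lambda * rsum p 0 x - lambda * - (Re (esum p 0 z) - rsum p 0 x)) by ring.
  apply Rle_trans with (2 := Rabs_triang_inv _ _). rewrite !Rabs_mult, Rabs_Ropp.
  pose proof (Rabs_pos x). nra.
Qed.

(** * Preimages of the real axis are dense *)

Lemma ratio_tends_to_1 (s : nat -> R) B del : 0 < s 0%nat -> 0 < del ->
  (forall n, s n <= s (S n)) -> (forall n, s n <= B) ->
  exists N, forall n, (N <= n)%nat -> s (S n) <= (1 + del) * s n.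
Proof.
  intros H0 Hd Hi Hb.
  destruct (ex_finite_lim_seq_incr s B Hi Hb) as [l Hl].
  assert (Hc : forall n, s 0%nat <= s n) by (intros n; induction n; [lra|specialize (Hi n); lra]).
  assert (E : 0 < del * s 0%nat / 2) by (apply Rdiv_lt_0_compat; [now apply Rmult_lt_0_compat|lra]).
  apply is_lim_seq_spec in Hl. destruct (Hl (mkposreal _ E)) as [N HN]. exists N.
  intros n Hn. pose proof (HN n Hn) as A. pose proof (HN (S n) ltac:(lia)) as A'. cbn in A, A'.
  apply Rabs_lt_between in A. apply Rabs_lt_between in A'. specialize (Hc n). nra.
Qed.

Section Density.
Variables (p : nat) (lambda : R).
Hypothesis p_ge_2 : (2 <= p)%nat.
Hypothesis p_even : Nat.Even p.
Hypothesis lambda_ge_1 : 1 <= Rabs lambda.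

Let f := f_lambda p lambda.
Let f1 (z : C) := (lambda * esum p 1 z)%C.
Let f2 (z : C) := (lambda * esum p 2 z)%C.

Lemma Cderiv_f z : Cderiv f z (f1 z).
Proof.
  apply (Cderiv_eq (fun z => lambda * esum p 0 z)%C _ _ (f1 z)); [|trivial|apply Cderiv_scal, Cderiv_esum].
  intros y. symmetry. apply f_lambda_esum. lia.
Qed.

Lemma Cderiv_f1 z : Cderiv f1 z (f2 z).
Proof. apply Cderiv_scal, Cderiv_esum. Qed.

Lemma Ccont_f2 z : Ccont f2 z.
Proof. eapply Cderiv_cont, Cderiv_scal, Cderiv_esum. Qed.

Lemma f_expansion (z : C) : z <> 0%C ->
  Cmod z * Rabs (Im (f z)) <= Rabs (Re z) * (Rabs (Im z) * Cmod (f1 z)).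
Proof.
  intros Hz. pose proof (esum_expansion_even p z p_ge_2 p_even Hz) as H.
  unfold f, f1. rewrite f_lambda_esum, im_scal_l, Rabs_mult, Cmod_mult, Cmod_R by lia.
  pose proof (Rabs_pos lambda). nra.
Qed.

(** If the conclusion fails, [s n = |(f^n)' (z0)| / |Im f^n (z0)|] is bounded by
    [half_plane_bound] and nondecreasing by [f_expansion].  So the expansion
    factor tends to [1], and the orbit ends up in a thin sector around the real
    axis ([Thin]).  There the distance [x n] to the imaginary axis grows by at
    least [1/2] per step ([Grow]), hence the orbit gets far out, where the height
    [y n] doubles but stays below [6/5] ([FarN]). *)
Lemma disc_meets_real_preimage z0 r : 0 < r ->
  exists n z, Cmod (z - z0) < r /\ Im (Nat.iter n f z) = 0.
Proof.
  intros Hr. apply NNPP. intros Hno.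
  assert (Hn : forall n z, Cmod (z - z0) < r -> Im (Nat.iter n f z) <> 0).
  { intros n z Hz E. apply Hno. now exists n, z. }
  clear Hno.
  set (w := fun n => Nat.iter n f z0). set (x := fun n => Rabs (Re (w n))). set (y := fun n => Rabs (Im (w n))).
  assert (C0 : Cmod (z0 - z0) < r).
  { replace (z0 - z0)%C with (RtoC 0) by ring. now rewrite Cmod_0. }
  assert (Yp : forall n, 0 < y n) by (intros n; apply Rabs_pos_lt, Hn, C0).
  assert (Wp : forall n, w n <> 0%C).
  { intros n E. apply (Hn n z0 C0). fold (w n). rewrite E. reflexivity. }
  set (s := fun n => Cmod (iter_d f f1 n z0) / y n).
  assert (Sb : forall n, s n <= 2 / r).
  { intros n. unfold s.
    pose proof (half_plane_bound _ _ _ z0 r Hr (Cderiv_iter f f1 Cderiv_f n) (Cderiv_iter_d f f1 f2 Cderiv_f Cderiv_f1 n)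
      (Ccont_iter_d2 f f1 f2 Cderiv_f Cderiv_f1 Ccont_f2 n) (Hn n)) as K.
    fold (w n) in K. fold (y n) in K. specialize (Yp n).
    apply Rmult_le_reg_r with (y n); trivial. unfold Rdiv. rewrite Rmult_assoc, Rinv_l by lra.
    apply Rmult_le_reg_l with r; trivial. rewrite Rmult_1_r.
    replace (r * (2 * / r * y n)) with (2 * y n) by (field; lra). exact K. }
  (* The orbit is expanded at step [n] by the factor [s (S n) / s n], which is at
     least [|w n| / x n]. *)
  assert (Ex : forall n, Cmod (w n) * y (S n) <= x n * (y n * Cmod (f1 (w n)))).
  { intros n. apply f_expansion, Wp. }
  assert (Wx : forall n, x n <= Cmod (w n)) by (intros n; apply re_le_Cmod).
  assert (Xp : forall n, 0 < x n).
  { intros n. specialize (Ex n). pose proof (Yp n). pose proof (Yp (S n)).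
    pose proof (proj1 (Cmod_gt_0 _) (Wp n)). assert (0 < Cmod (w n) * y (S n)) by (now apply Rmult_lt_0_compat).
    destruct (Rle_lt_or_eq_dec 0 (x n) (Rabs_pos _)) as [L|L]; trivial. rewrite <- L in Ex. lra. }
  assert (Sstep : forall n, s (S n) * y (S n) = Cmod (f1 (w n)) * (s n * y n)).
  { intros n. pose proof (Yp n). pose proof (Yp (S n)). unfold s. cbn [iter_d]. rewrite Cmod_mult.
    fold (w n). field. split; lra. }
  assert (Dp : forall n, 0 < s n).
  { induction n as [|n IH].
    - unfold s. cbn [iter_d]. rewrite Cmod_1. apply Rdiv_lt_0_compat; [lra|apply Yp].
    - specialize (Sstep n). specialize (Ex n). pose proof (Yp n). pose proof (Yp (S n)). pose proof (Xp n). specialize (Wx n).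
      assert (0 < Cmod (f1 (w n))).
      { destruct (Rle_lt_or_eq_dec 0 _ (Cmod_ge_0 (f1 (w n)))) as [L|L]; trivial. rewrite <- L in Ex.
        assert (0 < Cmod (w n) * y (S n)) by (apply Rmult_lt_0_compat; lra). lra. }
      assert (0 < s (S n) * y (S n)); [|nra].
      rewrite Sstep. apply Rmult_lt_0_compat; [trivial|]. apply Rmult_lt_0_compat; trivial. }
  assert (Si : forall n, s n * Cmod (w n) <= s (S n) * x n).
  { intros n. specialize (Sstep n). specialize (Ex n). pose proof (Yp (S n)). pose proof (Dp n).
    apply Rmult_le_reg_r with (y (S n)); trivial.
    apply Rmult_le_compat_l with (r := s n) in Ex; [|lra].
    replace (s (S n) * x n * y (S n)) with (x n * (s (S n) * y (S n))) by ring.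
    rewrite Sstep. lra. }
  assert (Sm : forall n, s n <= s (S n)).
  { intros n. specialize (Si n). pose proof (Dp n). pose proof (Dp (S n)). specialize (Wx n). pose proof (Xp n).
    apply Rmult_le_reg_r with (x n); trivial. nra. }
  destruct (far_real p p_ge_2 p_even) as [eps0 [X [He0 [HX Far]]]].
  destruct (near_real_step p X p_ge_2 p_even ltac:(lra) (Rabs lambda) lambda_ge_1) as [eta [Heta Near]].
  set (eps := Rmin 1 (Rmin eps0 (eta / X))).
  assert (E1 : eps <= 1) by apply Rmin_l.
  assert (E2 : eps <= eps0) by (eapply Rle_trans; [apply Rmin_r|apply Rmin_l]).
  assert (E3 : eps <= eta / X) by (eapply Rle_trans; [apply Rmin_r|apply Rmin_r]).
  assert (E0 : 0 < eps).
  { repeat apply Rmin_pos; try lra. apply Rdiv_lt_0_compat; lra. }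
  (* With this [del], [|w n| <= (1 + del) * x n] gives [y n <= eps * x n], and
     [1 + del] is below the factor [11/10] of [far_real]. *)
  set (del := eps * eps / 30).
  assert (Hd : 0 < del) by (unfold del; apply Rdiv_lt_0_compat; [now apply Rmult_lt_0_compat|lra]).
  assert (Hd2 : del <= 1 / 30) by (unfold del; nra).
  destruct (ratio_tends_to_1 s (2 / r) del (Dp 0%nat) Hd Sm Sb) as [N HN].
  assert (Thin : forall n, (N <= n)%nat -> y n <= eps * x n).
  { intros n Hn'. specialize (HN n Hn'). specialize (Si n). pose proof (Dp n). pose proof (Xp n). pose proof (Yp n).
    assert (A : Cmod (w n) <= (1 + del) * x n).
    { apply Rmult_le_reg_l with (s n); trivial. nra. }
    pose proof (Cmod2_alt (w n)) as Q. 
    rewrite <- (pow2_abs (Re (w n))), <- (pow2_abs (Im (w n))) in Q. fold (x n) (y n) in Q.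
    pose proof (Cmod_ge_0 (w n)).
    assert (Cmod (w n) ^ 2 <= ((1 + del) * x n) ^ 2) by (apply pow_incr; lra).
    assert (y n ^ 2 <= (eps * x n) ^ 2).
    { assert (y n ^ 2 <= (2 * del + del ^ 2) * x n ^ 2) by lra.
      apply Rle_trans with (1 := H4). rewrite Rpow_mult_distr.
      apply Rmult_le_compat_r; [apply pow2_ge_0|].
      assert (eps ^ 2 = 30 * del) by (unfold del; field). nra. }
    pose proof (Yp n).
    assert (0 < eps * x n) by (now apply Rmult_lt_0_compat). nra. }
  assert (Rel : forall n, (N <= n)%nat -> Cmod (f1 (w n)) * y n <= (1 + del) * y (S n)).
  { intros n Hn'. specialize (HN n Hn'). specialize (Sstep n). pose proof (Dp n). pose proof (Yp (S n)).
    apply Rmult_le_reg_l with (s n); trivial. nra. }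
  assert (WS : forall n, w (S n) = (lambda * esum p 0 (w n))%C).
  { intros n. apply (f_lambda_esum p lambda (w n)). lia. }
  assert (Fim : forall n, y (S n) = Rabs lambda * Rabs (Im (esum p 0 (w n)))).
  { intros n. unfold y at 1. rewrite WS, im_scal_l. apply Rabs_mult. }
  assert (Fre : forall n, x (S n) = Rabs (Re (lambda * esum p 0 (w n))%C)).
  { intros n. unfold x at 1. now rewrite WS. }
  assert (FarN : forall n, (N <= n)%nat -> X <= x n ->
    y n < 6/5 /\ 2 * y n <= y (S n) /\ x n + 1/2 <= x (S n)).
  { intros n Hn' Hx. pose proof (Thin n Hn') as T. pose proof (Xp n) as X0. pose proof (Yp (S n)) as Y0.
    destruct (Far (w n)) as [Fa [Fb Fc]]; fold (x n) (y n) in *; [trivial|nra|].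
    assert (A : y n < 6/5).
    { destruct (Rlt_or_le (y n) (6/5)) as [|L]; trivial. exfalso. specialize (Fa L). specialize (Rel n Hn').
      unfold f1 in Rel. rewrite Cmod_mult, Cmod_R in Rel. rewrite Fim in *.
      apply Rmult_le_compat_l with (r := Rabs lambda) in Fa; [|lra]. nra. }
    split; [trivial|]. split.
    - specialize (Fb (Rlt_le _ _ A)). rewrite Fim. pose proof (Yp n). nra.
    - assert (B : 2 * x n + 2 <= Cmod (w (S n))).
      { rewrite WS, Cmod_mult, Cmod_R. nra. }
      pose proof (Thin (S n) ltac:(lia)) as T'. pose proof (Xp (S n)).
      assert (Cmod (w (S n)) <= x (S n) + y (S n)).
      { unfold x, y. rewrite <- (C_eta (w (S n))) at 1.
        replace (Re (w (S n)), Im (w (S n))) with (Re (w (S n)) + Ci * Im (w (S n)))%C by (apply C_ext; cbn; unfold Re, Im; ring).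
        apply Rle_trans with (1 := Cmod_triangle _ _). rewrite Cmod_mult, Cmod_Ci, !Cmod_R. lra. }
      nra. }
  assert (Grow : forall n, (N <= n)%nat -> x n + 1/2 <= x (S n)).
  { intros n Hn'. destruct (Rle_or_lt X (x n)) as [L|L]; [now apply FarN|].
    rewrite Fre. apply Near; [lra|fold (x n); lra|]. fold (y n).
    pose proof (Thin n Hn') as T. pose proof (Xp n).
    apply Rle_trans with (1 := T). apply Rle_trans with (eta / X * X); [|apply Req_le; field; lra].
    apply Rmult_le_compat; lra. }
  assert (Gk : forall k, INR k / 2 <= x (N + k)%nat).
  { induction k as [|k IH]; [cbn; pose proof (Xp (N + 0)%nat); lra|].
    rewrite S_INR, Nat.add_succ_r. specialize (Grow (N + k)%nat ltac:(lia)). lra. }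
  destruct (INR_unbounded (2 * X)) as [k0 Hk0].
  set (n1 := (N + k0)%nat).
  assert (Big : forall k, X <= x (n1 + k)%nat).
  { intros k. unfold n1. rewrite <- Nat.add_assoc. specialize (Gk (k0 + k)%nat).
    rewrite plus_INR in Gk. pose proof (pos_INR k). lra. }
  assert (Yk : forall k, (1 + INR k) * y n1 <= y (n1 + k)%nat).
  { induction k as [|k IH]; [cbn [INR]; rewrite Nat.add_0_r; lra|].
    destruct (FarN (n1 + k)%nat ltac:(lia) (Big k)) as [_ [H2 _]].
    rewrite Nat.add_succ_r, S_INR. pose proof (Yp n1). pose proof (pos_INR k). nra. }
  destruct (INR_unbounded (6/5 / y n1)) as [k Hk].
  destruct (FarN (n1 + k)%nat ltac:(lia) (Big k)) as [H1 _].
  specialize (Yk k). pose proof (Yp n1).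
  assert (6/5 / y n1 * y n1 = 6/5) by (field; lra). nra.
Qed.
End Density.

(** * Local form of iterates *)

(** [g] takes the value [g z] with finite order [m]: at [z + h], the difference
    is [h^m] up to a factor that is continuous and nonzero at [h = 0].
    In this form the property composes. *)
Definition power_like (g : C -> C) (z : C) : Prop :=
  exists (m : nat) (q : C -> C), (1 <= m)%nat /\ q 0%C <> 0%C /\ Ccont q 0%C /\
    forall h, g (z + h)%C = (g z + h ^ m * q h)%C.

Lemma power_like_id z : power_like (fun w => w) z.
Proof.
  exists 1%nat, (fun _ => 1%C). split; [lia|]. split; [apply C1_nz|].
  split; [apply Ccont_const|]. intros h; cbn; ring.
Qed.

Lemma power_like_comp f g z : power_like g z -> power_like f (g z) -> power_like (fun w => f (g w)) z.
Proof.
  intros [m [q [Hm [Hq [Cq E]]]]] [n [s [Hn [Hs [Cs F]]]]].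
  exists (m * n)%nat, (fun h => q h ^ n * s (h ^ m * q h))%C.
  assert (Z : (0 ^ m * q 0 = 0)%C) by (destruct m; [lia|]; rewrite Cpow_S; ring).
  split; [nia|]. split; [|split].
  - rewrite Z. apply Cmult_neq_0; [now apply Cpow_nz|trivial].
  - apply Ccont_mult; [now apply Ccont_pow|].
    apply (Ccont_comp s (fun h => h ^ m * q h)%C); [now rewrite Z|].
    apply Ccont_mult; [apply Ccont_pow, Ccont_id|trivial].
  - intros h. rewrite E, F, Cpow_mult_l, Cpow_mult_r. ring.
Qed.

Lemma csum_exchange (a : nat -> nat -> C) m n :
  csum (fun i => csum (fun k => a i k) n) m = csum (fun k => csum (fun i => a i k) m) n.
Proof.
  induction m as [|m IH]; cbn [csum].
  - induction n as [|n IHn]; cbn; [trivial|]. rewrite <- IHn; ring.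
  - now rewrite IH, <- csum_plus.
Qed.

Lemma csum_0 n : csum (fun _ => 0%C) n = 0%C.
Proof. induction n as [|n IH]; cbn; [trivial|]. rewrite IH; ring. Qed.

(** Summing over the derivatives [i < p] isolates the root of unity [1]. *)
Lemma esum_total p (z : C) : (1 <= p)%nat -> csum (fun i => esum p i z) p = (INR p * Cexp z)%C.
Proof.
  intros Hp. unfold esum. rewrite csum_exchange.
  destruct p as [|m]; [lia|]. rewrite csum_first.
  rewrite (csum_ext (fun k => csum _ (S m)) (fun _ => 0%C)), csum_0.
  - change (omega (S m) ^ 0)%C with (RtoC 1).
    rewrite (csum_ext _ (fun _ => Cexp z)).
    + rewrite Cplus_0_r. clear. induction (S m) as [|n IH]; [cbn; ring|].
      cbn [csum]. rewrite IH, S_INR, RtoC_plus. ring.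
    + intros i _. rewrite Cpow_1_l, !Cmult_1_l. reflexivity.
  - intros k Hk. set (w := (omega (S m) ^ S k)%C).
    assert (G : ((w - 1) * csum (fun i => w ^ i) (S m) = 0)%C).
    { rewrite csum_geometric. unfold w.
      rewrite <- Cpow_mult_r, Nat.mul_comm, Cpow_mult_r, omega_pow_p, Cpow_1_l by trivial. ring. }
    rewrite (csum_ext _ (fun i => Cexp (w * z) * w ^ i)%C) by (intros; ring).
    rewrite (csum_scal _ (fun i => w ^ i)%C).
    destruct (Ceq_dec (csum (fun i => w ^ i)%C (S m)) 0) as [Q|Q]; [rewrite Q; ring|].
    exfalso. revert G. apply Cmult_neq_0; trivial. intros W.
    assert (W1 : w = 1%C) by (apply Ceq_minus, W).
    pose proof (Re_omega_pow (S m) (S k) ltac:(lia)) as L. fold w in L. rewrite W1 in L. cbn in L. lra.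
Qed.

Lemma exp_taylor n u : Cexp u = (csum (fun i => / INR (fact i) * u ^ i) n + exp_rem n u)%C.
Proof.
  induction n as [|n IH]; cbn [csum exp_rem]; [ring|]. rewrite IH at 1. ring.
Qed.

Lemma esum_taylor p n (z h : C) : exists R : C,
  esum p 0 (z + h) = (csum (fun i => / INR (fact i) * h ^ i * esum p i z) n + R)%C /\
  Cmod R <= INR p * (exp (Cmod z) * (Cmod h ^ n * exp (Cmod h))).
Proof.
  exists (csum (fun k => Cexp (omega p ^ k * z) * exp_rem n (omega p ^ k * h))%C p). split.
  - unfold esum at 1.
    rewrite (csum_ext _ (fun k => csum (fun i => / INR (fact i) * h ^ i * ((omega p ^ k) ^ i * Cexp (omega p ^ k * z)))%C n
      + Cexp (omega p ^ k * z) * exp_rem n (omega p ^ k * h))%C).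
    + rewrite csum_plus. f_equal. rewrite <- csum_exchange.
      apply csum_ext. intros i _. rewrite csum_scal. reflexivity.
    + intros k _. rewrite Cmult_plus_distr_l, Cexp_plus, (exp_taylor n (omega p ^ k * h)).
      cbn [Cpow]. rewrite Cmult_1_l, Cmult_plus_distr_l. f_equal.
      rewrite <- csum_scal. apply csum_ext; intros i _. rewrite Cpow_mult_l. ring.
  - apply csum_Cmod. intros k _. rewrite Cmod_mult. apply Rmult_le_compat; try apply Cmod_ge_0.
    + rewrite Cmod_Cexp. apply exp_monotone. apply Rle_trans with (1 := Rle_abs _).
      apply Rle_trans with (1 := re_le_Cmod _). rewrite Cmod_mult, Cmod_omega_pow; lra.
    + apply Rle_trans with (1 := exp_rem_bound _ _). rewrite Cmod_mult, Cmod_omega_pow, Rmult_1_l. lra.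
Qed.

(** Otherwise all derivatives at [z], which are periodic in their order, vanish,
    [esum p 0 z] included, and so does their sum [p * exp z]. *)
Lemma esum_some_derivative p (z : C) : (1 <= p)%nat ->
  exists m, (1 <= m)%nat /\ esum p m z <> 0%C /\ forall i, (1 <= i < m)%nat -> esum p i z = 0%C.
Proof.
  intros Hp.
  assert (Ex : exists m, (1 <= m <= p)%nat /\ esum p m z <> 0%C).
  { apply NNPP. intros Hno.
    assert (Z : forall i, (1 <= i <= p)%nat -> esum p i z = 0%C).
    { intros i Hi. apply NNPP. intros N. apply Hno. now exists i. }
    assert (T : csum (fun i => esum p i z) p = 0%C).
    { rewrite (csum_ext _ (fun _ => 0%C)); [apply csum_0|]. intros i Hi.
      destruct i as [|i]; [rewrite <- esum_p by trivial|]; apply Z; lia. }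
    rewrite esum_total in T by trivial. revert T. apply Cmult_neq_0; [|apply Cexp_neq_0].
    intros Q; apply RtoC_inj in Q. revert Q; apply not_0_INR; lia. }
  destruct Ex as [m0 [H1 H2]].
  assert (S : forall n, (forall i, (1 <= i < n)%nat -> esum p i z = 0%C) \/
     exists m, (1 <= m)%nat /\ esum p m z <> 0%C /\ forall i, (1 <= i < m)%nat -> esum p i z = 0%C).
  { induction n as [|n [IH|IH]]; [left; intros; lia| |now right].
    destruct (classic ((1 <= n)%nat /\ esum p n z <> 0%C)) as [[A B]|A].
    - right. now exists n.
    - left. intros i Hi. destruct (Nat.eq_dec i n) as [->|]; [|apply IH; lia].
      apply NNPP. intros N. apply A. split; [lia|trivial]. }
  destruct (S (Datatypes.S m0)) as [K|K]; trivial.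
  exfalso. apply H2, K. lia.
Qed.

Lemma Ccont_of_eps (g : C -> C) z :
  (forall eps, 0 < eps -> exists del, 0 < del /\
    forall w, Cmod (w - z) < del -> Cmod (g w - g z) < eps) -> Ccont g z.
Proof.
  intros H; split; apply Rcont_eps; intros eps He; destruct (H eps He) as [d [Hd K]];
    exists d; split; trivial; intros w Hw; apply Rle_lt_trans with (2 := K w Hw).
  - apply (re_le_Cmod (g w - g z)).
  - apply (Rabs_Im_le (g w - g z)).
Qed.

Lemma power_like_esum p (z : C) : (1 <= p)%nat -> power_like (esum p 0) z.
Proof.
  intros Hp. destruct (esum_some_derivative p z Hp) as [m [Hm [Hne Hz]]].
  set (a := (/ INR (fact m) * esum p m z)%C).
  assert (Ha : a <> 0%C).
  { apply Cmult_neq_0; trivial. rewrite <- RtoC_inv by apply INR_fact_neq_0.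
    intros Q; apply RtoC_inj in Q. revert Q. apply Rinv_neq_0_compat, INR_fact_neq_0. }
  exists m, (fun h => if Ceq_dec h 0 then a else (esum p 0 (z + h) - esum p 0 z) / h ^ m)%C.
  split; [trivial|]. split; [|split].
  - destruct (Ceq_dec 0 0); [trivial|contradiction].
  - assert (Bd : forall h : C, h <> 0%C -> Cmod h < 1 ->
      Cmod ((esum p 0 (z + h) - esum p 0 z) / h ^ m - a) <= INR p * (exp (Cmod z) * exp 1) * Cmod h).
    { intros h Hh Hh1. destruct (esum_taylor p (S m) z h) as [R [E BR]].
      assert (Tm : forall n, (n < m)%nat -> csum (fun i => / INR (fact i) * h ^ i * esum p i z)%C (S n) = esum p 0 z).
      { induction n as [|n IH]; intros Hn.
        - cbn. field.
        - change (csum ?b (S (S n))) with (csum b (S n) + b (S n))%C. rewrite IH by lia. cbn beta.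
          rewrite (Hz (S n)) by lia. ring. }
      assert (E2 : (esum p 0 (z + h) - esum p 0 z = h ^ m * a + R)%C).
      { rewrite E. change (csum ?b (S m)) with (csum b m + b m)%C.
        destruct m as [|m']; [lia|]. rewrite Tm by lia. unfold a. ring. }
      assert (Hp0 : (h ^ m)%C <> 0%C) by (now apply Cpow_nz).
      rewrite E2. replace ((h ^ m * a + R) / h ^ m - a)%C with (R / h ^ m)%C by (field; trivial).
      rewrite Cmod_div, Cmod_pow by trivial.
      apply Cmod_gt_0 in Hh. assert (Pm : 0 < Cmod h ^ m) by (now apply pow_lt).
      apply Rmult_le_reg_r with (Cmod h ^ m); trivial.
      unfold Rdiv. rewrite Rmult_assoc, Rinv_l, Rmult_1_r by lra.
      apply Rle_trans with (1 := BR).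
      replace (INR p * (exp (Cmod z) * exp 1) * Cmod h * Cmod h ^ m)
        with (INR p * (exp (Cmod z) * (Cmod h ^ S m * exp 1))) by (cbn [pow]; ring).
      apply Rmult_le_compat_l; [apply pos_INR|]. apply Rmult_le_compat_l; [apply Rlt_le, exp_pos|].
      apply Rmult_le_compat_l; [apply pow_le; lra|]. apply exp_monotone; lra. }
    apply Ccont_of_eps. intros eps He.
    set (K := INR p * (exp (Cmod z) * exp 1)).
    assert (HK : 0 < K).
    { unfold K. apply Rmult_lt_0_compat; [apply lt_0_INR; lia|]. apply Rmult_lt_0_compat; apply exp_pos. }
    exists (Rmin 1 (eps / K)). split; [apply Rmin_pos; [lra|now apply Rdiv_lt_0_compat]|].
    intros h Hh. replace (h - 0)%C with h in Hh by ring.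
    destruct (Ceq_dec 0 0) as [_|]; [|contradiction].
    destruct (Ceq_dec h 0) as [->|N].
    + replace (a - a)%C with (RtoC 0) by ring. now rewrite Cmod_0.
    + apply Rle_lt_trans with (1 := Bd h N (Rlt_le_trans _ _ _ Hh (Rmin_l _ _))). fold K.
      assert (Cmod h < eps / K) by (apply Rlt_le_trans with (1 := Hh), Rmin_r).
      apply Rmult_lt_compat_l with (r := K) in H; trivial.
      replace (K * (eps / K)) with eps in H by (field; lra). exact H.
  - intros h. destruct (Ceq_dec h 0) as [->|N].
    + rewrite Cplus_0_r. destruct m as [|m']; [lia|]. rewrite Cpow_S. ring.
    + assert (Hp0 : (h ^ m)%C <> 0%C) by (now apply Cpow_nz). field; trivial.
Qed.

(** The mean of [Im g] over a small circle around [z] is [Im (g z) = 0], so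
    [Im g] vanishes somewhere on it; [g] differs from [g z] there by its local
    form. *)
Lemma other_real_value (g g1 g2 : C -> C) z r : 0 < r ->
  (forall z, Cderiv g z (g1 z)) -> (forall z, Cderiv g1 z (g2 z)) ->
  power_like g z -> Im (g z) = 0 ->
  exists b, Cmod (b - z) < r /\ Im (g b) = 0 /\ g b <> g z.
Proof.
  intros Hr H1 H2 [m [q [Hm [Hq [Cq E]]]]] Hz.
  destruct (Ccont_eps q 0 Cq (Cmod (q 0%C)) (proj1 (Cmod_gt_0 _) Hq)) as [d [Hd K]].
  set (rho := Rmin (r / 2) (d / 2)).
  assert (R1 : 0 < rho) by (apply Rmin_pos; lra).
  assert (R2 : rho < r) by (apply Rle_lt_trans with (r / 2); [apply Rmin_l|lra]).
  assert (R3 : rho < d) by (apply Rle_lt_trans with (d / 2); [apply Rmin_r|lra]).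
  set (v := fun t => Im (g (circ z rho t))).
  assert (M : RInt v 0 (2 * PI) = 0).
  { transitivity (RInt (fun t => Re (- Ci * g (circ z rho t))%C) 0 (2 * PI)).
    - apply RInt_ext. intros t _.
      assert (Q : Im (g (circ z rho t)) = Re (- Ci * g (circ z rho t))%C) by (cbn; unfold Re, Im; ring).
      exact Q.
    - rewrite (circle_mean (fun w => - Ci * g w)%C (fun w => - Ci * g1 w)%C z r rho); [| | |lra].
      + replace (Re (- Ci * g z)%C) with (Im (g z)) by (cbn; unfold Re, Im; ring). rewrite Hz. apply Rmult_0_r.
      + intros w _. apply Cderiv_scal, H1.
      + intros w _. apply Ccont_mult; [apply Ccont_const|]. eapply Cderiv_cont, H2. }
  assert (Cv : forall t, continuous v t).
  { intros t. apply (Rcont_section (fun w => Im (g (circ z (Re w) (Im w)))) rho).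
    assert (HC : Ccont (fun w => g (circ z (Re w) (Im w))) (rho, t)); [|apply HC].
    apply (Ccont_comp g); [|apply Ccont_circ]. eapply Cderiv_cont, H1. }
  pose proof PI_RGT_0.
  assert (Zero : exists t, v t = 0).
  { assert (DV : forall t, is_derive (fun t => RInt v 0 t) t (v t)).
    { intros t. apply (is_derive_RInt v _ 0); [|apply Cv].
      exists (mkposreal 1 Rlt_0_1). intros s _. apply (RInt_correct (V := R_CompleteNormedModule)).
      apply (ex_RInt_continuous (V := R_CompleteNormedModule)). intros; apply Cv. }
    destruct (MVT_gen (fun t => RInt v 0 t) 0 (2 * PI) v) as [t [_ Et]].
    - intros t _. apply DV.
    - intros t _. apply derivable_continuous_pt. exists (v t). apply is_derive_Reals, DV.
    - exists t. rewrite M, RInt_point in Et. change (@zero R_CompleteNormedModule) with 0 in Et.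
      assert (P : v t * (2 * PI) = 0) by lra. apply Rmult_integral in P. destruct P; [trivial|lra]. }
  destruct Zero as [t Ht]. exists (circ z rho t). split; [|split].
  - rewrite Cmod_circ, Rabs_pos_eq; lra.
  - exact Ht.
  - unfold circ. rewrite E. set (h := (rho * unit_at t)%C).
    assert (Hh : Cmod h = rho) by (unfold h; rewrite Cmod_mult, Cmod_unit_at, Cmod_R, Rabs_pos_eq; lra).
    assert (h <> 0%C) by (apply Cmod_gt_0; lra).
    assert (Nq : q h <> 0%C).
    { intros Q. specialize (K h). replace (h - 0)%C with h in K by ring. specialize (K ltac:(lra)).
      rewrite Q in K. replace (0 - q 0)%C with (- q 0)%C in K by ring. rewrite Cmod_opp in K. lra. }
    intros Q. assert ((h ^ m * q h = 0)%C).
    { transitivity (g z + h ^ m * q h - g z)%C; [ring|]. rewrite Q; ring. }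
    revert H3. apply Cmult_neq_0; trivial. now apply Cpow_nz.
Qed.

Lemma other_real_modulus (g g1 g2 : C -> C) z r : 0 < r ->
  (forall z, Cderiv g z (g1 z)) -> (forall z, Cderiv g1 z (g2 z)) ->
  power_like g z -> Im (g z) = 0 ->
  exists b, Cmod (b - z) < r /\ Im (g b) = 0 /\ Cmod (g b) <> Cmod (g z).
Proof.
  intros Hr H1 H2 PL Hz.
  destruct (Ceq_dec (g z) 0) as [Z|Z].
  - destruct (other_real_value g g1 g2 z r Hr H1 H2 PL Hz) as [b [B1 [B2 B3]]].
    exists b. split; [trivial|]. split; [trivial|].
    rewrite Z, Cmod_0 in *. intros Q. now apply B3, Cmod_eq_0.
  - apply Cmod_gt_0 in Z.
    destruct (Ccont_eps g z (Cderiv_cont _ _ _ (H1 z)) _ Z) as [d [Hd K]].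
    destruct (other_real_value g g1 g2 z (Rmin r d) (Rmin_pos _ _ Hr Hd) H1 H2 PL Hz) as [b [B1 [B2 B3]]].
    exists b. split; [apply Rlt_le_trans with (1 := B1), Rmin_l|]. split; [trivial|].
    specialize (K b (Rlt_le_trans _ _ _ B1 (Rmin_r _ _))).
    assert (R : forall w : C, Im w = 0 -> w = RtoC (Re w)) by (intros w Hw; apply C_ext; cbn; trivial).
    rewrite (R _ B2), (R _ Hz) in K, B3 |- *. rewrite <- RtoC_minus, !Cmod_R in *.
    assert (N : Re (g b) <> Re (g z)) by (intros Q; apply B3; now rewrite Q).
    intros Q. unfold Rabs in *. repeat destruct Rcase_abs; lra.
Qed.

(** * Real orbits separate *)

Section RealOrbits.
Variables (p : nat) (lambda : R).
Hypothesis p_ge_2 : (2 <= p)%nat.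
Hypothesis p_even : Nat.Even p.
Hypothesis lambda_ge_1 : 1 <= Rabs lambda.

Let f := f_lambda p lambda.
(** The action of [f] on the moduli of real points. *)
Definition rstep (x : R) : R := Rabs lambda * rsum p 0 x.

Lemma power_like_f (z : C) : power_like f z.
Proof.
  destruct (power_like_esum p z ltac:(lia)) as [m [q [Hm [Hq [Cq E]]]]].
  assert (Hl : RtoC lambda <> 0%C).
  { intros Q; apply RtoC_inj in Q. rewrite Q, Rabs_R0 in lambda_ge_1. lra. }
  exists m, (fun h => lambda * q h)%C. split; [trivial|]. split; [now apply Cmult_neq_0|].
  split; [apply Ccont_mult; [apply Ccont_const|trivial]|].
  intros h. unfold f. rewrite !f_lambda_esum, E by lia. ring.
Qed.

Lemma f_real (z : C) : Im z = 0 -> Im (f z) = 0 /\ Cmod (f z) = rstep (Cmod z).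
Proof.
  intros Hz. assert (z = RtoC (Re z)) as Ez by (apply C_ext; cbn; trivial).
  set (x := Re z) in *. unfold f. rewrite f_lambda_esum by lia. rewrite Ez, esum0_rsum by lia.
  split; [cbn; ring|]. rewrite Cmod_mult, !Cmod_R. unfold rstep. f_equal.
  assert (A : rsum p 0 (Rabs x) = rsum p 0 x).
  { unfold Rabs; destruct (Rcase_abs x); trivial. unfold rsum. rewrite RtoC_opp.
    now rewrite (proj1 (esum_even p x p_ge_2 p_even)). }
  rewrite <- A. apply Rabs_pos_eq. pose proof (rsum_0_gt_id p (Rabs x) p_ge_2 (Rabs_pos x)).
  pose proof (Rabs_pos x). lra.
Qed.

Lemma f_real_iter n (z : C) : Im z = 0 ->
  Im (Nat.iter n f z) = 0 /\ Cmod (Nat.iter n f z) = Nat.iter n rstep (Cmod z).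
Proof.
  intros Hz. induction n as [|n [IH1 IH2]]; [now split|].
  cbn. change (Im (f (Nat.iter n f z)) = 0 /\ Cmod (f (Nat.iter n f z)) = rstep (Nat.iter n rstep (Cmod z))).
  rewrite <- IH2. now apply f_real.
Qed.

Lemma rstep_ge x : 0 <= x -> x + 1 <= rstep x.
Proof.
  intros Hx. pose proof (rsum_0_gt_id p x p_ge_2 Hx). unfold rstep. nra.
Qed.

Lemma rstep_iter_ge n x : 0 <= x -> x + INR n <= Nat.iter n rstep x.
Proof.
  intros Hx. induction n as [|n IH]; [cbn; lra|].
  pose proof (pos_INR n). rewrite S_INR. change (Nat.iter (S n) rstep x) with (rstep (Nat.iter n rstep x)).
  pose proof (rstep_ge (Nat.iter n rstep x) ltac:(lra)). lra.
Qed.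

Lemma rstep_bounds : exists X, 10 <= X /\ forall x, X <= x ->
  Rabs lambda * exp x / 2 <= rstep x <= 2 * (Rabs lambda * exp x) /\ 2 <= rsum p 1 x.
Proof.
  destruct (esum_dominated p (1/2) ltac:(lia) ltac:(lra)) as [eps [X [He [HX D]]]].
  exists (Rmax X 10). split; [apply Rmax_r|]. intros x Hx.
  assert (X1 : X <= x) by (apply Rle_trans with (2 := Hx), Rmax_l).
  assert (X2 : 10 <= x) by (apply Rle_trans with (2 := Hx), Rmax_r).
  assert (B : forall i, Rabs (rsum p i x - exp x) <= 1/2 * exp x).
  { intros i. assert (Hi : Rabs (Im x) <= eps * Re x) by (cbn; rewrite Rabs_R0; nra).
    apply Rle_trans with (2 := D i (RtoC x) X1 Hi).
    replace (rsum p i x - exp x) with (Re (esum p i x - Cexp x)%C).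
    - apply re_le_Cmod.
    - unfold rsum; cbn. rewrite cos_0. unfold Re; ring. }
  pose proof (B 0%nat) as B0. pose proof (B 1%nat) as B1.
  apply Rabs_le_between in B0. apply Rabs_le_between in B1.
  pose proof (exp_pos x). pose proof (exp_ineq1_le x). unfold rstep.
  split; [split; nra|lra].
Qed.

Lemma rstep_expands x y X : 0 <= x < y -> (forall t, x <= t -> X <= rsum p 1 t) -> 0 <= X ->
  X * (y - x) <= rstep y - rstep x.
Proof.
  intros Hxy HX X0.
  destruct (MVT_gen (rsum p 0) x y (rsum p 1)) as [c [Hc E]].
  - intros; apply is_derive_rsum.
  - intros t _. apply derivable_continuous_pt. exists (rsum p 1 t). apply is_derive_Reals, is_derive_rsum.
  - rewrite Rmin_left, Rmax_right in Hc by lra. unfold rstep. rewrite <- Rmult_minus_distr_l, E.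
    specialize (HX c ltac:(lra)).
    assert (X * (y - x) <= rsum p 1 c * (y - x)) by (apply Rmult_le_compat_r; lra).
    assert (0 <= rsum p 1 c * (y - x)) by (apply Rmult_le_pos; lra). nra.
Qed.

Lemma rstep_increasing x y : 0 <= x < y -> rstep x < rstep y.
Proof.
  intros Hxy. set (m := (x + y) / 2).
  assert (H1 : 0 * (m - x) <= rstep m - rstep x).
  { apply rstep_expands; [unfold m; lra| |lra]. intros t Ht. apply esum_real; [lia|lra]. }
  destruct (MVT_gen (rsum p 0) m y (rsum p 1)) as [c [Hc E]].
  - intros; apply is_derive_rsum.
  - intros t _. apply derivable_continuous_pt. exists (rsum p 1 t). apply is_derive_Reals, is_derive_rsum.
  - assert (Hm : x < m < y) by (unfold m; lra).
    rewrite Rmin_left, Rmax_right in Hc by lra.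
    pose proof (rsum_1_pos p c p_ge_2 ltac:(lra)).
    assert (0 < rsum p 1 c * (y - m)) by (apply Rmult_lt_0_compat; lra).
    unfold rstep in *. nra.
Qed.

Lemma rstep_iter_increasing n x y : 0 <= x < y -> Nat.iter n rstep x < Nat.iter n rstep y.
Proof.
  intros H. induction n as [|n IH]; [cbn; lra|].
  apply rstep_increasing. split; [|exact IH].
  change (0 <= Nat.iter n rstep x). pose proof (rstep_iter_ge n x ltac:(lra)). pose proof (pos_INR n). lra.
Qed.

(** Far out the difference of the two orbits at least doubles, so it becomes
    large.  One exponential step turns a large difference into a large quotient,
    and a second step turns it into a large quotient of logarithms. *)
Lemma real_orbits_log_gap x y K : 0 <= x < y -> 1 <= K ->
  exists N, forall n, (N <= n)%nat ->
    0 < Nat.iter n rstep x /\ K * ln (Nat.iter n rstep x) < ln (Nat.iter n rstep y).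
Proof.
  intros Hxy HK. set (a := fun n => Nat.iter n rstep x). set (b := fun n => Nat.iter n rstep y).
  destruct rstep_bounds as [X [HX B]].
  assert (Al : forall n, INR n <= a n) by (intros n; pose proof (rstep_iter_ge n x ltac:(lra)); unfold a; lra).
  assert (Ab : forall n, a n < b n) by (intros n; now apply rstep_iter_increasing).
  destruct (INR_unbounded X) as [N0 HN0].
  assert (AX : forall n, (N0 <= n)%nat -> X <= a n).
  { intros n Hn. specialize (Al n). apply le_INR in Hn. lra. }
  set (d := fun n => b n - a n).
  assert (Dd : forall n, (N0 <= n)%nat -> 2 * d n <= d (S n)).
  { intros n Hn. unfold d. pose proof (AX n Hn). pose proof (Ab n).
    change (b (S n)) with (rstep (b n)). change (a (S n)) with (rstep (a n)).
    apply rstep_expands; [lra| |lra]. intros t Ht. apply (B t). lra. }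
  assert (Dk : forall k, (1 + INR k) * d N0 <= d (N0 + k)%nat).
  { assert (D0 : 0 < d N0) by (specialize (Ab N0); unfold d; lra).
    induction k as [|k IH]; [rewrite Nat.add_0_r; cbn [INR]; lra|].
    rewrite Nat.add_succ_r, S_INR. specialize (Dd (N0 + k)%nat ltac:(lia)). pose proof (pos_INR k). nra. }
  set (L := ln (Rabs lambda)).
  assert (L0 : 0 <= L).
  { unfold L. rewrite <- ln_1. destruct (Rle_lt_or_eq_dec _ _ lambda_ge_1) as [H|H].
    - apply Rlt_le, ln_increasing; lra.
    - rewrite <- H; lra. }
  assert (Lower : forall t, X <= t -> L + t - 1 <= ln (rstep t)).
  { intros t Ht. destruct (B t Ht) as [[H1 _] _]. pose proof (exp_pos t) as E. pose proof (exp_ineq1_le 1).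
    replace (L + t - 1) with (ln (Rabs lambda * exp t * / exp 1)).
    - apply Rcomplements.ln_le; [repeat apply Rmult_lt_0_compat; try lra; apply Rinv_0_lt_compat, exp_pos|].
      apply Rle_trans with (2 := H1). apply Rmult_le_compat_l; [nra|].
      apply Rinv_le_contravar; lra.
    - rewrite !ln_mult, ln_Rinv, !ln_exp; try apply Rmult_lt_0_compat; try lra; try apply Rinv_0_lt_compat; try apply exp_pos.
      unfold L; ring. }
  assert (Upper : forall t, X <= t -> 0 < rstep t -> ln (rstep t) <= L + t + 1).
  { intros t Ht Hp. destruct (B t Ht) as [[_ H2] _]. pose proof (exp_pos t) as E. pose proof (exp_ineq1_le 1).
    replace (L + t + 1) with (ln (exp 1 * (Rabs lambda * exp t))).
    - apply Rcomplements.ln_le; [trivial|]. apply Rle_trans with (1 := H2). apply Rmult_le_compat_r; [nra|lra].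
    - rewrite !ln_mult, !ln_exp; try apply Rmult_lt_0_compat; try lra; try apply exp_pos. unfold L; ring. }
  (* A difference [8 * K] makes the quotient of [b] and [a] at least [2 * K] one
     step later, and [L + 4 <= a] absorbs the additive constants of [Lower] and
     [Upper]. *)
  destruct (INR_unbounded (8 * K / d N0)) as [k0 Hk0].
  destruct (INR_unbounded (L + 4)) as [N1 HN1].
  exists (S (S (N0 + (k0 + N1)))). intros n Hn.
  destruct n as [|[|n]]; [lia|lia|].
  assert (HnN : (N0 + (k0 + N1) <= n)%nat) by lia.
  assert (Big : 8 * K <= d n).
  { assert (D0 : 0 < d N0) by (specialize (Ab N0); unfold d; lra).
    specialize (Dk (n - N0)%nat). replace (N0 + (n - N0))%nat with n in Dk by lia.
    assert (Ik : INR k0 <= INR (n - N0)) by (apply le_INR; lia).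
    assert (8 * K = 8 * K / d N0 * d N0) by (field; lra). nra. }
  pose proof (AX n ltac:(lia)) as A0. pose proof (AX (S n) ltac:(lia)) as A1.
  pose proof (Ab n) as C0. pose proof (Ab (S n)) as C1.
  assert (Ratio : 2 * K * a (S n) <= b (S n)).
  { destruct (B (a n) A0) as [[_ U] _]. destruct (B (b n) ltac:(lra)) as [[Lo _] _].
    change (b (S n)) with (rstep (b n)). change (a (S n)) with (rstep (a n)).
    apply Rle_trans with (2 := Lo). apply Rle_trans with (2 * K * (2 * (Rabs lambda * exp (a n)))).
    - apply Rmult_le_compat_l; lra.
    - replace (b n) with (a n + d n) by (unfold d; ring). rewrite exp_plus.
      pose proof (exp_pos (a n)). pose proof (exp_ineq1_le (d n)).
      assert (P : 0 < Rabs lambda * exp (a n)) by (apply Rmult_lt_0_compat; lra).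
      apply Rle_trans with (Rabs lambda * exp (a n) * (8 * K) / 2); [apply Req_le; field|].
      replace (Rabs lambda * (exp (a n) * exp (d n))) with (Rabs lambda * exp (a n) * exp (d n)) by ring.
      apply Rmult_le_compat_r; [lra|]. apply Rmult_le_compat_l; lra. }
  pose proof (Al (S n)) as I1.
  assert (I2 : INR N1 <= INR (S n)) by (apply le_INR; lia).
  fold (a (S (S n))) (b (S (S n))). pose proof (AX (S (S n)) ltac:(lia)) as A2.
  split; [lra|].
  pose proof (Lower (b (S n)) ltac:(lra)) as Q1.
  pose proof (Upper (a (S n)) A1 ltac:(change (rstep (a (S n))) with (a (S (S n))); lra)) as Q2.
  change (rstep (b (S n))) with (b (S (S n))) in Q1. change (rstep (a (S n))) with (a (S (S n))) in Q2.
  apply Rmult_le_compat_l with (r := K) in Q2; [|lra].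
  apply Rle_lt_trans with (1 := Q2).
  nra.
Qed.
End RealOrbits.

(** * Spherical distance *)

(** The spherical distance is at least the chordal one. *)
Lemma asin_small c : 0 <= c -> 2 * asin (c / 2) < 1/10 -> c < 1/10.
Proof.
  intros Hc H. destruct (Rle_or_lt 1 (c / 2)) as [L|L].
  - exfalso. assert (A : asin (c / 2) = PI / 2).
    { unfold asin. destruct (Rle_dec (c / 2) (-1)); [lra|]. destruct (Rle_dec 1 (c / 2)); lra. }
    pose proof PI2_3_2. lra.
  - pose proof (sin_asin (c / 2) ltac:(lra)) as S.
    destruct (Rle_or_lt (asin (c / 2)) 0) as [N|N].
    + assert (sin (asin (c / 2)) <= 0); [|lra].
      destruct (Req_dec (asin (c / 2)) 0) as [->|]; [rewrite sin_0; lra|].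
      apply Rlt_le, sin_lt_0_var; [|lra]. pose proof (asin_bound (c / 2)). pose proof PI_RGT_0. lra.
    + pose proof (sin_lt_x _ N). lra.
Qed.

Lemma sqrt_one_plus_sq x : 0 <= x -> 1 <= sqrt (1 + x ^ 2) <= 1 + x.
Proof.
  intros Hx. split.
  - rewrite <- sqrt_1 at 1. apply sqrt_le_1_alt. nra.
  - rewrite <- (sqrt_pow2 (1 + x)) by lra. apply sqrt_le_1_alt. nra.
Qed.

Lemma spherical_Cmod_gap (a b : C) : spherical_dist (Some a) (Some b) < 1/10 ->
  20 * (Cmod a - Cmod b) < (1 + Cmod a) * (1 + Cmod b).
Proof.
  intros H. pose proof (sqrt_one_plus_sq _ (Cmod_ge_0 a)) as [A1 A2].
  pose proof (sqrt_one_plus_sq _ (Cmod_ge_0 b)) as [B1 B2].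
  pose proof (Cmod_ge_0 a). pose proof (Cmod_ge_0 b). pose proof (Cmod_ge_0 (a - b)).
  assert (P : 0 < sqrt (1 + Cmod a ^ 2) * sqrt (1 + Cmod b ^ 2)) by nra.
  apply asin_small in H.
  - cbn [chordal_dist] in H.
    apply Rmult_lt_compat_r with (r := sqrt (1 + Cmod a ^ 2) * sqrt (1 + Cmod b ^ 2)) in H; trivial.
    unfold Rdiv in H at 1. rewrite Rmult_assoc, Rinv_l, Rmult_1_r in H by lra.
    assert (sqrt (1 + Cmod a ^ 2) * sqrt (1 + Cmod b ^ 2) <= (1 + Cmod a) * (1 + Cmod b)) by (apply Rmult_le_compat; lra).
    pose proof (Cmod_triangle (a - b) b) as T. replace (a - b + b)%C with a in T by ring. lra.
  - cbn [chordal_dist]. apply Rmult_le_pos; [lra|]. apply Rlt_le, Rinv_0_lt_compat, P.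
Qed.

Lemma spherical_infinity_Cmod (a : C) : spherical_dist (Some a) None < 1/10 -> 1 <= Cmod a.
Proof.
  intros H. pose proof (sqrt_one_plus_sq _ (Cmod_ge_0 a)) as [A1 A2].
  apply asin_small in H.
  - cbn [chordal_dist] in H.
    apply Rmult_lt_compat_r with (r := sqrt (1 + Cmod a ^ 2)) in H; [|lra].
    unfold Rdiv in H at 1. rewrite Rmult_assoc, Rinv_l, Rmult_1_r in H by lra. lra.
  - cbn [chordal_dist]. apply Rmult_le_pos; [lra|]. apply Rlt_le, Rinv_0_lt_compat; lra.
Qed.

Lemma spherical_dist_sym a b : spherical_dist a b = spherical_dist b a.
Proof.
  unfold spherical_dist. do 3 f_equal. destruct a as [a|], b as [b|]; cbn; trivial.
  rewrite (Rmult_comm (sqrt (1 + Cmod a * _))). f_equal. f_equal.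
  rewrite <- Cmod_opp. f_equal. ring.
Qed.

(** Two values of the sequence close to the same limit [h], one of them near
    infinity, are both outside the unit disc.  The comparison through [h] works
    for a limit that is an arbitrary function of the point. *)
Lemma large_of_close (a b : C) h : 10 <= Cmod a ->
  spherical_dist (Some a) h < 1/10 -> spherical_dist (Some b) h < 1/10 -> 1 <= Cmod b.
Proof.
  intros Ha H1 H2. destruct h as [c|]; [|now apply spherical_infinity_Cmod].
  rewrite spherical_dist_sym in H2.
  apply spherical_Cmod_gap in H1. apply spherical_Cmod_gap in H2.
  pose proof (Cmod_ge_0 c). pose proof (Cmod_ge_0 b).
  destruct (Rle_or_lt 1 (Cmod b)); trivial. nra.
Qed.

Lemma locally_disc (z : C) (V : C -> Prop) : locally z V ->
  exists r, 0 < r /\ forall w, Cmod (w - z) < r -> V w.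
Proof.
  intros [eps H]. exists eps. split; [apply cond_pos|]. intros w Hw. apply H.
  apply C_NormedModule_mixin_compat1. exact Hw.
Qed.

Lemma increasing_ge_id (phi : nat -> nat) : (forall k, (phi k < phi (S k))%nat) -> forall k, (k <= phi k)%nat.
Proof. intros H k; induction k as [|k IH]; [lia|]. specialize (H k). lia. Qed.

Theorem theorem1p2 (p : nat) (hp3 : (3 <= p)%nat) (hpeven : Nat.Even p)
    (lambda : R) (hlambda : (1 <= Rabs lambda)%R) :
  forall z : C, Julia (f_lambda p lambda) z.
Proof.
  intros z0 [U [HU [Uz Norm]]].
  set (f := f_lambda p lambda) in *.
  assert (p2 : (2 <= p)%nat) by lia.
  destruct (locally_disc z0 U (HU z0 Uz)) as [r0 [Hr0 Hdisc]].
  destruct (disc_meets_real_preimage p lambda p2 hpeven hlambda z0 r0 Hr0) as [N [z1 [Hz1 Im1]]].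
  fold f in Im1. assert (Uz1 : U z1) by now apply Hdisc.
  destruct (Norm (fun k => Nat.iter k f) (fun k => ex_intro _ k eq_refl)) as [phi [Hphi [h Hcv]]].
  destruct (Hcv z1 Uz1) as [V [HV Hunif]].
  destruct (Hunif (1/10) ltac:(lra)) as [k1 Hk1].
  pose proof (increasing_ge_id phi Hphi) as Hge.
  assert (Real : forall b n, Im (Nat.iter N f b) = 0 ->
    Cmod (Nat.iter (n + N) f b) = Nat.iter n (rstep p lambda) (Cmod (Nat.iter N f b))).
  { intros b n Hb. rewrite Nat.iter_add. now apply f_real_iter. }
  (* The iterate [phi k2] is large at [z1], hence near [z1]; all later ones of the
     subsequence are close to the same limit there. *)
  set (k2 := (k1 + N + 20)%nat).
  assert (Large : 20 <= Cmod (Nat.iter (phi k2) f z1)).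
  { specialize (Hge k2). replace (phi k2) with ((phi k2 - N) + N)%nat by (unfold k2 in *; lia).
    rewrite Real by trivial.
    pose proof (rstep_iter_ge p lambda p2 hlambda (phi k2 - N) (Cmod (Nat.iter N f z1)) (Cmod_ge_0 _)) as G.
    pose proof (Cmod_ge_0 (Nat.iter N f z1)).
    assert (I : INR 20 <= INR (phi k2 - N)) by (apply le_INR; unfold k2 in *; lia).
    cbn [INR] in I. lra. }
  pose proof (Cderiv_f p lambda p2) as D0. pose proof (Cderiv_f1 p lambda) as D1. pose proof (Ccont_f2 p lambda) as C2.
  fold f in D0.
  set (f1 := fun z : C => (lambda * esum p 1 z)%C) in *. set (f2 := fun z : C => (lambda * esum p 2 z)%C) in *.
  destruct (Ccont_eps _ z1 (Ccont_iter f f1 D0 (phi k2) z1) 10 ltac:(lra)) as [r2 [Hr2 Hnear]].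
  destruct (locally_disc z1 V HV) as [r1 [Hr1 HV1]].
  destruct (locally_disc z1 U (HU z1 Uz1)) as [r3 [Hr3 HU1]].
  set (r := Rmin r1 (Rmin r2 r3)).
  assert (Hr : 0 < r) by (repeat apply Rmin_pos; trivial).
  assert (Omit : forall j w, (k2 <= j)%nat -> Cmod (w - z1) < r -> 1 <= Cmod (Nat.iter (phi j) f w)).
  { intros j w Hj Hw.
    assert (W1 : V w) by (apply HV1, Rlt_le_trans with (1 := Hw), Rmin_l).
    assert (W2 : Cmod (w - z1) < r2) by (apply Rlt_le_trans with (1 := Hw); eapply Rle_trans; [apply Rmin_r|apply Rmin_l]).
    assert (W3 : U w) by (apply HU1, Rlt_le_trans with (1 := Hw); eapply Rle_trans; [apply Rmin_r|apply Rmin_r]).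
    apply (large_of_close (Nat.iter (phi k2) f w) _ (h w)).
    - specialize (Hnear w W2).
      pose proof (Cmod_triangle (Nat.iter (phi k2) f w) (- (Nat.iter (phi k2) f w - Nat.iter (phi k2) f z1))) as T.
      replace (Nat.iter (phi k2) f w + - (Nat.iter (phi k2) f w - Nat.iter (phi k2) f z1))%C
        with (Nat.iter (phi k2) f z1) in T by ring. rewrite Cmod_opp in T. lra.
    - apply Hk1; trivial. unfold k2; lia.
    - apply Hk1; trivial. unfold k2 in *; lia. }
  assert (PL : forall n z, power_like (Nat.iter n f) z).
  { induction n as [|n IH]; intros z; [apply power_like_id|].
    apply (power_like_comp f (Nat.iter n f)); trivial. apply power_like_f; trivial. }
  assert (Other : exists b, Cmod (b - z1) < r / 4 /\ Im (Nat.iter N f b) = 0 /\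
    Cmod (Nat.iter N f b) <> Cmod (Nat.iter N f z1)).
  { apply (other_real_modulus _ _ _ z1 (r / 4) ltac:(lra) (Cderiv_iter f f1 D0 N)
      (Cderiv_iter_d f f1 f2 D0 D1 N)); trivial. }
  destruct Other as [b [Hb [Imb Nb]]].
  assert (Hz : Cmod (z1 - z1) < r / 4).
  { replace (z1 - z1)%C with (RtoC 0) by ring. rewrite Cmod_0. lra. }
  assert (Contra : forall u v : C, Cmod (u - z1) < r / 4 -> Cmod (v - z1) < r / 4 ->
    Im (Nat.iter N f u) = 0 -> Im (Nat.iter N f v) = 0 -> Cmod (Nat.iter N f u) < Cmod (Nat.iter N f v) -> False).
  { intros u v Hu Hv Iu Iv L.
    destruct (real_orbits_log_gap p lambda p2 hlambda _ _ (exp 2) (conj (Cmod_ge_0 (Nat.iter N f u)) L)) as [M HM].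
    { pose proof (exp_ineq1_le 2). lra. }
    set (j := (k2 + M + N)%nat). specialize (Hge j).
    destruct (HM (phi j - N)%nat) as [_ G]; [unfold j in *; lia|].
    rewrite <- !Real in G by trivial.
    replace (phi j - N + N)%nat with (phi j) in G by (unfold j in *; lia).
    pose proof (log_harnack _ _ _ z1 r u v Hr (Cderiv_iter f f1 D0 (phi j)) (Cderiv_iter_d f f1 f2 D0 D1 (phi j))
      (Ccont_iter_d2 f f1 f2 D0 D1 C2 (phi j)) (fun w => Omit j w ltac:(unfold j; lia)) Hu Hv). lra. }
  destruct (Rtotal_order (Cmod (Nat.iter N f b)) (Cmod (Nat.iter N f z1))) as [L|[L|L]].
  - exact (Contra b z1 Hb Hz Imb Im1 L).
  - contradiction.
  - exact (Contra z1 b Hz Hb Im1 Imb L).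
Qed.
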